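(* Let $X$ be a complex projective abelian surface, $n\geq2$, $S^+=H^{even}(X,\mathbb{Z})$, and $w=(1,0,-(n+1))\in S^+$. Let $h\in S^+$ satisfy $(h,w)=0$ and $(h,h)<0$. Set $d:=(w,w)(h,h)/4$. The restriction of the universal torus $\mathcal{T}\to\Omega_{w^\perp}$ to the four dimensional subspace $\Omega_{\{w,h\}^\perp}\subset\Omega_{w^\perp}$, consisting of periods $\ell$ orthogonal to $h$, is a complete family of polarized abelian fourfolds of Weil type of discriminant $1$ with complex multiplication by $\mathbb{Q}[\sqrt{-d}]$.
   Context: **Lattices and Clifford action.** $V:=H^1(X,\mathbb{Z})\oplus H^1(X,\mathbb{Z})^*$ with $((a_1,a_2),(b_1,b_2))_V=b_2(a_1)+a_2(b_1)$. $S:=H^*(X,\mathbb{Z})$, $S^-:=H^{odd}(X,\mathbb{Z})$, $(s,t)_S=\int_X\tau(s)\cup t$ with $\tau$ acting on $H^i$ by $(-1)^{i(i-1)/2}$; on $S^+$: $((r,c,s),(r',c',s'))=rs'+r's-\int_Xc\cup c'$. $V$ acts on $S$ by the Clifford action: $a\in H^1(X,\mathbb{Z})$ by $a\wedge(\bullet)$ and $\theta\in H^1(X,\mathbb{Z})^*$ by contraction $D_\theta$. For $y\in S^+$, $m_y:V\to S^-$ is $m_y(v)=v\cdot y$, and $m_y:S^-\to V$ is its adjoint, $(m_y(t),v)_V=(v\cdot y,t)_S$. **Period domain and torus.** $\Omega_{w^\perp}=\{\ell\in\mathbb{P}(w^\perp\otimes\mathbb{C}):(\ell,\ell)=0,(\ell,\bar\ell)<0\}$,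 of dimension $5$. For $\ell\in\Omega_{w^\perp}$, $Z_\ell:=\{v\in V_{\mathbb{C}}:v\cdot\ell=0\}$ is a maximal isotropic subspace transversal to its conjugate $Z_{\bar\ell}$, and $V$ has the weight $1$ Hodge structure with $V^{1,0}=Z_\ell$. The universal torus $\mathcal{T}\to\Omega_{w^\perp}$ has fibers $T_\ell:=V_{\mathbb{C}}/[Z_\ell+V]$. For $\ell$ orthogonal to $h$, the polarization of $T_\ell$ is, up to sign, the class $\Theta_h\in\wedge^2V^*$, $\Theta_h(x,y)=(\Theta'_h(x),y)_V$, and $\sqrt{-d}$ acts by the endomorphism $\Theta'_h:=m_w\circ m_h:V\to V$. **Weil type.** A polarized abelian fourfold of Weil type $(A,K,\Theta)$ consists of an abelian fourfold $A$, an embedding $\eta$ of an imaginary quadratic field $K=\mathbb{Q}[\sqrt{-d}]$ in $\mathrm{End}(A)\otimes\mathbb{Q}$ such that the $\pm\sqrt{-d}$-eigenspaces of $\eta(\sqrt{-d})$ on $H^{1,0}(A)$ are both $2$-dimensional, and an ample class $\Theta\in H^{1,1}(A,\mathbb{Z})$ with $\eta(\sqrt{-d})^*\Theta=d\,\Theta$. Its discriminant is the class in $\mathbb{Q}^*/Nm(K^* )$ of the determinant of the matrix, in any $K$-basis of $H_1(A,\mathbb{Q})$, of the Hermitian form $H(x,y)=\Theta(x,\eta(\sqrt{-d})y)+\sqrt{-d}\,\Theta(x,y)$, where $Nm(a+b\sqrt{-d})=a^2+db^2$; discriminant $1$ means the class is trivial. Polarized abelian fourfolds of Weil type come in $4$-dimensional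 families; ''complete'' means a full $4$-dimensional such family. *)

(* Defs.v *)
From HB Require Import structures.
From mathcomp Require Import all_boot all_order all_algebra.
From mathcomp Require Import all_classical all_reals all_analysis.
From mathcomp Require Import complex ring.

Set Implicit Arguments.
Unset Strict Implicit.
Unset Printing Implicit Defensive.

Import Order.TTheory GRing.Theory Num.Theory numFieldNormedType.Exports.
Local Open Scope ring_scope.

Section Exterior.
Variable A : comNzRingType.

(* The exterior algebra of A^4: coordinates are indexed by the subsets of 'I_4,
   {i_1 < ... < i_k} standing for e_(i_1) /\ ... /\ e_(i_k). *)
Definition ext := 'rV[A]_#|{set 'I_4}|.

Definition coef (s : ext) (I : {set 'I_4}) : A := s 0 (enum_rank I).

Definition mono (I : {set 'I_4}) : ext := delta_mx 0 (enum_rank I).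

Definition inversions (I J : {set 'I_4}) : nat :=
  #|[set p : 'I_4 * 'I_4 | [&& p.1 \in I, p.2 \in J & (p.2 < p.1)%N]]|.

Definition cup (s t : ext) : ext :=
  \sum_(I : {set 'I_4}) \sum_(J : {set 'I_4} | [disjoint I & J])
    ((-1) ^+ inversions I J * coef s I * coef t J) *: mono (I :|: J).

Definition of_deg1 (a : 'rV[A]_4) : ext := \sum_i a 0 i *: mono [set i].

(* The antiderivation of degree -1 that extends theta. *)
Definition contract (theta : 'rV[A]_4) (s : ext) : ext :=
  \sum_(I : {set 'I_4}) \sum_(i in I)
    ((-1) ^+ #|[set j in I | (j < i)%N]| * theta 0 i * coef s I)
      *: mono (I :\ i).

(* v = (a, theta), with a in H^1 and theta in its dual. *)
Definition clifford (v : 'rV[A]_(4 + 4)) (s : ext) : ext :=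
  cup (of_deg1 (lsubmx v)) s + contract (rsubmx v) s.

Definition pairV (u v : 'rV[A]_(4 + 4)) : A :=
  (lsubmx u *m (rsubmx v)^T + rsubmx u *m (lsubmx v)^T) 0 0.

Definition tau (s : ext) : ext :=
  \sum_(I : {set 'I_4}) ((-1) ^+ (#|I| * #|I|.-1)%N./2 * coef s I) *: mono I.

Definition is_even (s : ext) : Prop :=
  forall I : {set 'I_4}, odd #|I| -> coef s I = 0.

End Exterior.

Lemma clifford_linear (A : comNzRingType) (y : ext A) (a : A)
    (u v : 'rV[A]_(4 + 4)) :
  clifford (a *: u + v) y = a *: clifford u y + clifford v y.
Proof.
rewrite /clifford scalerDr addrACA; congr (_ + _).
  have coef1 b I : coef (of_deg1 b) I = \sum_i b 0 i * coef (mono A [set i]) I.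
    by rewrite /coef /of_deg1 summxE; apply: eq_bigr => i _; rewrite mxE.
  rewrite /cup scaler_sumr -big_split; apply: eq_bigr => I _.
  rewrite scaler_sumr -big_split; apply: eq_bigr => J _ /=.
  rewrite scalerA -scalerDl !coef1; congr (_ *: _).
  have -> : \sum_i lsubmx (a *: u + v) 0 i * coef (mono A [set i]) I =
      a * (\sum_i lsubmx u 0 i * coef (mono A [set i]) I) +
      \sum_i lsubmx v 0 i * coef (mono A [set i]) I.
    rewrite mulr_sumr -big_split; apply: eq_bigr => i _ /=.
    by rewrite !mxE mulrDl mulrA.
  by ring.
rewrite /contract scaler_sumr -big_split; apply: eq_bigr => I _.
rewrite scaler_sumr -big_split; apply: eq_bigr => i _ /=.
by rewrite scalerA -scalerDl !mxE; congr (_ *: _); ring.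
Qed.

Lemma lin1_mxE (A : comNzRingType) m n (f : 'rV[A]_m -> 'rV[A]_n) :
  linear f -> forall u, u *m lin1_mx f = f u.
Proof.
move=> lin_f u.
pose fL : {linear 'rV[A]_m -> 'rV[A]_n} :=
  HB.pack f (GRing.isLinear.Build _ _ _ _ f lin_f).
by rewrite -[f]/(fL : _ -> _) mul_rV_lin1.
Qed.

Lemma coefP (A : comNzRingType) (a : A) (s t : ext A) I :
  coef (a *: s + t) I = a * coef s I + coef t I.
Proof. by rewrite /coef !mxE. Qed.

Lemma coef_mono (A : comNzRingType) (I J : {set 'I_4}) :
  coef (mono A I) J = (J == I)%:R.
Proof. by rewrite /coef /mono mxE eqxx /= (inj_eq enum_rank_inj). Qed.

Lemma coef_tau (A : comNzRingType) (s : ext A) I :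
  coef (tau s) I = (-1) ^+ (#|I| * #|I|.-1)%N./2 * coef s I.
Proof.
rewrite {1}/coef /tau summxE (bigD1 I) //= big1 => [|J neJI]; rewrite !mxE eqxx /=.
  by rewrite eqxx mulr1 addr0.
by rewrite (inj_eq enum_rank_inj) eq_sym (negbTE neJI) mulr0.
Qed.

Definition Cplx (R : realType) : numClosedFieldType := R[i].

Section Tori.
Variable R : realType.
Let C := Cplx R.

Definition conj_mx m N (F : 'M[C]_(m, N)) : 'M[C]_(m, N) := map_mx Num.conj F.

(* A subspace F of C^N (the row space of a matrix) such that C^N is the direct
   sum of F and its conjugate encodes the complex torus C^N / (F + Z^N), of
   dimension N / 2, with first homology lattice Z^N and Lie algebra C^N / F. *)
Definition is_torus N (F : 'M[C]_N) : Prop :=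
  (\rank F).*2 = N /\ \rank (F :&: conj_mx F)%MS = 0%N.

Definition bilin (A : comNzRingType) N (E : 'M[A]_N) (x y : 'rV[A]_N) : A :=
  (x *m E *m y^T) 0 0.

(* The Riemann conditions for the integral alternating form E on Z^N: type
   (1,1), and E(ix, x) > 0 for x real and nonzero, where i acts on R^N through
   R^N = C^N / F.  If x = u + conj u with u in F, then ix = i conj u - i u, and
   E(ix, x) = 2i E(conj u, u). *)
Definition is_polarization N (F : 'M[C]_N) (E : 'M[int]_N) : Prop :=
  [/\ E^T = - E,
      F *m map_mx intr E *m F^T = 0 &
      forall u : 'rV[C]_N, (u <= F)%MS -> u != 0 ->
        0 < 'i * bilin (map_mx intr E) (conj_mx u) u].

(* The holomorphic 1-forms of the torus: the functionals v |-> v *m phi^T on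
   C^N that vanish on F. *)
Definition H10 N (F : 'M[C]_N) : 'M[C]_N := kermx F^T.

(* Columns 2k and 2k+1 are the real and imaginary parts of the k-th complex
   coordinate, so that \det is positive exactly when the rows are a positively
   oriented real basis of C^2. *)
Definition real_coords (P : 'M[C]_(4, 2)) : 'M[C]_4 :=
  \matrix_(i, j) (if odd j then 'Im (P i (inord j./2))
                  else 'Re (P i (inord j./2))).

(* C^2 / Lambda, where the rows of [period] are a basis of Lambda.  The basis
   of H^1(X, Z) = Hom(Lambda, Z) is the dual one, and H^*(X, Z) is
   [ext int], the exterior algebra of H^1(X, Z). *)
Record abelian_surface := AbelianSurface {
  period : 'M[C]_(4, 2);
  period_lattice : real_coords period \in unitmx;
  period_projective : exists E : 'M[int]_4, is_polarization (kermx period) E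
}.

End Tori.

Section MukaiLattice.
Variables (R : realType) (X : abelian_surface R).

Section Coefficients.
Variable A : comNzRingType.

Definition orientation : A :=
  if 0 < \det (real_coords (period X)) then 1 else -1.

(* The dual basis satisfies \int_X e_0 /\ e_1 /\ e_2 /\ e_3 = orientation. *)
Definition integral (s : ext A) : A := orientation * coef s [set: 'I_4].

Definition pairS (s t : ext A) : A := integral (cup (tau s) t).

Definition pt_class : ext A := orientation *: mono A [set: 'I_4].

(* The adjoint S^- -> V of v |-> v . y; see m_adjP. *)
Definition m_adj (y t : ext A) : 'rV[A]_(4 + 4) :=
  row_mx (\row_i pairS (clifford (row_mx 0 (delta_mx 0 i)) y) t)
         (\row_i pairS (clifford (row_mx (delta_mx 0 i) 0) y) t).

End Coefficients.

Definition w_vec (n : nat) : ext int := mono int finset.set0 - pt_class int *+ n.+1.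

Definition theta_end (n : nat) (h : ext int) : 'M[int]_(4 + 4) :=
  lin1_mx (fun v => m_adj (w_vec n) (clifford v h)).

Definition theta_form (n : nat) (h : ext int) : 'M[int]_(4 + 4) :=
  \matrix_(i, j) pairV (delta_mx 0 i *m theta_end n h) (delta_mx 0 j).

Definition weil_d (n : nat) (h : ext int) : rat :=
  (pairS (w_vec n) (w_vec n) * pairS h h)%:~R / 4%:R.

Let C := Cplx R.

Definition extC (s : ext int) : ext C := map_mx intr s.

Local Open Scope classical_set_scope.

(* A subset of a projective space is represented by its cone of nonzero
   representatives. *)
Definition Omega_w (n : nat) : set (ext C) :=
  [set l | [/\ is_even l, l != 0, pairS l (extC (w_vec n)) = 0,
               pairS l l = 0 & pairS l (conj_mx l) < 0]].

Definition Omega_wh (n : nat) (h : ext int) : set (ext C) :=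
  Omega_w n `&` [set l | pairS l (extC h) = 0].

End MukaiLattice.

(* The fiber T_l is the torus V_C / (Zker l + V). *)
Definition Zker (R : realType) (l : ext (Cplx R)) : 'M[Cplx R]_(4 + 4) :=
  kermx (lin1_mx (fun v => clifford v l)).

Section Manifold.
Variable R : realType.
Let C := Cplx R.
Local Open Scope classical_set_scope.

Definition complex_submanifold N (k : nat) (M : set 'rV[C]_N) : Prop :=
  forall p, M p -> exists (m : nat) (U : set 'rV[C]_N) (f : 'rV[C]_N -> 'rV[C]_m),
    [/\ (m + k = N)%N, open U /\ U p,
        forall q, U q -> differentiable f q,
        M `&` U = [set q | U q /\ f q = 0] &
        forall y, exists v, 'd f p v = y].

(* M is the cone over a k-dimensional complex submanifold of P^(N-1). *)
Definition projective_submanifold N (k : nat) (M : set 'rV[C]_N) : Prop :=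
  [/\ ~ M 0, forall (c : C) l, c != 0 -> M l -> M (c *: l) &
      complex_submanifold k.+1 M].

End Manifold.

(* Q[sqrt(-d)] as Q[x]/(x^2 + d); the square root of -d is 'qX. *)
Definition quadratic (d : rat) := {poly %/ 'X^2 + d%:P}.

Section Quadratic.
Import Pdiv.CommonRing Pdiv.RingMonic.

Lemma qX_sqr (d : rat) : 'qX ^+ 2 = - d%:A :> quadratic d.
Proof.
have szp : size ('X^2 + d%:P : {poly rat}) = 3%N by rewrite size_XnaddC.
have mon : 'X^2 + d%:P \is @monic rat.
  by rewrite monicE lead_coefDl ?size_polyXn ?size_polyC ?lead_coefXn //;
    case: (d != 0).
have mkp : mk_monic ('X^2 + d%:P) = 'X^2 + d%:P :> {poly rat}.
  by rewrite /mk_monic szp mon.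
apply/eqP; rewrite -addr_eq0; apply/eqP/val_inj => /=.
rewrite (rmodp_small (p := 'X)) mkp ?szp ?size_polyX //.
have -> : 'X * 'X = 1 * ('X^2 + d%:P) + - d%:P :> {poly rat}.
  by rewrite mul1r addrK.
by rewrite rmodp_addl_mul_small ?szp ?size_polyN ?size_polyC ?alg_polyC ?addNr; case: (d != 0).
Qed.

End Quadratic.

Section WeilType.
Variables (R : realType) (d : rat).
Let C := Cplx R.
Let K := quadratic d.

Definition sqrt_neg_d : C := sqrtC (- ratr d).

Variables (eta : {rmorphism K -> 'M[rat]_(4 + 4)}) (E : 'M[int]_(4 + 4)).

(* (A, K, E) with A the torus encoded by F.  Endomorphisms act on row vectors
   of H_1(A, Q) from the right, hence by the transpose on 1-forms. *)
Record weil_type (F : 'M[C]_(4 + 4)) : Prop := WeilType {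
  weil_imaginary : 0 < d;
  weil_torus : is_torus F;
  weil_endomorphism : forall k : K, stablemx F (map_mx ratr (eta k));
  weil_eigen_pos :
    \rank (eigenspace (map_mx ratr (eta 'qX))^T sqrt_neg_d :&: H10 F)%MS = 2%N;
  weil_eigen_neg :
    \rank (eigenspace (map_mx ratr (eta 'qX))^T (- sqrt_neg_d) :&: H10 F)%MS = 2%N;
  weil_polarization : is_polarization F E;
  weil_similitude :
    eta 'qX *m map_mx intr E *m (eta 'qX)^T = d *: map_mx intr E
}.

Definition K_basis (e : 'I_4 -> 'rV[rat]_(4 + 4)) : Prop :=
  forall x, exists! k : {ffun 'I_4 -> K}, x = \sum_i e i *m eta (k i).

Definition weil_hermitian (x y : 'rV[rat]_(4 + 4)) : K :=
  (bilin (map_mx intr E) x (y *m eta 'qX))%:A + bilin (map_mx intr E) x y *: 'qX.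

(* Nm(a + b sqrt(-d)) = a^2 + d b^2. *)
Definition discriminant_one : Prop :=
  forall e, K_basis e -> exists a b : rat,
    (a, b) != (0, 0) /\
    \det (\matrix_(i, j) weil_hermitian (e i) (e j)) = (a ^+ 2 + d * b ^+ 2)%:A.

End WeilType.

Section Family.
Variable R : realType.
Let C := Cplx R.
Local Open Scope classical_set_scope.

(* M is the base (a cone of representatives, as above) and F l encodes the torus
   over l.  The polarization is the integral class E up to a sign, constant on
   connected components.  Completeness: M has dimension 4, the period map
   l |-> F l is injective, and every torus of Weil type with the given lattice,
   K-action and polarization (up to sign) is a fiber. *)
Record complete_weil_family (d : rat) (f : 'M[rat]_(4 + 4))
    (E : 'M[int]_(4 + 4)) N (M : set 'rV[C]_N)
    (F : 'rV[C]_N -> 'M[C]_(4 + 4))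
    (eta : {rmorphism quadratic d -> 'M[rat]_(4 + 4)})
    (sgn : 'rV[C]_N -> bool) : Prop := CompleteWeilFamily {
  family_base : M !=set0 /\ projective_submanifold 4 M;
  family_eta : eta 'qX = f;
  family_sgn : {within M, continuous sgn};
  family_sgnZ : forall (c : C) l, c != 0 -> M l -> sgn (c *: l) = sgn l;
  family_weil : forall l, M l -> weil_type eta ((-1) ^+ sgn l *: E) (F l);
  family_discriminant : forall l, M l -> discriminant_one eta ((-1) ^+ sgn l *: E);
  family_effective : forall l l', M l -> M l' ->
    (F l == F l')%MS -> exists c : C, l' = c *: l;
  family_full : forall (s : bool) (G : 'M[C]_(4 + 4)),
    weil_type eta ((-1) ^+ s *: E) G ->
    exists l, [/\ M l, sgn l = s & (F l == G)%MS]
}.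

End Family.

Lemma pairS_linear_r (R : realType) (X : abelian_surface R) (A : comNzRingType)
    (s t1 t2 : ext A) (a : A) :
  pairS X s (a *: t1 + t2) = a * pairS X s t1 + pairS X s t2.
Proof.
rewrite /pairS /integral.
suff -> : cup (tau s) (a *: t1 + t2) = a *: cup (tau s) t1 + cup (tau s) t2.
  by rewrite coefP; ring.
rewrite /cup scaler_sumr -big_split; apply: eq_bigr => I _.
rewrite scaler_sumr -big_split; apply: eq_bigr => J _ /=.
by rewrite scalerA -scalerDl coefP; congr (_ *: _); ring.
Qed.

Lemma pairS_linear_l (R : realType) (X : abelian_surface R) (A : comNzRingType)
    (s1 s2 t : ext A) (a : A) :
  pairS X (a *: s1 + s2) t = a * pairS X s1 t + pairS X s2 t.
Proof.
rewrite /pairS /integral.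
have -> : tau (a *: s1 + s2) = a *: tau s1 + tau s2.
  apply/rowP => j; rewrite -[j]enum_valK.
  rewrite -[LHS]/(coef _ (enum_val j)) -[RHS]/(coef _ (enum_val j)).
  by rewrite coefP !coef_tau coefP mulrDr !mulrA; congr (_ * _ + _); exact: mulrC.
suff -> : cup (a *: tau s1 + tau s2) t = a *: cup (tau s1) t + cup (tau s2) t.
  by rewrite coefP; ring.
move: (tau s1) (tau s2) => {}s1 {}s2; rewrite /cup scaler_sumr -big_split; apply: eq_bigr => I _.
rewrite scaler_sumr -big_split; apply: eq_bigr => J _ /=.
by rewrite scalerA -scalerDl coefP; congr (_ *: _); ring.
Qed.

Lemma m_adj_linear (R : realType) (X : abelian_surface R) (A : comNzRingType)
    (y : ext A) : linear (m_adj X y : ext A -> 'rV_(4 + 4)).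
Proof.
move=> a t1 t2; rewrite /m_adj scale_row_mx add_row_mx.
by congr row_mx; apply/rowP => i; rewrite !mxE pairS_linear_r.
Qed.

Lemma m_adjP (R : realType) (X : abelian_surface R) (A : comNzRingType)
    (y t : ext A) (v : 'rV[A]_(4 + 4)) :
  pairV (m_adj X y t) v = pairS X (clifford v y) t.
Proof.
pose g (v : 'rV[A]_(4 + 4)) : 'rV[A]_1 := const_mx (pairS X (clifford v y) t).
have lin_g : linear g.
  move=> a u1 u2; apply/rowP => i.
  by rewrite !mxE clifford_linear pairS_linear_l.
suff -> : pairV (m_adj X y t) v = (v *m lin1_mx g) 0 0.
  by rewrite (lin1_mxE lin_g) mxE.
rewrite /pairV /m_adj row_mxKl row_mxKr !mxE big_split_ord /= addrC.
by congr (_ + _); apply: eq_bigr => i _;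
  rewrite !mxE mulrC ?delta_mx_lshift ?delta_mx_rshift.
Qed.

Lemma theta_endP (R : realType) (X : abelian_surface R) n (h : ext int) v :
  v *m theta_end X n h = m_adj X (w_vec X n) (clifford v h).
Proof.
apply: (lin1_mxE (f := fun v => m_adj X (w_vec X n) (clifford v h))) => a u1 u2.
by rewrite clifford_linear m_adj_linear.
Qed.

Lemma theta_formP (R : realType) (X : abelian_surface R) n (h : ext int) x y :
  bilin (theta_form X n h) x y = pairV (x *m theta_end X n h) y.
Proof.
set T := theta_end X n h.
pose Q : 'M[int]_(4 + 4) := \matrix_(i, j) pairV (delta_mx 0 i) (delta_mx 0 j).
have pairVl a (u1 u2 v : 'rV[int]_(4 + 4)) :
    pairV (a *: u1 + u2) v = a * pairV u1 v + pairV u2 v.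
  by rewrite /pairV !linearP /= !mulmxDl -!scalemxAl !mxE; ring.
have pairVr a (u v1 v2 : 'rV[int]_(4 + 4)) :
    pairV u (a *: v1 + v2) = a * pairV u v1 + pairV u v2.
  by rewrite /pairV !linearP /= !mxE; ring.
have expand (f : 'rV[int]_(4 + 4) -> int) :
    (forall a u v, f (a *: u + v) = a * f u + f v) ->
    forall u, f u = \sum_i u 0 i * f (delta_mx 0 i).
  move=> lin_f u; pose g u : 'rV[int]_1 := const_mx (f u).
  have lin_g : linear g by move=> a u1 u2; apply/rowP => i; rewrite !mxE lin_f.
  have -> : f u = (u *m lin1_mx g) 0 0 by rewrite (lin1_mxE lin_g) mxE.
  by rewrite mxE; apply: eq_bigr => i _; rewrite !mxE.
rewrite (expand (fun y => pairV (x *m T) y)) => [|a u v]; last exact: pairVr.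
rewrite /bilin mxE; apply: eq_bigr => j _; rewrite [y^T _ _]mxE mulrC.
congr (_ * _); rewrite mxE.
rewrite (expand (fun x => pairV (x *m T) _)) => [|a u v].
  by apply: eq_bigr => i _; rewrite [theta_form _ _ _ _ _]mxE.
by rewrite mulmxDl -scalemxAl pairVl.
Qed.

Lemma ZkerP (R : realType) (l : ext (Cplx R)) (v : 'rV_(4 + 4)) :
  (v <= Zker l)%MS <-> clifford v l = 0.
Proof.
rewrite -(lin1_mxE (f := fun v => clifford v l)) => [|a u1 u2].
  by rewrite /Zker; split=> [/sub_kermxP|/sub_kermxP].
exact: clifford_linear.
Qed.

(* Main.v *)
(** For even [y] and [z] the Clifford action and its adjoints satisfy
    [m_y (v . z) + m_z (v . y) = (y, z) v] and [m_y(t) . z + m_z(t) . y = (y, z) t].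
    With [(w, h) = 0] this gives [theta^2 = - d] and shows that [theta] preserves
    the annihilator [Z] of any [l] orthogonal to [w] and [h].  The antilinear map
    [v |-> m_l (conj v . w)] makes each eigenspace of [theta] on [Z] a quaternionic
    line: both have dimension 2, and the hermitian form [(u, conj u)] is definite
    on each of them with opposite signs, so that [(theta x, y)] or its opposite is
    a polarization.  The sign is locally constant in [l].
    Restricted to the K-basis of [V] formed by a basis of H^1, the hermitian form
    is [sqrt (- d)] times an alternating matrix whose Pfaffian is nonzero, which
    makes the discriminant trivial.
    Conversely, if [G] is a complex structure of Weil type and [u1], [u2] span its
    [sqrt (- d)]-eigenspace, then [G] is the annihilator of [l = u1 . u2 . y] with
    [y = - sqrt (- d) w - ((w, w) / 2) h], so the family is complete. *)

Require Import Defs.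
From HB Require Import structures.
From mathcomp Require Import all_boot all_order all_algebra.
From mathcomp Require Import reals ring.
Import Order.TTheory GRing.Theory Num.Theory.
Set Implicit Arguments.
Unset Strict Implicit.
Unset Printing Implicit Defensive.
Local Open Scope ring_scope.

(** * Coordinates on the exterior algebra *)

(** The constant [d]: up to orthogonality signs, the square of [theta] is the product of the squares
    of [m_w] and [m_h], and each [m_y] squares to [(y, y) / 2]. Hence the 4 in its denominator, and
    the factors 2 and 4 in identities over an arbitrary ring. The opposite signs on the two
    eigenspaces come from [V] being split: equal signs would make its real form definite, although
    it contains null vectors. The choice of [y]: over the quadratic field, the plane of [w] and [h]
    contains two null lines, and their annihilators are the two eigenspaces of [theta] on the whole
    of [V]. The annihilator of [l] meets each of them in a plane. Multiplying the spinor of one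
    eigenspace by a basis of a plane in the other produces a spinor annihilated by both planes,
    which is why [G] can be read back as a period. The sign of the polarization cannot be constant:
    passing from [l] to its conjugate exchanges [Z] with its conjugate and reverses it. It is
    defined pointwise by positivity, and is locally constant because the vector [m_q(t)], for fixed
    [t], stays in the annihilator of [q] and depends linearly on [q]. *)

Definition bitset (b0 b1 b2 b3 : bool) : {set 'I_4} :=
  [set i : 'I_4 | nth false [:: b0; b1; b2; b3] i].

Lemma in_bitset b0 b1 b2 b3 (i : 'I_4) :
  (i \in bitset b0 b1 b2 b3) = nth false [:: b0; b1; b2; b3] i.
Proof. by rewrite inE. Qed.

Notation i0 := (ord0 : 'I_4).
Notation i1 := (lift ord0 ord0 : 'I_4).
Notation i2 := (lift ord0 (lift ord0 ord0) : 'I_4).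
Notation i3 := (lift ord0 (lift ord0 (lift ord0 ord0)) : 'I_4).

Lemma ord4_ind (P : 'I_4 -> Prop) : P i0 -> P i1 -> P i2 -> P i3 -> forall i, P i.
Proof.
move=> p0 p1 p2 p3 [[|[|[|[|//]]]] lti].
- by rewrite (_ : Ordinal lti = i0) //; apply: val_inj.
- by rewrite (_ : Ordinal lti = i1) //; apply: val_inj.
- by rewrite (_ : Ordinal lti = i2) //; apply: val_inj.
- by rewrite (_ : Ordinal lti = i3) //; apply: val_inj.
Qed.

Lemma bitsetE (I : {set 'I_4}) : I = bitset (i0 \in I) (i1 \in I) (i2 \in I) (i3 \in I).
Proof. by apply/setP; apply: ord4_ind; rewrite in_bitset. Qed.

(** With the 16 monomials indexed by four bits, identities of the exterior algebra become finitely
    many polynomial identities in coefficients, which [ring] decides. *)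
Lemma big_sets (V : nmodType) (F : {set 'I_4} -> V) :
  \sum_(I : {set 'I_4}) F I =
  \sum_(b0 : bool) \sum_(b1 : bool) \sum_(b2 : bool) \sum_(b3 : bool) F (bitset b0 b1 b2 b3).
Proof.
pose g (p : bool * (bool * (bool * bool))) := bitset p.1 p.2.1 p.2.2.1 p.2.2.2.
rewrite (reindex g) /=; last first.
  exists (fun I : {set 'I_4} => (i0 \in I, (i1 \in I, (i2 \in I, i3 \in I)))).
    by move=> [b0 [b1 [b2 b3]]] _; rewrite /g !in_bitset.
  by move=> I _; rewrite /g /= -bitsetE.
rewrite -(pair_bigA _ (fun b0 p => F (g (b0, p)))) /=; apply: eq_bigr => b0 _.
rewrite -(pair_bigA _ (fun b1 p => F (g (b0, (b1, p))))) /=; apply: eq_bigr => b1 _.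
by rewrite -(pair_bigA _ (fun b2 b3 => F (g (b0, (b1, (b2, b3)))))).
Qed.

Section Coordinates.
Variable A : comNzRingType.
Implicit Types (s t y z : ext A) (u v : 'rV[A]_(4 + 4)).

Definition sgn_at (i : 'I_4) (J : {set 'I_4}) : A := (-1) ^+ #|[set j in J | (j < i)%N]|.

Definition flip (i : 'I_4) (J : {set 'I_4}) := if i \in J then J :\ i else i |: J.

Lemma ext_coef_sum I (r : seq I) (P : pred I) (F : I -> ext A) K :
  coef (\sum_(i <- r | P i) F i) K = \sum_(i <- r | P i) coef (F i) K.
Proof. by rewrite /coef summxE. Qed.

Lemma ext_coefD s t K : coef (s + t) K = coef s K + coef t K.
Proof. by rewrite /coef mxE. Qed.

Lemma ext_coefZ a s K : coef (a *: s) K = a * coef s K.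
Proof. by rewrite /coef mxE. Qed.

Lemma coefZmono a I K : coef (a *: mono A I) K = a * (K == I)%:R.
Proof. by rewrite ext_coefZ coef_mono. Qed.

(** Only the sets [i |: K] with [i] outside [K] contribute; inserting [i] does not change the number
    of smaller indices, so the sign can be read on [K]. *)
Lemma coef_contract (th : 'rV[A]_4) s K :
  coef (Defs.contract th s) K =
  \sum_(i | i \notin K) sgn_at i K * th 0 i * coef s (i |: K).
Proof.
rewrite /Defs.contract ext_coef_sum.
under eq_bigr => I _ do rewrite ext_coef_sum.
rewrite (exchange_big_dep predT) //= [LHS](bigID (fun i => i \in K)) /=.
rewrite [X in X + _]big1 ?add0r => [|i iK]; last first.
  rewrite big1 // => I iI; rewrite coefZmono; case: eqP => [eK|_]; last by rewrite mulr0.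
  by move: iK; rewrite eK !inE eqxx.
apply: eq_bigr => i iK; rewrite (bigD1 (i |: K)) ?setU11 //= big1 ?addr0.
  rewrite coefZmono setU1K // eqxx mulr1 /sgn_at; congr (_ ^+ _ * _ * _).
  apply: eq_card => j; rewrite !inE; case: eqP => //= ->.
  by rewrite ltnn andbF.
move=> I /andP[iI neI]; rewrite coefZmono; case: eqP => [eK|_]; last by rewrite mulr0.
by move: neI; rewrite eK setD1K // eqxx.
Qed.

Lemma coef_of_deg1 (a : 'rV[A]_4) I : coef (of_deg1 a) I = \sum_i a 0 i * (I == [set i])%:R.
Proof. by rewrite /of_deg1 ext_coef_sum; apply: eq_bigr => i _; rewrite coefZmono. Qed.

Lemma coef_cup s t K :
  coef (cup s t) K = \sum_(I : {set 'I_4} | I \subset K)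
    (-1) ^+ inversions I (K :\: I) * coef s I * coef t (K :\: I).
Proof.
rewrite /cup ext_coef_sum [LHS](bigID (fun I : {set 'I_4} => I \subset K)) /=.
rewrite [X in _ + X]big1 ?addr0 => [|I nIK]; last first.
  rewrite ext_coef_sum big1 // => J _; rewrite coefZmono; case: eqP => [eK|_]; last by rewrite mulr0.
  by move: nIK; rewrite eK subsetUl.
apply: eq_bigr => I sIK; rewrite ext_coef_sum (bigD1 (K :\: I)) /=; last first.
  by rewrite -setI_eq0 setIDA setDIl setIC setDv ?setI0 ?set0I.
have eKI : I :|: (K :\: I) = K by rewrite -[RHS](setID K I) (setIidPr sIK).
rewrite coefZmono eKI eqxx mulr1 big1 ?addr0 // => J /andP[dIJ neJ].
rewrite coefZmono; case: eqP => [eK|_]; last by rewrite mulr0.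
case/eqP: neJ; rewrite eK setDUl setDv set0U; apply/esym/setDidPl.
by rewrite disjoint_sym.
Qed.

Lemma coef_wedge (a : 'rV[A]_4) s K :
  coef (cup (of_deg1 a) s) K = \sum_(i in K) sgn_at i K * a 0 i * coef s (K :\ i).
Proof.
rewrite coef_cup; under eq_bigr => I _ do rewrite coef_of_deg1 mulr_sumr mulr_suml.
rewrite (exchange_big_dep predT) //= [LHS](bigID (fun i => i \in K)) /=.
rewrite [X in _ + X]big1 ?addr0 => [|i niK]; last first.
  rewrite big1 // => I sIK; case: eqP => [eI|_]; last by rewrite !(mulr0, mul0r).
  by move: sIK; rewrite eI sub1set (negbTE niK).
apply: eq_bigr => i iK; rewrite (bigD1 [set i]) ?sub1set ?iK //= eqxx mulr1 big1 ?addr0.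
  congr (_ ^+ _ * _ * _); rewrite /inversions.
  (* The inversions of [[set i]] against [K :\ i] are the pairs [(i, j)] with [j] in [K] below
     [i]. *)
  rewrite -(card_imset (mem [set j in K | (j < i)%N]) (f := fun j => (i, j))); last by move=> ? ? [].
  apply: eq_card => -[k j]; apply/idP/imsetP => /=.
    rewrite !inE /= => /and3P[/eqP -> /andP[_ jK] ltj].
    by exists j; rewrite ?inE ?jK.
  move=> [j' ]; rewrite !inE => /andP[jK ltj] [-> ->] /=.
  by rewrite eqxx jK ltj neq_ltn ltj.
by move=> I /andP[_ /negbTE ->]; rewrite !(mulr0, mul0r).
Qed.

(** Wedge and contraction toggle one index with the same sign [sgn_at], so [flip] treats both halves
    of [V] uniformly. *)
Lemma coef_clifford v s K :
  coef (clifford v s) K =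
  \sum_i sgn_at i K * (if i \in K then lsubmx v 0 i else rsubmx v 0 i) * coef s (flip i K).
Proof.
rewrite /clifford ext_coefD coef_wedge coef_contract [RHS](bigID (fun i => i \in K)) /=.
by congr (_ + _); apply: eq_bigr => i; rewrite /flip; [move=> -> | move=> /negbTE ->].
Qed.

(* [coordV v i true] is the coordinate of [v] along [e_i] in H^1, and
   [coordV v i false] the one along the dual vector; likewise for [basisV]. *)
Definition coordV v (i : 'I_4) (b : bool) : A := if b then lsubmx v 0 i else rsubmx v 0 i.

Lemma flip_bitset i b0 b1 b2 b3 : flip i (bitset b0 b1 b2 b3) =
  bitset (b0 (+) (i == i0)) (b1 (+) (i == i1)) (b2 (+) (i == i2)) (b3 (+) (i == i3)).
Proof.
rewrite /flip in_bitset; move: i; apply: ord4_ind;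
by case: b0; case: b1; case: b2; case: b3; apply/setP; apply: ord4_ind; rewrite !inE -?val_eqE.
Qed.

Lemma sgn_at_bitset i b0 b1 b2 b3 : sgn_at i (bitset b0 b1 b2 b3) =
  (-1) ^+ ((b0 && (0 < i)%N) + (b1 && (1 < i)%N) + (b2 && (2 < i)%N))%N.
Proof.
rewrite /sgn_at -sum1_card big_mkcond /= !big_ord_recl big_ord0 /= !inE /=.
by move: i; apply: ord4_ind; case: b0; case: b1; case: b2; case: b3.
Qed.

Lemma coef_clifford_bitset v s b0 b1 b2 b3 :
  coef (clifford v s) (bitset b0 b1 b2 b3) =
    coordV v i0 b0 * coef s (bitset (~~ b0) b1 b2 b3)
    + (-1) ^+ b0 * (coordV v i1 b1 * coef s (bitset b0 (~~ b1) b2 b3))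
    + (-1) ^+ (b0 (+) b1) * (coordV v i2 b2 * coef s (bitset b0 b1 (~~ b2) b3))
    + (-1) ^+ (b0 (+) b1 (+) b2) * (coordV v i3 b3 * coef s (bitset b0 b1 b2 (~~ b3))).
Proof.
rewrite coef_clifford !big_ord_recl big_ord0 addr0 !addrA !sgn_at_bitset !flip_bitset !in_bitset /=.
rewrite /bump /= !andbT !andbF !addn0 expr0 mul1r !addbT !addbF -!mulrA.
by congr (_ + _ + _ + _); congr (_ * _); rewrite -signr_odd !oddD !oddb.
Qed.

End Coordinates.

(** * The pairing on spinors and the Clifford relation *)

Section Pairing.
Variables (R : realType) (X : abelian_surface R) (A : comNzRingType).
Implicit Types (s t y z : ext A) (u v : 'rV[A]_(4 + 4)).

Local Notation o := (orientation X A).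
Local Notation "'[ s , t ]" := (pairS X s t).

Lemma orientation_sqr : o * o = 1.
Proof. by rewrite /orientation; case: ifP => _; rewrite ?mulr1 ?mulrNN ?mulr1. Qed.

(** For [k = #|I|], the number of inversions between [I] and its complement is the sum of the
    elements of [I] minus [k (k - 1) / 2]. The exponent of [tau] restores the subtracted term, and
    the parity of the remaining sum only sees the indices 1 and 3. *)
Lemma tau_sign_bitset b0 b1 b2 b3 :
  let I := bitset b0 b1 b2 b3 in
  (-1) ^+ inversions I (setT :\: I) * (-1) ^+ (#|I| * #|I|.-1)./2 = (-1) ^+ (b1 (+) b3) :> A.
Proof.
move=> I; have -> : inversions I (setT :\: I) =
    (\sum_(i : 'I_4) \sum_(j : 'I_4) ((i \in I) && (j \notin I) && (j < i)%N))%N.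
  rewrite /inversions -sum1_card big_mkcond /= [RHS]pair_bigA /=.
  by apply: eq_bigr => -[i j] _; rewrite !inE /= andbT andbA; case: ifP.
have -> : #|I| = (b0 + b1 + b2 + b3)%N.
  by rewrite -sum1_card big_mkcond /= !big_ord_recl big_ord0 !inE /=;
    case: b0 {I}; case: b1; case: b2; case: b3.
rewrite !big_ord_recl !big_ord0 !inE -exprD -[in LHS]signr_odd.
by case: b0 {I}; case: b1; case: b2; case: b3.
Qed.

Lemma pairS_bits s t : '[s, t] = o *
  \sum_(b0 : bool) \sum_(b1 : bool) \sum_(b2 : bool) \sum_(b3 : bool)
    (-1) ^+ (b1 (+) b3) * (coef s (bitset b0 b1 b2 b3) * coef t (bitset (~~ b0) (~~ b1) (~~ b2) (~~ b3))).
Proof.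
rewrite /pairS /Defs.integral coef_cup (eq_bigl predT) => [|I]; last by rewrite subsetT.
rewrite big_sets; congr (_ * _).
do 4 (apply: eq_bigr => ? _).
rewrite coef_tau mulrA tau_sign_bitset -mulrA; congr (_ * (_ * coef t _)).
apply/setP; apply: ord4_ind; rewrite !inE /= ?andbT //.
Qed.

Lemma pairSE s t : '[s, t] = o * (
    coef s (bitset false false false false) * coef t (bitset true true true true)
  + coef s (bitset true true true true) * coef t (bitset false false false false)
  - coef s (bitset true true false false) * coef t (bitset false false true true)
  + coef s (bitset true false true false) * coef t (bitset false true false true)
  - coef s (bitset true false false true) * coef t (bitset false true true false)
  - coef s (bitset false true true false) * coef t (bitset true false false true)
  + coef s (bitset false true false true) * coef t (bitset true false true false)
  - coef s (bitset false false true true) * coef t (bitset true true false false)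
  + coef s (bitset true false false false) * coef t (bitset false true true true)
  - coef s (bitset false true false false) * coef t (bitset true false true true)
  + coef s (bitset false false true false) * coef t (bitset true true false true)
  - coef s (bitset false false false true) * coef t (bitset true true true false)
  - coef s (bitset true true true false) * coef t (bitset false false false true)
  + coef s (bitset true true false true) * coef t (bitset false false true false)
  - coef s (bitset true false true true) * coef t (bitset false true false false)
  + coef s (bitset false true true true) * coef t (bitset true false false false)).
Proof.
rewrite pairS_bits !big_bool /= !expr0 !expr1 !mul1r !mulN1r; congr (_ * _); ring.
Qed.

Lemma pairSC s t : '[s, t] = '[t, s].
Proof. rewrite !pairSE; congr (_ * _); ring. Qed.

Lemma vecV_ext u v : (forall i b, coordV u i b = coordV v i b) -> u = v.
Proof.
move=> e; rewrite -(hsubmxK u) -(hsubmxK v); congr row_mx; apply/rowP => i.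
  by have := e i true.
by have := e i false.
Qed.

Lemma extP s t : (forall b0 b1 b2 b3, coef s (bitset b0 b1 b2 b3) = coef t (bitset b0 b1 b2 b3)) -> s = t.
Proof.
move=> e; apply/rowP => j; rewrite -[j]enum_valK.
by rewrite -[LHS]/(coef s (enum_val j)) -[RHS]/(coef t (enum_val j)) [enum_val j]bitsetE.
Qed.

Lemma pairVE u v : pairV u v =
    coordV u i0 true * coordV v i0 false + coordV u i1 true * coordV v i1 false
  + coordV u i2 true * coordV v i2 false + coordV u i3 true * coordV v i3 false
  + coordV u i0 false * coordV v i0 true + coordV u i1 false * coordV v i1 true
  + coordV u i2 false * coordV v i2 true + coordV u i3 false * coordV v i3 true.
Proof.
by rewrite /pairV mxE 2!mxE !big_ord_recl !big_ord0 ![_^T _ _]mxE /coordV; ring.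
Qed.

Lemma clifford_anticomm u v s :
  clifford u (clifford v s) + clifford v (clifford u s) = pairV u v *: s.
Proof.
apply: extP => b0 b1 b2 b3; rewrite ext_coefD ext_coefZ !coef_clifford_bitset pairVE.
by case: b0; case: b1; case: b2; case: b3; rewrite /= !expr0 ?expr1; ring.
Qed.

(** [tau] reverses products, so a 1-form wedged in front of [s] moves in front of [t] without a
    sign; contractions behave alike. *)
Lemma clifford_adjoint v s t : '[clifford v s, t] = '[s, clifford v t].
Proof.
rewrite !pairSE; congr (_ * _); rewrite !coef_clifford_bitset /= !expr0 !expr1; ring.
Qed.

End Pairing.

(** * Adjoints of Clifford multiplication *)

Section Triality.
Local Notation T := true.
Local Notation F := false.
Variables (R : realType) (X : abelian_surface R) (A : comNzRingType).
Implicit Types (s t y z : ext A) (u v : 'rV[A]_(4 + 4)).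

Local Notation o := (orientation X A).
Local Notation "'[ s , t ]" := (pairS X s t).
Local Notation adj := (m_adj X).

Definition is_odd s : Prop := forall I : {set 'I_4}, ~~ odd #|I| -> coef s I = 0.

Lemma card_bitset b0 b1 b2 b3 : #|bitset b0 b1 b2 b3| = (b0 + b1 + b2 + b3)%N.
Proof.
by rewrite -sum1_card big_mkcond /= !big_ord_recl big_ord0 !inE /=;
  case: b0; case: b1; case: b2; case: b3.
Qed.

Lemma is_evenP s : is_even s <->
  forall b0 b1 b2 b3, b0 (+) b1 (+) b2 (+) b3 -> coef s (bitset b0 b1 b2 b3) = 0.
Proof.
split=> [ev b0 b1 b2 b3 od|ev I]; first by apply: ev; rewrite card_bitset !oddD !oddb.
by rewrite [I]bitsetE card_bitset !oddD !oddb; apply: ev.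
Qed.

Lemma is_oddP s : is_odd s <->
  forall b0 b1 b2 b3, ~~ (b0 (+) b1 (+) b2 (+) b3) -> coef s (bitset b0 b1 b2 b3) = 0.
Proof.
split=> [od b0 b1 b2 b3 ev|od I]; first by apply: od; rewrite card_bitset !oddD !oddb.
by rewrite [I]bitsetE card_bitset !oddD !oddb; apply: od.
Qed.

Lemma clifford_even v y : is_even y -> is_odd (clifford v y).
Proof.
move=> /is_evenP ev; apply/is_oddP => b0 b1 b2 b3.
by rewrite coef_clifford_bitset => od; rewrite !ev ?mulr0 ?addr0 //;
  case: b0 od; case: b1; case: b2; case: b3.
Qed.

Lemma clifford_odd v t : is_odd t -> is_even (clifford v t).
Proof.
move=> /is_oddP od; apply/is_evenP => b0 b1 b2 b3.
by rewrite coef_clifford_bitset => ev; rewrite !od ?mulr0 ?addr0 //;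
  case: b0 ev; case: b1; case: b2; case: b3.
Qed.

Lemma is_evenZD a y z : is_even y -> is_even z -> is_even (a *: y + z).
Proof. by move=> evy evz I oI; rewrite coefP evy // evz // mulr0 addr0. Qed.

Lemma clifford_linear_r v a y z : clifford v (a *: y + z) = a *: clifford v y + clifford v z.
Proof.
apply: extP => b0 b1 b2 b3; rewrite coefP !coef_clifford_bitset !coefP; ring.
Qed.

Definition basisV (i : 'I_4) (b : bool) : 'rV[A]_(4 + 4) :=
  if b then row_mx (delta_mx 0 i) 0 else row_mx 0 (delta_mx 0 i).

Lemma coordV_basisV i b j c : coordV (basisV i b) j c = ((i == j) && (b == c))%:R.
Proof.
by rewrite /coordV /basisV; case: b; case: c; rewrite ?row_mxKl ?row_mxKr mxE ?eqxx /= ?andbF ?andbT // eq_sym.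
Qed.

Lemma coordV_adj y t i b : coordV (adj y t) i b = '[clifford (basisV i (~~ b)) y, t].
Proof. by rewrite /coordV /m_adj; case: b; rewrite ?row_mxKl ?row_mxKr mxE. Qed.

Lemma pairVC u v : pairV u v = pairV v u.
Proof. by rewrite !pairVE; ring. Qed.

Lemma pairV_linear_l a u1 u2 v : pairV (a *: u1 + u2) v = a * pairV u1 v + pairV u2 v.
Proof. by rewrite /pairV !linearP /= !mulmxDl -!scalemxAl !mxE; ring. Qed.

Lemma pairV_basisV u i b : pairV u (basisV i b) = coordV u i (~~ b).
Proof.
rewrite pairVE !coordV_basisV; move: i; apply: ord4_ind; case: b => /=;
by rewrite ?eqxx /= ?mulr0 ?addr0 ?add0r ?mulr1 -?val_eqE ?mulr0 ?addr0 ?add0r ?mulr1.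
Qed.

Lemma pairV_nondeg u v : (forall x, pairV u x = pairV v x) -> u = v.
Proof. by move=> e; apply: vecV_ext => i b; rewrite -[b]negbK -!pairV_basisV. Qed.

Lemma pairSDl s1 s2 t : '[s1 + s2, t] = '[s1, t] + '[s2, t].
Proof. by rewrite -[s1]scale1r pairS_linear_l scale1r mul1r. Qed.

Lemma pairS0l t : '[0, t] = 0.
Proof. by apply: (addrI '[0, t]); rewrite -pairSDl !addr0. Qed.

Lemma pairSZl a s t : '[a *: s, t] = a * '[s, t].
Proof. by rewrite -[a *: s]addr0 pairS_linear_l pairS0l addr0. Qed.

Lemma pairSDr s t1 t2 : '[s, t1 + t2] = '[s, t1] + '[s, t2].
Proof. by rewrite pairSC pairSDl !(pairSC _ s). Qed.

Lemma pairSZr a s t : '[s, a *: t] = a * '[s, t].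
Proof. by rewrite pairSC pairSZl pairSC. Qed.

Lemma cliffordDr v y z : clifford v (y + z) = clifford v y + clifford v z.
Proof. by rewrite -[y]scale1r clifford_linear_r !scale1r. Qed.

Lemma clifford0r v : clifford v (0 : ext A) = 0.
Proof. by apply: (addrI (clifford v 0)); rewrite -cliffordDr !addr0. Qed.

Lemma cliffordZr v a y : clifford v (a *: y) = a *: clifford v y.
Proof. by rewrite -[a *: y]addr0 clifford_linear_r clifford0r addr0. Qed.

Lemma cliffordDl u v y : clifford (u + v) y = clifford u y + clifford v y.
Proof. by rewrite -[u]scale1r clifford_linear !scale1r. Qed.

Lemma clifford0l y : clifford 0 y = 0 :> ext A.
Proof. by apply: (addrI (clifford 0 y)); rewrite -cliffordDl !addr0. Qed.

Lemma cliffordZl a v y : clifford (a *: v) y = a *: clifford v y.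
Proof. by rewrite -[a *: v]addr0 clifford_linear clifford0l addr0. Qed.

Lemma pairVDl u1 u2 v : pairV (u1 + u2) v = pairV u1 v + pairV u2 v.
Proof. by rewrite -[u1]scale1r pairV_linear_l scale1r mul1r. Qed.

Lemma pairV0l v : pairV 0 v = 0 :> A.
Proof. by apply: (addrI (pairV 0 v)); rewrite -pairVDl !addr0. Qed.

Lemma pairVZl a u v : pairV (a *: u) v = a * pairV u v.
Proof. by rewrite -[a *: u]addr0 pairV_linear_l pairV0l addr0. Qed.

Lemma pairVDr u v1 v2 : pairV u (v1 + v2) = pairV u v1 + pairV u v2.
Proof. by rewrite pairVC pairVDl !(pairVC _ u). Qed.

Lemma pairVZr a u v : pairV u (a *: v) = a * pairV u v.
Proof. by rewrite pairVC pairVZl pairVC. Qed.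

Lemma adj_linear_l a y z t : adj (a *: y + z) t = a *: adj y t + adj z t.
Proof.
apply: pairV_nondeg => x; rewrite pairV_linear_l !m_adjP.
by rewrite clifford_linear_r pairS_linear_l.
Qed.

Lemma adjDr y s t : adj y (s + t) = adj y s + adj y t.
Proof. by rewrite -[s]scale1r m_adj_linear !scale1r. Qed.

Lemma adj0r y : adj y 0 = 0.
Proof. by apply: (addrI (adj y 0)); rewrite -adjDr !addr0. Qed.

Lemma adjZr a y t : adj y (a *: t) = a *: adj y t.
Proof. by rewrite -[a *: t]addr0 m_adj_linear adj0r addr0. Qed.

Lemma pairS_clifford2 u v y z :
  '[clifford u y, clifford v z] + '[clifford u z, clifford v y] = pairV u v * '[y, z].
Proof.
by rewrite -pairSZr -clifford_anticomm pairSDr -!(clifford_adjoint _ _ y) [X in _ + X = _]pairSC.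
Qed.

(** Paired with [x], this is [pairS_clifford2], the Clifford relation seen through self-adjointness.
    For [y = z] it says that [adj y] inverts multiplication into [y] up to the factor
    [(y, y) / 2]. *)
Lemma adj_clifford y z v :
  adj y (clifford v z) + adj z (clifford v y) = '[y, z] *: v.
Proof.
apply: pairV_nondeg => x; rewrite pairVDl !m_adjP pairVZl mulrC pairVC -pairS_clifford2.
by [].
Qed.

Lemma coef_clifford_basisV i b s b0 b1 b2 b3 :
  coef (clifford (basisV i b) s) (bitset b0 b1 b2 b3) =
  if nth false [:: b0; b1; b2; b3] i == b then
    (-1) ^+ (b0 && (0 < i)%N (+) b1 && (1 < i)%N (+) b2 && (2 < i)%N)
      * coef s (bitset (b0 (+) (i == 0%N :> nat)) (b1 (+) (i == 1%N :> nat))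
                   (b2 (+) (i == 2%N :> nat)) (b3 (+) (i == 3%N :> nat)))
  else 0.
Proof.
rewrite coef_clifford_bitset !coordV_basisV -!val_eqE; move: i; apply: ord4_ind => /=;
by rewrite !mul0r ?mulr0 ?add0r ?addr0 ?addbF !addbT ?andbF ?andbT ?addbF ?expr0 [b == _]eq_sym;
  case: eqP => _ /=; rewrite ?(mul0r, mulr0, mul1r).
Qed.

(* Fully expanded, so that [clifford_adj] becomes a polynomial identity. *)
Lemma coordV_adjE y t : is_even y -> is_odd t -> forall i b, coordV (adj y t) i b = o *
  nth 0 (if b then
    [:: - (coef y (bitset T F F T) * coef t (bitset T T T F)) + coef y (bitset T F T F) * coef t (bitset T T F T)
        - coef y (bitset T T F F) * coef t (bitset T F T T) + coef y (bitset T T T T) * coef t (bitset T F F F);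
        - (coef y (bitset F T F T) * coef t (bitset T T T F)) + coef y (bitset F T T F) * coef t (bitset T T F T)
        - coef y (bitset T T F F) * coef t (bitset F T T T) + coef y (bitset T T T T) * coef t (bitset F T F F);
        - (coef y (bitset F F T T) * coef t (bitset T T T F)) + coef y (bitset F T T F) * coef t (bitset T F T T)
        - coef y (bitset T F T F) * coef t (bitset F T T T) + coef y (bitset T T T T) * coef t (bitset F F T F);
        - (coef y (bitset F F T T) * coef t (bitset T T F T)) + coef y (bitset F T F T) * coef t (bitset T F T T)
        - coef y (bitset T F F T) * coef t (bitset F T T T) + coef y (bitset T T T T) * coef t (bitset F F F T)]
  else
    [:: coef y (bitset F F F F) * coef t (bitset F T T T) - coef y (bitset F F T T) * coef t (bitset F T F F)
        + coef y (bitset F T F T) * coef t (bitset F F T F) - coef y (bitset F T T F) * coef t (bitset F F F T);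
        - (coef y (bitset F F F F) * coef t (bitset T F T T)) + coef y (bitset F F T T) * coef t (bitset T F F F)
        - coef y (bitset T F F T) * coef t (bitset F F T F) + coef y (bitset T F T F) * coef t (bitset F F F T);
        coef y (bitset F F F F) * coef t (bitset T T F T) - coef y (bitset F T F T) * coef t (bitset T F F F)
        + coef y (bitset T F F T) * coef t (bitset F T F F) - coef y (bitset T T F F) * coef t (bitset F F F T);
        - (coef y (bitset F F F F) * coef t (bitset T T T F)) + coef y (bitset F T T F) * coef t (bitset T F F F)
        - coef y (bitset T F T F) * coef t (bitset F T F F) + coef y (bitset T T F F) * coef t (bitset F F T F)]) i.
Proof.
move=> /is_evenP evy /is_oddP odt i b; rewrite coordV_adj pairSE; congr (_ * _).
rewrite !(odt T T F F) // !(odt T F T F) // !(odt T F F T) // !(odt F T T F) // !(odt F T F T) //.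
rewrite !(odt F F T T) // !(odt F F F F) // !(odt T T T T) // !mulr0 !(oppr0, addr0, add0r).
by move: i; apply: ord4_ind; case: b; rewrite !coef_clifford_basisV /=; ring.
Qed.

(** The companion of [adj_clifford] for the composite in the other order. It reflects that [V] and
    the odd part both have rank 8, where a one-sided inverse up to a scalar is two-sided; over an
    arbitrary ring, where one cannot divide, it is checked on coefficients. *)
Lemma clifford_adj y z t : is_even y -> is_even z -> is_odd t ->
  clifford (adj y t) z + clifford (adj z t) y = '[y, z] *: t.
Proof.
move=> evy evz odt; apply: extP => b0 b1 b2 b3; rewrite ext_coefD ext_coefZ.
have [odb|evb] := boolP (b0 (+) b1 (+) b2 (+) b3); last first.
  have /is_oddP ody := clifford_even (adj z t) evy.
  have /is_oddP odz := clifford_even (adj y t) evz.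
  by move/is_oddP: odt => odt; rewrite odt // mulr0 ody // odz // addr0.
rewrite !coef_clifford_bitset !coordV_adjE //.
move: evy evz odt => /is_evenP evy /is_evenP evz /is_oddP odt.
rewrite pairSE.
rewrite !(evy T F F F) // !(evy F T F F) // !(evy F F T F) // !(evy F F F T) //.
rewrite !(evy F T T T) // !(evy T F T T) // !(evy T T F T) // !(evy T T T F) // !mul0r.
by case: b0 odb; case: b1; case: b2; case: b3 => //= _; rewrite ?expr0 ?expr1; ring.
Qed.

End Triality.

(** * Base change of the spinor calculus *)

Section BaseChange.
Variables (R : realType) (X : abelian_surface R) (A B : comNzRingType) (f : {rmorphism A -> B}).
Implicit Types (s t y z : ext A) (u v : 'rV[A]_(4 + 4)).

Lemma ext_coef_map s I : coef (map_mx f s : ext B) I = f (coef s I).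
Proof. by rewrite /coef mxE. Qed.

Lemma coordV_map v i b : coordV (map_mx f v) i b = f (coordV v i b).
Proof. by rewrite /coordV; case: b; rewrite !mxE. Qed.

Lemma map_clifford v s : map_mx f (clifford v s) = clifford (map_mx f v) (map_mx f s : ext B).
Proof.
apply: extP => b0 b1 b2 b3; rewrite ext_coef_map !coef_clifford_bitset !ext_coef_map !coordV_map.
by rewrite !rmorphD !rmorphM !rmorphXn !rmorphN1.
Qed.

Lemma rmorph_orientation : f (orientation X A) = orientation X B.
Proof. by rewrite /orientation; case: ifP => _; rewrite ?rmorphN1 ?rmorph1. Qed.

Lemma map_pairS s t : f (pairS X s t) = pairS X (map_mx f s : ext B) (map_mx f t : ext B).
Proof.
rewrite !pairS_bits rmorphM rmorph_orientation; congr (_ * _).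
do 4 (rewrite rmorph_sum; apply: eq_bigr => ? _).
by rewrite !rmorphM rmorphXn rmorphN1 !ext_coef_map.
Qed.

Lemma map_pairV u v : f (pairV u v) = pairV (map_mx f u) (map_mx f v).
Proof. by rewrite /pairV -!map_lsubmx -!map_rsubmx !matrix.map_trmx -!map_mxM -map_mxD [RHS]mxE. Qed.

Lemma map_basisV i b : map_mx f (basisV A i b) = basisV B i b.
Proof. by apply: vecV_ext => j c; rewrite coordV_map !coordV_basisV rmorph_nat. Qed.

Lemma map_adj y t : map_mx f (m_adj X y t) = m_adj X (map_mx f y : ext B) (map_mx f t : ext B).
Proof.
apply: vecV_ext => i b; rewrite coordV_map [X in f X]coordV_adj [RHS]coordV_adj.
by rewrite map_pairS map_clifford map_basisV.
Qed.

Lemma map_even s : is_even s -> is_even (map_mx f s : ext B).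
Proof. by move=> ev I oI; rewrite ext_coef_map ev ?rmorph0. Qed.

End BaseChange.

(** * The operator theta over an arbitrary ring *)

Section Theta.
Variables (R : realType) (X : abelian_surface R) (A : comNzRingType) (w : ext A).
Hypothesis w_even : is_even w.
Implicit Types (y z l t h : ext A) (u v : 'rV[A]_(4 + 4)).

Local Notation "'[ s , t ]" := (pairS X s t).
Local Notation adj := (m_adj X).

Lemma adj_clifford_orth y z v : '[y, z] = 0 -> adj y (clifford v z) = - adj z (clifford v y).
Proof. by move=> yz0; apply/eqP; rewrite -addr_eq0 adj_clifford yz0 scale0r. Qed.

Lemma clifford_adj_orth y z t : is_even y -> is_even z -> is_odd t -> '[y, z] = 0 ->
  clifford (adj y t) z = - clifford (adj z t) y.
Proof. by move=> evy evz odt yz0; apply/eqP; rewrite -addr_eq0 clifford_adj // yz0 scale0r. Qed.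

Definition theta h v := adj w (clifford v h).

Lemma thetaZD h a u v : theta h (a *: u + v) = a *: theta h u + theta h v.
Proof. by rewrite /theta clifford_linear m_adj_linear. Qed.

Lemma thetaD h u v : theta h (u + v) = theta h u + theta h v.
Proof. by rewrite -[u]scale1r thetaZD !scale1r. Qed.

Lemma theta0 h : theta h 0 = 0.
Proof. by rewrite /theta clifford0l adj0r. Qed.

Lemma thetaZ h a u : theta h (a *: u) = a *: theta h u.
Proof. by rewrite -[a *: u]addr0 thetaZD theta0 addr0. Qed.

Lemma thetaN h u : theta h (- u) = - theta h u.
Proof. by rewrite -scaleN1r thetaZ scaleN1r. Qed.

(** Twice [theta z (theta y u)] is [- (w, w)] times [adj z (clifford u y)], and [adj_clifford] turns
    the symmetrized sum into a scalar. The case [e = h] gives the square of [theta]; for orthogonal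
    [h] and [e] the two operators anticommute up to the factor 2. *)
Lemma theta_anticomm h e v : is_even h -> is_even e -> '[w, h] = 0 -> '[w, e] = 0 ->
  2%:R *: (theta h (theta e v) + theta e (theta h v)) = - ('[w, w] * '[h, e]) *: v.
Proof.
move=> evh eve wh we.
have sqr t : is_odd t -> 2%:R *: clifford (adj w t) w = '[w, w] *: t.
  by move=> odt; rewrite -clifford_adj // scaler_nat mulr2n.
have comp y z u : is_even y -> '[w, z] = 0 -> 2%:R *: theta z (theta y u) = - '[w, w] *: adj z (clifford u y).
  move=> evy wz; rewrite {1}/theta adj_clifford_orth // scalerN -adjZr sqr; last exact: clifford_even.
  by rewrite adjZr scaleNr.
by rewrite scalerDr !comp // -scalerDr adj_clifford scalerA mulNr.
Qed.

End Theta.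

Section ThetaOperator.
Variables (R : realType) (X : abelian_surface R) (A : comNzRingType) (w h : ext A).
Hypotheses (w_even : is_even w) (h_even : is_even h) (orth_wh : pairS X w h = 0).
Implicit Types (y z l t : ext A) (u v : 'rV[A]_(4 + 4)).

Local Notation "'[ s , t ]" := (pairS X s t).
Local Notation adj := (m_adj X).
Local Notation theta := (theta X).

Lemma theta_sqr v : 4%:R *: theta w h (theta w h v) = - ('[w, w] * '[h, h]) *: v.
Proof. by rewrite -theta_anticomm // -mulr2n -(scaler_nat 2) scalerA -natrM. Qed.

Lemma theta_antisym u v : pairV (theta w h u) v = - pairV u (theta w h v).
Proof.
rewrite /theta m_adjP adj_clifford_orth // pairVC -[RHS]mulN1r -pairVZl scaleN1r opprK.
by rewrite m_adjP pairSC.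
Qed.

Lemma theta_ker l v : is_even l -> '[l, w] = 0 -> '[l, h] = 0 ->
  clifford v l = 0 -> clifford (theta w h v) l = 0.
Proof.
move=> evl lw lh vl0; rewrite /theta clifford_adj_orth // 1?pairSC //; last exact: clifford_even.
by rewrite (@adj_clifford_orth _ _ _ l h) // vl0 adj0r oppr0 clifford0l oppr0.
Qed.

Lemma ker_isotropic l u v : clifford u l = 0 -> clifford v l = 0 -> pairV u v *: l = 0.
Proof. by move=> ul vl; rewrite -clifford_anticomm ul vl !clifford0r addr0. Qed.

End ThetaOperator.

(** * Isotropic subspaces of V and their annihilators *)

Section Gram.
Variable A : comNzRingType.

Definition gram : 'M[A]_(4 + 4) := block_mx 0 1%:M 1%:M 0.

Lemma pairV_gram (u v : 'rV[A]_(4 + 4)) : pairV u v = (u *m gram *m v^T) 0 0.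
Proof.
rewrite /pairV -[in RHS](hsubmxK u) -[in RHS](hsubmxK v) /gram mul_row_block tr_row_mx.
by rewrite !mulmx0 !mulmx1 add0r addr0 mul_row_col addrC.
Qed.

Lemma gram_sqr : gram *m gram = 1%:M.
Proof. by rewrite /gram mulmx_block !mulmx0 !mul0mx !mulmx1 !add0r !addr0 -scalar_mx_block. Qed.

End Gram.

Section LinearAlgebra.
Variable K : fieldType.
Local Notation gramV := (gram K).
Local Notation gramV_sqr := (gram_sqr K).

Lemma gramV_unit : gramV \in unitmx.
Proof. by case: (mulmx1_unit gramV_sqr). Qed.

Definition isotropic m (Z : 'M[K]_(m, 4 + 4)) := Z *m gramV *m Z^T = 0.

Lemma isotropicP m (Z : 'M[K]_(m, 4 + 4)) :
  (forall u v, (u <= Z)%MS -> (v <= Z)%MS -> pairV u v = 0) <-> isotropic Z.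
Proof.
split=> [iso|iso u v /submxP[a ->] /submxP[b ->]]; last first.
  by rewrite pairV_gram trmx_mul !mulmxA -(mulmxA a) -(mulmxA a) iso mulmx0 mul0mx mxE.
apply/matrixP => i j; have := iso (row i Z) (row j Z) (row_sub _ _) (row_sub _ _).
rewrite pairV_gram -row_mul tr_row => e; rewrite [RHS]mxE; apply: etrans e.
by rewrite !mxE; apply: eq_bigr => k _; rewrite !mxE.
Qed.

Lemma isotropic_maximal m (Z : 'M[K]_(m, 4 + 4)) u : isotropic Z -> \rank Z = 4%N ->
  (forall z, (z <= Z)%MS -> pairV u z = 0) -> (u <= Z)%MS.
Proof.
move=> iso rkZ orth.
have sub : (Z <= kermx (gramV *m Z^T))%MS by apply/sub_kermxP; rewrite mulmxA.
have -> : (Z :=: kermx (gramV *m Z^T))%MS.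
  apply/eqmxP/andP; rewrite sub; split=> //.
  (* The orthogonal of [Z] has rank [8 - 4], which is the rank of [Z]. *)
  rewrite -(geq_leqif (mxrank_leqif_sup sub)) mxrank_ker -mxrank_tr trmx_mul trmxK.
  rewrite mxrankMfree ?rkZ // row_free_unit unitmx_tr; exact: gramV_unit.
apply/sub_kermxP/rowP => j; rewrite mulmxA [RHS]mxE.
have := orth (row j Z) (row_sub _ _); rewrite pairV_gram tr_row => e; apply: etrans e.
by rewrite [LHS]mxE [RHS]mxE; apply: eq_bigr => k _; congr (_ * _); rewrite !mxE.
Qed.

Lemma pairV_antisym_gram (T : 'M[K]_(4 + 4)) :
  (forall u v, pairV (u *m T) v = - pairV u (v *m T)) ->
  T *m gramV = - (gramV *m T^T).
Proof.
move=> anti; apply/matrixP => i j.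
have := anti (delta_mx 0 i) (delta_mx 0 j).
rewrite !pairV_gram trmx_mul !mulmxA -(mulmxA _ T) -(mulmxA _ gramV T^T) !trmx_delta.
by rewrite -!rowE -!colE !mxE.
Qed.

(** The Weil condition counts eigenvalues on 1-forms, that is, on functionals vanishing on [Z]. The
    pairing identifies these functionals with the orthogonal of [Z], which is [Z] itself by
    maximality, and turns the transpose of the skew operator [T] into [- T]; hence the change of
    sign of the eigenvalue. *)
Lemma eigenspace_annihilator (T : 'M[K]_(4 + 4)) (Z : 'M[K]_(4 + 4)) a :
  (forall u v, pairV (u *m T) v = - pairV u (v *m T)) -> isotropic Z -> \rank Z = 4%N ->
  \rank (eigenspace T^T a :&: kermx Z^T)%MS = \rank (Z :&: eigenspace T (- a))%MS.
Proof.
move=> /pairV_antisym_gram anti iso rkZ.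
have anti' : gramV *m T = - (T^T *m gramV).
  rewrite -[LHS]mulmx1 -gramV_sqr mulmxA -(mulmxA gramV T) anti mulmxN mulNmx.
  by rewrite !mulmxA gramV_sqr mul1mx.
have fwd (p : 'rV[K]_(4 + 4)) : (p <= eigenspace T^T a :&: kermx Z^T)%MS =
    (p *m gramV <= Z :&: eigenspace T (- a))%MS.
  rewrite !sub_capmx andbC; congr (_ && _); apply/idP/idP.
  - move=> /sub_kermxP pZ; apply: isotropic_maximal => // z /submxP[b ->].
    by rewrite pairV_gram -(mulmxA p) gramV_sqr mulmx1 trmx_mul mulmxA pZ mul0mx mxE.
  - move=> /submxP[b pb]; apply/sub_kermxP.
    rewrite -[p]mulmx1 -gramV_sqr mulmxA pb -!mulmxA (mulmxA Z) iso; exact: mulmx0.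
  - move=> /eigenspaceP pa; apply/eigenspaceP.
    by rewrite -mulmxA anti' mulmxN mulmxA pa scaleNr scalemxAl.
  - move=> /eigenspaceP pa; apply/eigenspaceP.
    have : p *m gramV *m T *m gramV = (- a) *: (p *m gramV) *m gramV by rewrite pa.
    rewrite -(mulmxA p) anti' mulmxN mulNmx -!mulmxA gramV_sqr mulmx1 -scalemxAl -!mulmxA gramV_sqr mulmx1.
    by rewrite scaleNr => /oppr_inj.
have eqs : ((eigenspace T^T a :&: kermx Z^T)%MS *m gramV :=: Z :&: eigenspace T (- a))%MS.
  apply/eqmxP/andP; split.
    by apply/row_subP => i; rewrite row_mul -fwd row_sub.
  apply/row_subP => i; rewrite -[row i _]mulmx1 -gramV_sqr mulmxA; apply: submxMr.
  by rewrite fwd -mulmxA gramV_sqr mulmx1 row_sub.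
by rewrite -eqs mxrankMfree // row_free_unit gramV_unit.
Qed.

End LinearAlgebra.

(** * Even spinors and nondegeneracy *)

Section EvenPairing.
Variables (R : realType) (X : abelian_surface R) (A : comNzRingType).
Implicit Types (s t y z : ext A).

Local Notation "'[ s , t ]" := (pairS X s t).

Lemma even_mono (I : {set 'I_4}) : ~~ odd #|I| -> is_even (mono A I).
Proof. by move=> ev J oJ; rewrite coef_mono; case: eqP oJ ev => // -> ->. Qed.

Lemma is_evenD y z : is_even y -> is_even z -> is_even (y + z).
Proof. by move=> evy evz; rewrite -[y]scale1r; apply: is_evenZD. Qed.

Lemma is_evenZ a y : is_even y -> is_even (a *: y).
Proof. by move=> evy; rewrite -[_ *: _]addr0; apply: is_evenZD => // I _; rewrite /coef mxE. Qed.

Lemma is_evenN y : is_even y -> is_even (- y).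
Proof. by rewrite -scaleN1r; apply: is_evenZ. Qed.

Lemma even_ext_sum s : is_even s -> s = \sum_(I : {set 'I_4} | ~~ odd #|I|) coef s I *: mono A I.
Proof.
move=> ev; apply/rowP => j; rewrite -[j]enum_valK; set J := enum_val j.
rewrite -[LHS]/(coef s J) -[RHS]/(coef _ J) ext_coef_sum.
have [oJ|eJ] := boolP (odd #|J|).
  rewrite ev // big1 // => I eI; rewrite coefZmono; case: eqP eI => [<-|_ _]; last by rewrite mulr0.
  by rewrite oJ.
rewrite (bigD1 J) //= coefZmono eqxx mulr1 big1 ?addr0 // => I /andP[_ neI].
by rewrite coefZmono eq_sym (negbTE neI) mulr0.
Qed.

Lemma pairS_even_sum s t : is_even s ->
  '[s, t] = \sum_(I : {set 'I_4} | ~~ odd #|I|) coef s I * '[mono A I, t].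
Proof.
move=> /even_ext_sum {1}->; elim/big_rec2: _ => [|I x y _ <-]; first by rewrite pairS0l.
by rewrite pairSDl pairSZl.
Qed.

Lemma coef_mono_bitset b0 b1 b2 b3 c0 c1 c2 c3 :
  coef (mono A (bitset b0 b1 b2 b3)) (bitset c0 c1 c2 c3) =
  [&& c0 == b0, c1 == b1, c2 == b2 & c3 == b3]%:R.
Proof.
rewrite coef_mono; congr (nat_of_bool _)%:R; apply/eqP/idP => [e|/and4P[]].
  by have := (in_bitset c0 c1 c2 c3, in_bitset b0 b1 b2 b3); rewrite e => -[m1 m2];
    move: (m1 i0) (m1 i1) (m1 i2) (m1 i3); rewrite !m2 /= => <- <- <- <-; rewrite !eqxx.
by do 4 move=> /eqP->.
Qed.

Lemma pairS_mono b0 b1 b2 b3 s : '[mono A (bitset b0 b1 b2 b3), s] =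
  orientation X A * ((-1) ^+ (b1 (+) b3) * coef s (bitset (~~ b0) (~~ b1) (~~ b2) (~~ b3))).
Proof.
rewrite pairSE !coef_mono_bitset; congr (_ * _).
by case: b0; case: b1; case: b2; case: b3; rewrite /= ?expr0 ?expr1; ring.
Qed.

(** Pairing with a monomial reads off the complementary coefficient up to a sign, and the complement
    of an even subset of a set of four elements is even. *)
Lemma pairS_even_nondeg s : is_even s ->
  (forall I : {set 'I_4}, ~~ odd #|I| -> '[mono A I, s] = 0) -> s = 0.
Proof.
move=> /is_evenP ev orth; apply: extP => b0 b1 b2 b3; rewrite [RHS]mxE.
have [|evb] := boolP (b0 (+) b1 (+) b2 (+) b3); first exact: ev.
have := orth (bitset (~~ b0) (~~ b1) (~~ b2) (~~ b3)); rewrite card_bitset.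
have -> : ~~ odd (~~ b0 + ~~ b1 + ~~ b2 + ~~ b3).
  by move: evb; case: b0; case: b1; case: b2; case: b3.
move=> /(_ isT).
rewrite pairS_mono !negbK => e0.
have := congr1 (fun x => (-1) ^+ (~~ b1 (+) ~~ b3) * (orientation X A * x)) e0.
by rewrite /= !mulr0 (mulrA (orientation _ _)) orientation_sqr mul1r mulrA -expr2 sqrr_sign mul1r.
Qed.

Lemma card_even_sets : (\sum_(I : {set 'I_4} | ~~ odd #|I|) 1)%N = 8%N.
Proof. by rewrite big_mkcond big_sets !big_bool !card_bitset. Qed.

End EvenPairing.

(* Otherwise the orthogonal projection onto the complement of [w, h, l, l'] in the
   8-dimensional even part would vanish, although its trace is 4. *)
Lemma exists_orthogonal (R : realType) (X : abelian_surface R) (K : numFieldType)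
    (w h l l' : ext K) :
  is_even w -> is_even h -> is_even l -> is_even l' ->
  pairS X w w != 0 -> pairS X h h != 0 -> pairS X l l' != 0 ->
  pairS X w h = 0 -> pairS X l w = 0 -> pairS X l h = 0 -> pairS X l' w = 0 -> pairS X l' h = 0 ->
  pairS X l l = 0 -> pairS X l' l' = 0 ->
  exists e : ext K, [/\ is_even e, pairS X w e = 0, pairS X h e = 0, pairS X l e = 0 & pairS X e e != 0].
Proof.
move=> evw evh evl evl' ww hh ll' wh lw lh l'w l'h ll l'l'.
have [pr prE] : exists pr : ext K -> ext K, forall x, pr x = x - (pairS X x w / pairS X w w) *: w - (pairS X x h / pairS X h h) *: h
  - (pairS X x l' / pairS X l l') *: l - (pairS X x l / pairS X l l') *: l' by eexists.
have pr_orth x y : pairS X (pr x) y = pairS X x y - pairS X x w / pairS X w w * pairS X w y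
   - pairS X x h / pairS X h h * pairS X h y
   - pairS X x l' / pairS X l l' * pairS X l y - pairS X x l / pairS X l l' * pairS X l' y.
  by rewrite prE !pairSDl -!scaleNr !pairSZl !mulNr.
have prw x : pairS X (pr x) w = 0.
  by rewrite pr_orth (pairSC _ h) wh lw l'w !mulr0 !subr0 mulfVK ?subrr.
have prh x : pairS X (pr x) h = 0.
  by rewrite pr_orth wh lh l'h !mulr0 !subr0 mulfVK ?subrr.
have prl x : pairS X (pr x) l = 0.
  by rewrite pr_orth !(pairSC _ _ l) lw lh ll !mulr0 !subr0 mulfVK ?subrr.
have prl' x : pairS X (pr x) l' = 0.
  by rewrite pr_orth (pairSC _ w) (pairSC _ h) l'w l'h l'l' !mulr0 !subr0 mulfVK ?subrr.
have pr_even x : is_even x -> is_even (pr x).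
  by move=> evx; rewrite prE; do 4 (apply: is_evenD; last by apply/is_evenN/is_evenZ).
have prr x y : pairS X (pr x) (pr y) = pairS X (pr x) y.
  by rewrite [pr y]prE !pairSDr -!scaleNr !pairSZr prw prh prl prl' !mulr0 !addr0.
(* Polarization: if the form vanishes on all these sums, the case [I = J] kills the squares, and
   then the mixed products vanish too. *)
pose q I J : ext K := pr (mono K I) + pr (mono K J).
have [/existsP[I /existsP[J /and3P[evI evJ nz]]]|none] :=
  boolP [exists I : {set 'I_4}, exists J : {set 'I_4}, [&& ~~ odd #|I|, ~~ odd #|J| & pairS X (q I J) (q I J) != 0]].
  exists (q I J); split=> //; try by rewrite pairSC /q pairSDl (prw, prh, prl) (prw, prh, prl) addr0.
  by apply: is_evenD; apply: pr_even; apply: even_mono.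
have none' (I J : {set 'I_4}) : ~~ odd #|I| -> ~~ odd #|J| -> pairS X (q I J) (q I J) = 0.
  move=> evI evJ; apply/eqP; move: none; apply: contraNT => nz.
  by apply/existsP; exists I; apply/existsP; exists J; rewrite evI evJ.
have iso (I : {set 'I_4}) : ~~ odd #|I| -> pairS X (pr (mono K I)) (pr (mono K I)) = 0.
  move=> evI; have := none' I I evI evI; rewrite /q !pairSDl !pairSDr => /eqP.
  by rewrite -mulr2n -mulr2n !mulrn_eq0 /= => /eqP.
have iso2 (I J : {set 'I_4}) : ~~ odd #|I| -> ~~ odd #|J| -> pairS X (pr (mono K I)) (pr (mono K J)) = 0.
  move=> evI evJ; have := none' I J evI evJ; rewrite /q !pairSDl !pairSDr => /eqP.
  by rewrite !iso // add0r addr0 [X in _ + X]pairSC -mulr2n mulrn_eq0 /= => /eqP.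
have pr0 (I : {set 'I_4}) : ~~ odd #|I| -> pr (mono K I) = 0.
  move=> evI; apply: (@pairS_even_nondeg _ X).
    by apply: pr_even; apply: even_mono.
  by move=> J evJ; rewrite pairSC -prr iso2.
have tr0 : \sum_(I : {set 'I_4} | ~~ odd #|I|) coef (pr (mono K I)) I = 0.
  by rewrite big1 // => I evI; rewrite pr0 // /coef mxE.
have : \sum_(I : {set 'I_4} | ~~ odd #|I|) coef (pr (mono K I)) I = 4%:R.
  (* The identity of the even part has trace 8, and each of the four removed rank one terms has
     trace 1. *)
  transitivity (8%:R - pairS X w w / pairS X w w - pairS X h h / pairS X h h
     - pairS X l l' / pairS X l l' - pairS X l' l / pairS X l l').
    have -> : 8%:R = \sum_(I : {set 'I_4} | ~~ odd #|I|) 1 :> K.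
      by rewrite -card_even_sets natr_sum.
    have tr y z c : is_even y -> pairS X y z * c =
        \sum_(I : {set 'I_4} | ~~ odd #|I|) coef y I * pairS X (mono K I) z * c.
      by move=> evy; rewrite -mulr_suml -pairS_even_sum.
    rewrite (tr w w _ evw) (tr h h _ evh) (tr l l' _ evl) (tr l' l _ evl').
    rewrite -!sumrB; apply: eq_bigr => I _.
    rewrite prE -!scaleNr !(ext_coefD, ext_coefZ) coef_mono eqxx /=; ring.
  rewrite (pairSC X l') !divff //; ring.
by move=> e; move: tr0; rewrite e => /eqP; rewrite pnatr_eq0.
Qed.

(** * Complex conjugation and hermitian forms *)

Section Conjugation.
Variables (R : realType) (X : abelian_surface R) (C : numClosedFieldType).
Implicit Types (s t y z : ext C) (u v : 'rV[C]_(4 + 4)).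

Let conjC : {rmorphism C -> C} := Num.conj.

Definition conjm m N (M : 'M[C]_(m, N)) : 'M[C]_(m, N) := map_mx Num.conj M.

Lemma conj_mxK m N (M : 'M[C]_(m, N)) : conjm (conjm M) = M.
Proof. by apply/matrixP => i j; rewrite !mxE conjCK. Qed.

Lemma conj_mxZ m N a (M : 'M[C]_(m, N)) : conjm (a *: M) = a^* *: conjm M.
Proof. exact: (map_mxZ conjC). Qed.

Lemma conj_mxD m N (M P : 'M[C]_(m, N)) : conjm (M + P) = conjm M + conjm P.
Proof. exact: (map_mxD conjC). Qed.

Lemma conj_mxN m N (M : 'M[C]_(m, N)) : conjm (- M) = - conjm M.
Proof. exact: (map_mxN conjC). Qed.

Lemma conj_mx0 m N : conjm (0 : 'M[C]_(m, N)) = 0.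
Proof. exact: (map_mx0 conjC). Qed.

Lemma conj_map_intr m N (M : 'M[int]_(m, N)) : conjm (map_mx intr M : 'M[C]_(m, N)) = map_mx intr M.
Proof. by apply/matrixP => i j; rewrite !mxE; apply: (rmorph_int conjC). Qed.

Lemma conj_submx m n p (M : 'M[C]_(m, p)) (P : 'M[C]_(n, p)) :
  (conjm M <= conjm P)%MS = (M <= P)%MS.
Proof. exact: (map_submx conjC). Qed.

Lemma rank_conj m N (M : 'M[C]_(m, N)) : \rank (conjm M) = \rank M.
Proof. exact: (mxrank_map conjC). Qed.

Lemma conj_clifford v s : conjm (clifford v s) = clifford (conjm v) (conjm s : ext C).
Proof. exact: (map_clifford conjC). Qed.

Lemma conj_pairS s t : (pairS X s t)^* = pairS X (conjm s : ext C) (conjm t : ext C).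
Proof. exact: (map_pairS X conjC). Qed.

Lemma conj_pairV u v : (pairV u v)^* = pairV (conjm u) (conjm v).
Proof. exact: (map_pairV conjC). Qed.

Lemma conj_adj y t : conjm (m_adj X y t) = m_adj X (conjm y : ext C) (conjm t : ext C).
Proof. exact: (map_adj X conjC). Qed.

Lemma conj_even s : is_even s -> is_even (conjm s : ext C).
Proof. exact: (map_even conjC). Qed.

Lemma hermS_real s : pairS X s (conjm s : ext C) \is Num.real.
Proof. by rewrite CrealE conj_pairS conj_mxK pairSC. Qed.

Lemma hermV_real u : pairV u (conjm u) \is Num.real.
Proof. by rewrite CrealE conj_pairV conj_mxK pairVC. Qed.

End Conjugation.

(** * Annihilators of null spinors *)

Section SpinorKernel.
Variables (R : realType) (X : abelian_surface R) (C : numClosedFieldType).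
Local Notation "'[ s , t ]" := (pairS X s t).
Local Notation adj := (m_adj X).

(** The matrix of [Zker], over any closed field instead of [Cplx R]; the two agree by conversion
    when the field is [Cplx R]. *)
Definition spinor_ker (l : ext C) : 'M[C]_(4 + 4) := kermx (lin1_mx (fun v => clifford v l)).

Lemma spinor_kerP (l : ext C) (v : 'rV_(4 + 4)) : (v <= spinor_ker l)%MS <-> clifford v l = 0.
Proof.
rewrite -(lin1_mxE (f := fun v => clifford v l)) => [|a u1 u2]; last exact: clifford_linear.
by split=> [/sub_kermxP|/sub_kermxP].
Qed.

Lemma addrr_eq0 (V : lmodType C) (x : V) : x + x = 0 -> x = 0.
Proof.
by rewrite -mulr2n -scaler_nat => /eqP; rewrite scaler_eq0 pnatr_eq0 => /eqP.
Qed.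

Lemma sub_conjm m (v : 'rV[C]_m) (Z : 'M[C]_m) : (v <= conjm Z)%MS = (conjm v <= Z)%MS.
Proof. by rewrite -[X in (X <= _)%MS]conj_mxK conj_submx. Qed.

Lemma spinor_kernel_isotropic (l : ext C) : l != 0 -> isotropic (spinor_ker l).
Proof.
move=> l0; apply/isotropicP => u v /spinor_kerP ul /spinor_kerP vl; apply/eqP.
by have := ker_isotropic ul vl => /eqP; rewrite scaler_eq0 (negbTE l0) orbF.
Qed.

Variable l : ext C.
Hypotheses (l_even : is_even l) (l_null : '[l, l] = 0) (l_neg : '[l, conjm l] < 0).

Local Notation lb := (conjm l : ext C).
Local Notation N := '[l, lb].

Lemma period_neq0 : l != 0.
Proof. by apply: contraTneq l_neg => ->; rewrite pairS0l ltxx. Qed.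

Lemma conj_null : '[lb, lb] = 0.
Proof. by rewrite -conj_pairS l_null conjC0. Qed.

Lemma adj_in_kernel t : is_odd t -> clifford (adj l t) l = 0.
Proof. by move=> odt; apply: addrr_eq0; rewrite clifford_adj // l_null scale0r. Qed.

Lemma adj_in_conj_kernel t : is_odd t -> clifford (adj lb t) lb = 0.
Proof.
by move=> odt; apply: addrr_eq0; rewrite clifford_adj ?conj_null ?scale0r //; exact: conj_even.
Qed.

(** By [adj_in_kernel] and [adj_in_conj_kernel], for even null [l] the first summand annihilates [l]
    and the second one its conjugate; with [N] nonzero this is an explicit Hodge decomposition of
    [v]. *)
Lemma kernel_decomposition v : N *: v = adj l (clifford v lb) + adj lb (clifford v l).
Proof. by rewrite adj_clifford. Qed.

Lemma conj_kernel v : (v <= conjm (spinor_ker l))%MS <-> clifford v lb = 0.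
Proof.
rewrite sub_conjm; split=> [/spinor_kerP|] e; last apply/spinor_kerP.
  by rewrite -[v]conj_mxK -conj_clifford e conj_mx0.
by rewrite -[l]conj_mxK -conj_clifford e conj_mx0.
Qed.

Lemma kernel_cap : (spinor_ker l :&: conjm (spinor_ker l))%MS = 0.
Proof.
apply/eqP; rewrite -submx0; apply/row_subP => i; move: (row_sub i (spinor_ker l :&: conjm (spinor_ker l))%MS).
rewrite sub_capmx => /andP[/spinor_kerP vl /conj_kernel vlb]; rewrite submx0.
have := kernel_decomposition (row i (spinor_ker l :&: conjm (spinor_ker l))%MS).
rewrite vl vlb !adj0r addr0 => /eqP; rewrite scaler_eq0 => /orP[/eqP N0|//].
by move: l_neg; rewrite N0 ltxx.
Qed.

Lemma kernel_rank : \rank (spinor_ker l) = 4%N.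
Proof.
have full : (1%:M <= spinor_ker l + conjm (spinor_ker l))%MS.
  apply/row_subP => i; move: (row i _) => v.
  rewrite -[v]scale1r -(mulVf (ltr0_neq0 l_neg)) -scalerA kernel_decomposition.
  apply/scalemx_sub/addmx_sub_adds.
    by apply/spinor_kerP/adj_in_kernel/clifford_even/conj_even.
  by apply/conj_kernel/adj_in_conj_kernel/clifford_even.
have := mxrank_sum_cap (spinor_ker l) (conjm (spinor_ker l)).
rewrite kernel_cap mxrank0 addn0 rank_conj (eqP (_ : row_full _)) -?sub1mx //.
by move=> e; apply: double_inj; rewrite -addnn -e.
Qed.

(* The endomorphism [v |-> adj y (v . l)] vanishes, since its values annihilate
   the anisotropic vector [w]. *)
Lemma kernel_determines (w y : ext C) : is_even w -> is_even y ->
  '[w, w] != 0 -> '[l, w] = 0 -> '[y, w] = 0 ->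
  (forall v, clifford v l = 0 -> clifford v y = 0) -> exists c, y = c *: l.
Proof.
move=> evw evy ww lw yw sub.
have N0 := ltr0_neq0 l_neg.
have yl : '[l, y] = 0.
  (* A nonzero vector [z] annihilating both spinors forces [(l, y) z = 0] by [adj_clifford]. *)
  have : nz_row (spinor_ker l) != 0 by rewrite nz_row_eq0 -mxrank_eq0 kernel_rank.
  have /spinor_kerP zl := nz_row_sub (spinor_ker l).
  move: (nz_row _) zl => z zl z0; have := adj_clifford X l y z.
  by rewrite sub // zl !adj0r addr0 => /esym/eqP; rewrite scaler_eq0 (negbTE z0) orbF => /eqP.
have prod v z : is_even z -> clifford (adj y (clifford v l)) z = '[y, z] *: clifford v l - '[l, z] *: clifford v y.
  move=> evz; apply/eqP; rewrite eq_sym subr_eq; apply/eqP.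
  rewrite -(clifford_adj X evy evz); last exact: clifford_even.
  congr (_ + _); have -> : adj z (clifford v l) = '[l, z] *: v - adj l (clifford v z).
    by rewrite (pairSC X l) -adj_clifford addrK.
  have yk : clifford (adj l (clifford v z)) y = 0 by apply/sub/adj_in_kernel/clifford_even.
  by rewrite cliffordDl cliffordZl -[- adj _ _]scaleN1r cliffordZl yk scaler0 addr0.
have phi0 v : adj y (clifford v l) = 0.
  apply: (scalerI ww); rewrite scaler0 -adj_clifford.
  by rewrite prod // lw yw !scale0r subrr adj0r addr0.
have inj (s : ext C) : (forall v, clifford v s = 0) -> s = 0.
  move=> s0; have := clifford_anticomm (basisV C i0 true) (basisV C i0 false) s.
  by rewrite !s0 !clifford0r addr0 pairV_basisV coordV_basisV /= scale1r.
(* The constant is found by pairing with the conjugate of [l]. At [z = lb], [prod] compares the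
   actions of any [v] on [N *: y] and on ['[y, lb] *: l], and a spinor killed by all vectors is
   zero. *)
exists ('[y, lb] / N); apply: (scalerI N0); rewrite scalerA mulrC mulfVK //.
apply/eqP; rewrite -subr_eq0; apply/eqP/inj => v.
have := prod v lb (conj_even l_even); rewrite phi0 clifford0l => /esym/eqP.
by rewrite subr_eq0 cliffordDr -scaleNr !cliffordZr scaleNr => /eqP ->; rewrite subrr.
Qed.

End SpinorKernel.

(** * Eigenspaces of the operator theta *)

Section WeilOperator.
Variables (R : realType) (X : abelian_surface R) (C : numClosedFieldType).
Local Notation "'[ s , t ]" := (pairS X s t).
Local Notation adj := (m_adj X).
Variables (w h : ext C) (T : 'M[C]_(4 + 4)) (lam : C).
Hypotheses (w_even : is_even w) (h_even : is_even h).
Hypotheses (w_real : conjm w = w) (h_real : conjm h = h).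
Hypotheses (w_neg : '[w, w] < 0) (h_neg : '[h, h] < 0) (wh : '[w, h] = 0).
Hypothesis TE : forall v, v *m T = theta X w h v.
Hypothesis lam_sqr : 4%:R * lam ^+ 2 = - ('[w, w] * '[h, h]).

Lemma lam_sqr_neg : lam ^+ 2 < 0.
Proof.
rewrite -(pmulr_rlt0 _ (ltr0n C 4)) lam_sqr oppr_lt0 nmulr_rgt0 //.
Qed.

Lemma lam_neq0 : lam != 0.
Proof. by apply: contraTneq lam_sqr_neg => ->; rewrite expr0n ltxx. Qed.

Lemma conj_lam : lam^* = - lam.
Proof.
have lam2 : (lam ^+ 2)^* = lam ^+ 2 by apply/CrealP/ltr0_real/lam_sqr_neg.
have /eqP : (lam^*) ^+ 2 = lam ^+ 2 by rewrite -lam2 rmorphXn.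
rewrite eqf_sqr => /orP[/eqP/CrealP lamR|/eqP //].
by move: lam_sqr_neg; rewrite (le_gtF _) // real_exprn_even_ge0.
Qed.

Lemma theta_theta v : theta X w h (theta X w h v) = lam ^+ 2 *: v.
Proof.
have n4 : 4%:R != 0 :> C by rewrite pnatr_eq0.
by apply: (scalerI n4); rewrite theta_sqr // scalerA lam_sqr.
Qed.

Lemma conj_theta v : conjm (theta X w h v) = theta X w h (conjm v).
Proof. by rewrite /theta conj_adj conj_clifford w_real h_real. Qed.

Lemma eigenvectorP v a : (v <= eigenspace T a)%MS <-> theta X w h v = a *: v.
Proof. by rewrite -TE; split=> /eigenspaceP. Qed.

Lemma eigen_conj v a : theta X w h v = a *: v -> theta X w h (conjm v) = a^* *: conjm v.
Proof. by rewrite -conj_theta => ->; rewrite conj_mxZ. Qed.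

(** Skewness of [theta] gives [a (u, v) = - b (u, v)]. *)
Lemma eigen_orth u v a b : theta X w h u = a *: u -> theta X w h v = b *: v ->
  a + b != 0 -> pairV u v = 0.
Proof.
move=> ua vb ab; apply/eqP; rewrite -[_ == 0](mulrI_eq0 _ (mulfI ab)) mulrDl.
by rewrite -pairVZl -ua theta_antisym // vb pairVZr addNr.
Qed.

Lemma eigen_split (G : 'M[C]_(4 + 4)) (u : 'rV[C]_(4 + 4)) : stablemx G T -> (u <= G)%MS ->
  exists u1 u2 : 'rV[C]_(4 + 4), [/\ u = u1 + u2, (u1 <= G :&: eigenspace T lam)%MS & (u2 <= G :&: eigenspace T (- lam))%MS].
Proof.
move=> stG uG; have l2 : 2%:R * lam != 0 by rewrite mulf_neq0 ?lam_neq0 ?pnatr_eq0.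
have tuG : (theta X w h u <= G)%MS.
  by rewrite -TE; exact: submx_trans (submxMr T uG) stG.
(* The spectral projections [(lam + theta) / (2 lam)] and [(lam - theta) / (2 lam)]. *)
exists ((2%:R * lam)^-1 *: (lam *: u + theta X w h u)), ((2%:R * lam)^-1 *: (lam *: u - theta X w h u)).
split.
- have ll : lam + lam = 2%:R * lam by rewrite mulr_natl mulr2n.
  by rewrite -scalerDr addrACA subrr addr0 -scalerDl ll scalerA mulVf // scale1r.
- apply: scalemx_sub; rewrite sub_capmx addmx_sub ?scalemx_sub //; apply/eigenvectorP.
  by rewrite thetaZD theta_theta scalerDr scalerA addrC.
- apply: scalemx_sub; rewrite sub_capmx addmx_sub ?scalemx_sub ?eqmx_opp //; apply/eigenvectorP.
  by rewrite thetaZD thetaN theta_theta scalerBr !scaleNr opprK scalerA -expr2 addrC.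
Qed.

Lemma eigen_disjoint : (eigenspace T lam :&: eigenspace T (- lam))%MS = 0.
Proof.
apply/eqP; rewrite -submx0; apply/row_subP => i; have := row_sub i (eigenspace T lam :&: eigenspace T (- lam))%MS.
move: (row i _) => v; rewrite sub_capmx => /andP[/eigenvectorP v1 /eigenvectorP].
rewrite v1 => /eqP; rewrite -subr_eq0 -scalerBl opprK scaler_eq0 -mulr2n mulrn_eq0 /= (negbTE lam_neq0).
by rewrite submx0.
Qed.

Lemma eigen_rank_sum (G : 'M[C]_(4 + 4)) : stablemx G T ->
  (\rank (G :&: eigenspace T lam)%MS + \rank (G :&: eigenspace T (- lam))%MS)%N = \rank G.
Proof.
move=> stG; rewrite -mxrank_sum_cap.
have -> : ((G :&: eigenspace T lam) :&: (G :&: eigenspace T (- lam)) = 0)%MS.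
  by apply/eqP; rewrite -submx0 -eigen_disjoint capmxS ?capmxSr.
rewrite mxrank0 addn0; suff e : (G :&: eigenspace T lam + G :&: eigenspace T (- lam) :=: G)%MS by rewrite e.
apply/eqmxP/andP; split; first by rewrite addsmx_sub; apply/andP; split; apply: capmxSl.
apply/row_subP => i.
have [u1 [u2 [-> u1G u2G]]] := eigen_split stG (row_sub i G).
exact: addmx_sub_adds.
Qed.

Section Period.
Variable l : ext C.
Hypotheses (l_even : is_even l) (l_null : '[l, l] = 0) (l_neg : '[l, conjm l] < 0).
Hypotheses (lw : '[l, w] = 0) (lh : '[l, h] = 0).

Local Notation lb := (conjm l : ext C).
Local Notation Z := (spinor_ker l).

Lemma kernel_stable : stablemx Z T.
Proof.
apply/row_subP => i; rewrite row_mul TE.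
apply/spinor_kerP.
have /spinor_kerP vl : (row i Z <= Z)%MS by apply: row_sub.
exact: theta_ker vl.
Qed.

Lemma conj_orth_w : '[lb, w] = 0. Proof. by rewrite -[w]w_real -conj_pairS lw conjC0. Qed.
Lemma conj_orth_h : '[lb, h] = 0. Proof. by rewrite -[h]h_real -conj_pairS lh conjC0. Qed.

(* [theta w e] anticommutes with [theta w h], hence exchanges the eigenspaces, when
   [e] is anisotropic and orthogonal to [w], [h] and [l]. *)
Lemma kernel_eigen_rank a : a = lam \/ a = - lam -> \rank (Z :&: eigenspace T a)%MS = 2%N.
Proof.
have lb_even := conj_even l_even.
have ww0 := ltr0_neq0 w_neg; have n4 : 4%:R != 0 :> C by rewrite pnatr_eq0.
have [e [eve we he le ee]] := exists_orthogonal w_even h_even l_even lb_even ww0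
  (ltr0_neq0 h_neg) (ltr0_neq0 l_neg) wh lw lh conj_orth_w conj_orth_h l_null (conj_null l_null).
pose M := lin1_mx (theta X w e).
have ME v : v *m M = theta X w e v by apply: lin1_mxE => b u1 u2; rewrite thetaZD.
have freeM : row_free M.
  rewrite row_free_unit; suff : M *m M \in unitmx by rewrite unitmx_mul => /andP[].
  have -> : M *m M = (- ('[w, w] * '[e, e]) / 4%:R)%:M.
    apply/row_matrixP => i; rewrite !rowE mulmxA !ME mul_mx_scalar.
    by apply: (scalerI n4); rewrite (theta_sqr w_even eve we) scalerA [in RHS]mulrC mulfVK.
  by rewrite unitmxE det_scalar unitrX // unitfE mulf_neq0 ?invr_eq0 // oppr_eq0 mulf_neq0.
(* [M] maps each eigenspace injectively into the other one and preserves [Z], so the two ranks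
   agree; as they add up to 4, both are 2. *)
have le_rank b : (\rank (Z :&: eigenspace T b)%MS <= \rank (Z :&: eigenspace T (- b))%MS)%N.
  have <- := mxrankMfree (Z :&: eigenspace T b)%MS freeM.
  apply: mxrankS.
  apply/row_subP => i.
  have := row_sub i (Z :&: eigenspace T b)%MS; rewrite row_mul ME; move: (row i _) => v.
  rewrite !sub_capmx => /andP[/spinor_kerP vl /eigenvectorP vb]; apply/andP; split.
    by apply/spinor_kerP; exact: (theta_ker w_even eve l_even lw le vl).
  apply/eigenvectorP; have n2 : 2%:R != 0 :> C by rewrite pnatr_eq0.
  have := theta_anticomm w_even v h_even eve wh we.
  rewrite he mulr0 oppr0 scale0r => /eqP; rewrite scaler_eq0 (negbTE n2) /= addr_eq0 vb.
  by move=> /eqP->; rewrite thetaZ scaleNr.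
have sum4 := eigen_rank_sum kernel_stable; rewrite (kernel_rank l_even l_null l_neg) in sum4.
have := le_rank (- lam); rewrite opprK => le1; have := le_rank lam => le2.
have e12 : \rank (Z :&: eigenspace T lam)%MS = \rank (Z :&: eigenspace T (- lam))%MS by apply/eqP; rewrite eqn_leq le1 le2.
have e2 : \rank (Z :&: eigenspace T lam)%MS = 2%N.
  by apply: double_inj; rewrite -addnn {2}e12 sum4.
by case=> -> //; rewrite -e12.
Qed.

Definition kernel_eigen a u := clifford u l = 0 /\ theta X w h u = a *: u.

Lemma kernel_eigenP a (u : 'rV[C]_(4 + 4)) : (u <= Z :&: eigenspace T a)%MS <-> kernel_eigen a u.
Proof.
rewrite sub_capmx; split=> [/andP[/spinor_kerP ul /eigenvectorP ua]|[ul ua]]; first by split.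
by apply/andP; split; [apply/spinor_kerP | apply/eigenvectorP].
Qed.

(* An antilinear map on the kernel of [l] that commutes with [theta] and squares
   to a negative scalar: each eigenspace is a quaternionic line. *)
Definition quat v := adj l (clifford (conjm v) w).

(** Minus this number is the square of [quat]. It is positive because [(l, conj l)] and [(w, w)] are
    both negative, which makes the structure quaternionic rather than real. *)
Definition quat_scale := '[l, lb] * '[w, w] / 2%:R.

Lemma quat_scale_gt0 : 0 < quat_scale.
Proof. by rewrite /quat_scale divr_gt0 ?ltr0n // nmulr_rgt0. Qed.

Lemma orth_wl : '[w, l] = 0. Proof. by rewrite pairSC. Qed.
Lemma orth_hw : '[h, w] = 0. Proof. by rewrite pairSC. Qed.

Lemma quatZ a v : quat (a *: v) = a^* *: quat v.
Proof. by rewrite /quat conj_mxZ cliffordZl adjZr. Qed.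

(** Moving [theta] through [quat] uses the three orthogonality relations among [l], [h] and [w],
    each with a minus sign; the resulting sign cancels the one in [a^* = - a]. *)
Lemma quat_eigen a v : a^* = - a -> kernel_eigen a v -> kernel_eigen a (quat v).
Proof.
move=> conja [vl va]; have odd_t := clifford_even (conjm v) w_even.
split; first exact: adj_in_kernel.
rewrite {1}/theta /quat (clifford_adj_orth l_even h_even odd_t lh) -scaleN1r adjZr.
rewrite (adj_clifford_orth _ orth_wl) scaleN1r opprK (adj_clifford_orth _ orth_hw).
by rewrite -/(theta X w h (conjm v)) (eigen_conj va) conja scaleNr opprK cliffordZl adjZr.
Qed.

Lemma quat_orth v : pairV (quat v) (conjm v) = 0.
Proof.
have := pairS_clifford2 X (conjm v) (conjm v) l w; rewrite lw mulr0 -m_adjP.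
rewrite [X in _ + X](pairSC X) -m_adjP -mulr2n => /eqP; rewrite mulrn_eq0 /=.
by move=> /eqP.
Qed.

Lemma sqr_norm_w u v : '[clifford u w, clifford v w] = pairV u v * '[w, w] / 2%:R.
Proof.
have n2 : 2%:R != 0 :> C by rewrite pnatr_eq0.
by apply: (mulIf n2); rewrite mulfVK // -pairS_clifford2 mulr_natr mulr2n.
Qed.

Lemma quat_norm v : clifford v l = 0 ->
  pairV (quat v) (conjm (quat v)) = quat_scale * pairV v (conjm v).
Proof.
move=> vl; have odd_t := clifford_even v w_even.
have -> : conjm (quat v) = adj lb (clifford v w).
  by rewrite /quat conj_adj conj_clifford conj_mxK w_real.
rewrite /quat m_adjP; have := clifford_adj X (conj_even l_even) l_even odd_t.
rewrite (adj_clifford_orth _ lw) vl adj0r oppr0 clifford0l addr0 (pairSC X lb) => ->.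
by rewrite pairSZl sqr_norm_w /quat_scale; ring.
Qed.

Lemma quat_quat v : clifford v l = 0 -> quat (quat v) = - quat_scale *: v.
Proof.
move=> vl; have odd_t := clifford_even v w_even.
have n2 : 2%:R != 0 :> C by rewrite pnatr_eq0.
rewrite {1}/quat /quat conj_adj conj_clifford conj_mxK w_real.
rewrite (clifford_adj_orth (conj_even l_even) w_even odd_t conj_orth_w) -scaleN1r adjZr scaleN1r.
have -> : adj w (clifford v w) = ('[w, w] / 2%:R) *: v.
  apply: (scalerI n2); rewrite scalerA mulrC mulfVK // -adj_clifford.
  by rewrite scaler_nat mulr2n.
rewrite cliffordZl adjZr; have := kernel_decomposition X l v.
rewrite vl adj0r addr0 => <-; rewrite scalerA -scaleNr /quat_scale; congr (_ *: _); ring.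
Qed.

Lemma conj_eigenvalue a : a = lam \/ a = - lam -> a^* = - a.
Proof. by case=> ->; rewrite -?conj_lam ?conjCK // conj_lam opprK. Qed.

Lemma kernel_eigen_span a v u : a = lam \/ a = - lam -> v != 0 ->
  kernel_eigen a v -> kernel_eigen a u -> exists b c, u = b *: v + c *: quat v.
Proof.
move=> ha v0 ev eu; have eq := quat_eigen (conj_eigenvalue ha) ev.
have sub : (v + quat v <= Z :&: eigenspace T a)%MS.
  by rewrite addsmx_sub; apply/andP; split; apply/kernel_eigenP.
(* If [quat v] were [b *: v], applying [quat] again would give [b * b^* = - quat_scale], a
   nonnegative number equal to a negative one. *)
have qv : ~~ (v + quat v <= v)%MS.
  apply/negP => /(submx_trans (addsmxSr v (quat v)))/sub_rVP[b qb].
  have [vl _] := ev; have := quat_quat vl.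
  rewrite qb quatZ qb scalerA => /eqP; rewrite -subr_eq0 -scalerBl opprK scaler_eq0 (negbTE v0) orbF.
  by rewrite gt_eqF // ltr_wpDl ?quat_scale_gt0 // mulrC mul_conjC_ge0.
have : (\rank v < \rank (v + quat v)%MS)%N by rewrite (ltn_leqif (mxrank_leqif_sup (addsmxSl _ _))).
rewrite rank_rV v0 => rk2.
have : (Z :&: eigenspace T a <= v + quat v)%MS.
  rewrite -(geq_leqif (mxrank_leqif_sup sub)) kernel_eigen_rank //.
move=> /(submx_trans (proj2 (kernel_eigenP a u) eu))/sub_addsmxP[[b c] /= ->].
by exists (b 0 0), (c 0 0); rewrite {1}[b]mx11_scalar {1}[c]mx11_scalar !mul_scalar_mx.
Qed.

(** The basis [v], [quat v] of the eigenspace is orthogonal for the hermitian form, and [quat]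
    scales norms by the positive factor [quat_scale]; all values are thus nonnegative multiples of
    the value at [v]. *)
Lemma kernel_eigen_herm a v u : a = lam \/ a = - lam -> v != 0 ->
  kernel_eigen a v -> kernel_eigen a u ->
  exists c, [/\ 0 <= c, u != 0 -> 0 < c & pairV u (conjm u) = c * pairV v (conjm v)].
Proof.
move=> ha v0 ev eu; have [b [c ub]] := kernel_eigen_span ha v0 ev eu.
exists (b * b^* + c * c^* * quat_scale); split.
- by rewrite addr_ge0 ?mul_conjC_ge0 // mulr_ge0 ?mul_conjC_ge0 // ltW ?quat_scale_gt0.
- move=> u0; have [b0|b0] := eqVneq b 0; last first.
    by rewrite ltr_pwDl ?mul_conjC_gt0 // mulr_ge0 ?mul_conjC_ge0 // ltW ?quat_scale_gt0.
  rewrite b0 mul0r add0r mulr_gt0 ?quat_scale_gt0 // mul_conjC_gt0.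
  by apply: contraNneq u0 => c0; rewrite ub b0 c0 !scale0r addr0.
have [vl _] := ev; have orth := quat_orth v.
have orth' : pairV v (conjm (quat v)) = 0.
  by have := congr1 Num.conj orth; rewrite conj_pairV conj_mxK conjC0 pairVC.
rewrite ub conj_mxD !conj_mxZ !(pairVDl, pairVDr) !(pairVZl, pairVZr) orth orth' quat_norm //; ring.
Qed.

(** Otherwise [conjm v] would be orthogonal to everything: to the conjugate of the kernel by
    isotropy, to the opposite eigenspace by [eigen_orth], and to its own eigenspace because [v] and
    [quat v] span it. *)
Lemma kernel_eigen_herm_neq0 a v : a = lam \/ a = - lam -> v != 0 ->
  kernel_eigen a v -> pairV v (conjm v) != 0.
Proof.
move=> ha v0 ev; apply/negP => /eqP Hv0; case/negP: (v0).
suff vb0 : conjm v = 0 by rewrite -[v]conj_mxK vb0 conj_mx0.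
apply: pairV_nondeg => x; rewrite pairV0l pairVC.
have N0 := ltr0_neq0 l_neg; have a0 : a != 0 by case: ha => ->; rewrite ?oppr_eq0 lam_neq0.
have [vl va] := ev.
apply: (mulfI N0); rewrite mulr0 -pairVZl kernel_decomposition pairVDl.
have vlb : clifford (conjm v) lb = 0 by rewrite -conj_clifford vl conj_mx0.
rewrite [X in _ + X]m_adjP vlb pairS0l addr0.
set z := adj l _; have zl : (z <= Z)%MS by apply/spinor_kerP/adj_in_kernel/clifford_even/conj_even.
have same z1 : kernel_eigen a z1 -> pairV z1 (conjm v) = 0.
  move=> ez1; have [b [c ->]] := kernel_eigen_span ha v0 ev ez1.
  by rewrite pairVDl !pairVZl Hv0 quat_orth !mulr0 addr0.
have other z2 : kernel_eigen (- a) z2 -> pairV z2 (conjm v) = 0.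
  move=> [_ z2a]; apply: (eigen_orth z2a (eigen_conj va)).
  by rewrite conj_eigenvalue // -opprD oppr_eq0 -mulr2n mulrn_eq0.
have [z1 [z2 [-> /kernel_eigenP e1 /kernel_eigenP e2]]] := eigen_split kernel_stable zl.
case: ha => ha; rewrite ha ?opprK in same other.
  by rewrite pairVDl (same z1) // (other z2) // addr0.
by rewrite pairVDl (other z1) // (same z2) // addr0.
Qed.

Lemma kernel_split u : clifford u l = 0 ->
  exists u1 u2, [/\ u = u1 + u2, kernel_eigen lam u1 & kernel_eigen (- lam) u2].
Proof.
move=> /spinor_kerP uZ; have [u1 [u2 [e /kernel_eigenP e1 /kernel_eigenP e2]]] := eigen_split kernel_stable uZ.
by exists u1, u2.
Qed.

Lemma lam_lam_neq0 : lam + lam != 0.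
Proof. by rewrite -mulr2n mulrn_eq0 lam_neq0. Qed.

Lemma conj_opp_lam : (- lam)^* = lam.
Proof. by rewrite -conj_lam conjCK. Qed.

Lemma kernel_herm_split u1 u2 : kernel_eigen lam u1 -> kernel_eigen (- lam) u2 ->
  pairV (u1 + u2) (conjm (u1 + u2)) = pairV u1 (conjm u1) + pairV u2 (conjm u2).
Proof.
move=> [_ e1] [_ e2]; have [c1 c2] := (eigen_conj e1, eigen_conj e2).
rewrite conj_mxD !pairVDl !pairVDr (eigen_orth e1 c2) ?(eigen_orth e2 c1) ?addr0 ?add0r //.
  by rewrite conj_lam -opprD oppr_eq0 lam_lam_neq0.
by rewrite conj_opp_lam lam_lam_neq0.
Qed.

Lemma kernel_theta_split u1 u2 : kernel_eigen lam u1 -> kernel_eigen (- lam) u2 ->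
  pairV (theta X w h (conjm (u1 + u2))) (u1 + u2) =
  - lam * (pairV u1 (conjm u1) - pairV u2 (conjm u2)).
Proof.
move=> [_ e1] [_ e2]; have [c1 c2] := (eigen_conj e1, eigen_conj e2).
have [o12 o21] : pairV (conjm u1) u2 = 0 /\ pairV (conjm u2) u1 = 0.
  split; [apply: (eigen_orth c1 e2) | apply: (eigen_orth c2 e1)].
    by rewrite conj_lam -opprD oppr_eq0 lam_lam_neq0.
  by rewrite conj_opp_lam lam_lam_neq0.
rewrite conj_mxD thetaD c1 c2 conj_opp_lam conj_lam !pairVDl !pairVDr !pairVZl o12 o21.
by rewrite !(pairVC (conjm _)); ring.
Qed.

Lemma exists_kernel_eigen a : a = lam \/ a = - lam -> exists2 v, v != 0 & kernel_eigen a v.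
Proof.
move=> ha; exists (nz_row (Z :&: eigenspace T a)%MS).
  by rewrite nz_row_eq0 -mxrank_eq0 kernel_eigen_rank.
by apply/kernel_eigenP/nz_row_sub.
Qed.

(** With equal signs the hermitian form would be definite on the kernel. But the real null vector
    [e0] is [z + conjm z] with [z] in the kernel, so that [0 = (e0, e0) = 2 (z, conj z)] would force
    [z = 0]. *)
Lemma kernel_herm_opposite v1 v2 : v1 != 0 -> v2 != 0 ->
  kernel_eigen lam v1 -> kernel_eigen (- lam) v2 -> pairV v1 (conjm v1) * pairV v2 (conjm v2) < 0.
Proof.
move=> v10 v20 e1 e2.
have hl : lam = lam \/ lam = - lam by left.
have hml : - lam = lam \/ - lam = - lam by right.
have H1 := kernel_eigen_herm_neq0 hl v10 e1; have H2 := kernel_eigen_herm_neq0 hml v20 e2.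
rewrite real_ltNge ?real0 ?realM ?hermV_real //; apply/negP => same.
have {same} same : 0 < pairV v1 (conjm v1) * pairV v2 (conjm v2) by rewrite lt0r mulf_neq0.
pose e0 := basisV C i0 true.
have e0_real : conjm e0 = e0 by apply: (map_basisV Num.conj).
have e0_null : pairV e0 e0 = 0 by rewrite pairV_basisV coordV_basisV.
have N0 := ltr0_neq0 l_neg.
(* The component of [e0] in the kernel, given by [kernel_decomposition]. *)
pose z := '[l, lb]^-1 *: adj l (clifford e0 lb).
have zl : clifford z l = 0.
  by rewrite /z cliffordZl adj_in_kernel ?scaler0 //; exact/clifford_even/conj_even.
have zb : conjm z = '[l, lb]^-1 *: adj lb (clifford e0 l).
  rewrite /z conj_mxZ conj_adj conj_clifford conj_mxK e0_real; congr (_ *: _).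
  by apply/CrealP; rewrite realV; exact: hermS_real.
have e0E : e0 = z + conjm z.
  by rewrite zb /z -scalerDr -kernel_decomposition scalerA mulVf // scale1r.
have zlb : clifford (conjm z) lb = 0 by rewrite -conj_clifford zl conj_mx0.
have isoz : pairV z z = 0.
  have := ker_isotropic zl zl => /eqP; rewrite scaler_eq0 (negbTE (period_neq0 l_neg)) orbF.
  by move=> /eqP.
have isozb : pairV (conjm z) (conjm z) = 0 by rewrite -conj_pairV isoz conjC0.
have Hz : pairV z (conjm z) = 0.
  move: e0_null; rewrite e0E !pairVDl !pairVDr isoz isozb add0r addr0 [X in _ + X]pairVC.
  by rewrite -mulr2n => /eqP; rewrite mulrn_eq0 => /eqP.
have [z1 [z2 [zE ez1 ez2]]] := kernel_split zl.
have [c1 [c1_ge0 c1_gt0 Hz1]] := kernel_eigen_herm hl v10 e1 ez1.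
have [c2 [c2_ge0 c2_gt0 Hz2]] := kernel_eigen_herm hml v20 e2 ez2.
have sq : 0 < pairV v1 (conjm v1) * pairV v1 (conjm v1).
  by rewrite -expr2 real_exprn_even_gt0 ?hermV_real.
have : c1 * (pairV v1 (conjm v1) * pairV v1 (conjm v1))
       + c2 * (pairV v1 (conjm v1) * pairV v2 (conjm v2)) = 0.
  rewrite -[RHS](mulr0 (pairV v1 (conjm v1))) -Hz zE kernel_herm_split // Hz1 Hz2; ring.
move=> /eqP; rewrite (paddr_eq0 (mulr_ge0 c1_ge0 (ltW sq)) (mulr_ge0 c2_ge0 (ltW same))).
rewrite !mulf_eq0 (negbTE H1) (negbTE H2) !orbF => /andP[/eqP c10 /eqP c20].
have z10 : z1 = 0 by apply/eqP/negPn/negP => /c1_gt0; rewrite c10 ltxx.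
have z20 : z2 = 0 by apply/eqP/negPn/negP => /c2_gt0; rewrite c20 ltxx.
have : coordV e0 i0 true = 0.
  by rewrite e0E zE z10 z20 addr0 conj_mx0 addr0 /coordV !mxE.
by rewrite coordV_basisV => /eqP; rewrite oner_eq0.
Qed.

(* The hermitian form [(u, conj u)] is definite on each eigenspace, with opposite
   signs, and [theta] compensates the signs. *)
Lemma kernel_polarized : exists s : bool, forall u, clifford u l = 0 -> u != 0 ->
  0 < 'i * ((-1) ^+ s * pairV (theta X w h (conjm u)) u).
Proof.
have hl : lam = lam \/ lam = - lam by left.
have hml : - lam = lam \/ - lam = - lam by right.
have [v1 v10 e1] := exists_kernel_eigen hl; have [v2 v20 e2] := exists_kernel_eigen hml.
have opp := kernel_herm_opposite v10 v20 e1 e2.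
have H1 := kernel_eigen_herm_neq0 hl v10 e1.
(* The factor relating the polarization to the hermitian form in [kernel_theta_split]; it is real
   since [lam] is purely imaginary, and [s] is chosen to make it positive on [v1]. *)
pose g := (- 'i) * lam; have g0 : g != 0 by rewrite mulf_neq0 ?oppr_eq0 ?neq0Ci ?lam_neq0.
have g_real : g \is Num.real.
  have conj_opp_i : ((- 'i)^* : C) = 'i by rewrite -conjCi conjCK.
  have gb : g^* = (- 'i)^* * lam^* by apply: rmorphM.
  by apply/CrealP; rewrite gb conj_opp_i conj_lam /g mulrN mulNr.
have gH_real : g * pairV v1 (conjm v1) \is Num.real by rewrite realM ?hermV_real.
have [s pos1] : exists s : bool, 0 < (-1) ^+ s * g * pairV v1 (conjm v1).
  exists (g * pairV v1 (conjm v1) < 0).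
  rewrite -mulrA; case: (real_ltP gH_real (real0 _)) => [neg|ge0] /=.
    by rewrite expr1 mulN1r oppr_gt0.
  by rewrite expr0 mul1r lt0r mulf_neq0.
exists s; move: ((-1) ^+ s) pos1 => c pos1.
have neg2 : c * g * pairV v2 (conjm v2) < 0.
  have sq : 0 < pairV v1 (conjm v1) * pairV v1 (conjm v1).
    by rewrite -expr2 real_exprn_even_gt0 ?hermV_real.
  rewrite -(pmulr_rlt0 _ sq); suff -> : pairV v1 (conjm v1) * pairV v1 (conjm v1) * (c * g * pairV v2 (conjm v2)) =
    (c * g * pairV v1 (conjm v1)) * (pairV v1 (conjm v1) * pairV v2 (conjm v2)) by rewrite pmulr_rlt0.
  move: (pairV _ _) (pairV _ _) => x y; ring.
move=> u ul u0; have [u1 [u2 [uE eu1 eu2]]] := kernel_split ul.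
have [c1 [c1_ge0 c1_gt0 Hu1]] := kernel_eigen_herm hl v10 e1 eu1.
have [c2 [c2_ge0 c2_gt0 Hu2]] := kernel_eigen_herm hml v20 e2 eu2.
rewrite uE kernel_theta_split // Hu1 Hu2.
have -> : 'i * (c * (- lam * (c1 * pairV v1 (conjm v1) - c2 * pairV v2 (conjm v2)))) =
    c1 * (c * g * pairV v1 (conjm v1)) - c2 * (c * g * pairV v2 (conjm v2)).
  by rewrite /g; move: (pairV _ _) (pairV _ _) => x y; ring.
have [u10|/c1_gt0 c1p] := eqVneq u1 0; last first.
  apply: ltr_pwDl; first exact: mulr_gt0.
  by rewrite oppr_ge0; exact: (mulr_ge0_le0 c2_ge0 (ltW neg2)).
have c2p : 0 < c2 by apply: c2_gt0; apply: contraNneq u0 => u20; rewrite uE u10 u20 addr0.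
apply: ltr_wpDl; first exact: (mulr_ge0 c1_ge0 (ltW pos1)).
by rewrite oppr_gt0 nmulr_llt0.
Qed.

End Period.

(** * Reconstruction of a period from a complex structure *)

Section Reconstruction.
Variables (G : 'M[C]_(4 + 4)) (s : bool).
Hypotheses (G_stable : stablemx G T) (G_isotropic : isotropic G) (G_rank : \rank G = 4%N).
Hypothesis G_eigen : \rank (G :&: eigenspace T lam)%MS = 2%N.
Hypothesis G_pos : forall u, (u <= G)%MS -> u != 0 ->
  0 < 'i * ((-1) ^+ s * pairV (theta X w h (conjm u)) u).

(* The null vectors whose annihilators are the eigenspaces of [theta]. *)
Definition eigen_spinor a : ext C := a *: w - ('[w, w] / 2%:R) *: h.

Lemma eigen_spinor_even a : is_even (eigen_spinor a).
Proof. by rewrite /eigen_spinor -scaleNr; apply: is_evenZD => //; apply: is_evenZ. Qed.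

(** Letting both sides of [theta u = a u] act on [w] gives [(w, w) / 2] times [u . h] on the left
    and [a] times [u . w] on the right; the coefficients of [eigen_spinor] express exactly this
    relation. *)
Lemma clifford_eigen_spinor a u : theta X w h u = a *: u -> clifford u (eigen_spinor a) = 0.
Proof.
move=> ua; have n2 : 2%:R != 0 :> C by rewrite pnatr_eq0.
have odd_t := clifford_even u h_even.
apply: (scalerI n2); rewrite scaler0 /eigen_spinor -scaleNr cliffordDr !cliffordZr.
rewrite -cliffordZl -ua scalerDr scalerA mulrN mulrC mulfVK // scaleNr.
by rewrite -(clifford_adj X w_even w_even odd_t) scaler_nat mulr2n subrr.
Qed.

(** The [h]-parts contribute [(w, w)^2 (h, h) / 4 = - lam^2 (w, w)]. Thus equal square roots of
    [lam ^+ 2] give null spinors, and opposite ones a nonzero product. *)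
Lemma eigen_spinorE a b : '[eigen_spinor a, eigen_spinor b] = (a * b - lam ^+ 2) * '[w, w].
Proof.
have wwhh : '[w, w] * '[h, h] = - (4%:R * lam ^+ 2) by rewrite lam_sqr opprK.
have n4 : 4%:R != 0 :> C by rewrite pnatr_eq0.
rewrite /eigen_spinor -!scaleNr !pairSDl !pairSDr !pairSZl !pairSZr wh (pairSC X h w) wh.
apply: (mulfI n4); move: wwhh; move: '[w, w] '[h, h] => x y xy.
have -> : 4%:R * (a * (b * x) + a * (- (x / 2%:R) * 0) + (- (x / 2%:R) * (b * 0) + - (x / 2%:R) * (- (x / 2%:R) * y)))
    = 4%:R * a * b * x + x * (x * y) by field.
by rewrite xy; ring.
Qed.

Lemma conj_eigen_spinor : conjm (eigen_spinor (- lam)) = eigen_spinor lam.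
Proof.
have ww_real : ('[w, w] / 2%:R)^* = '[w, w] / 2%:R.
  by apply/CrealP; rewrite realM ?realV ?realn ?ltr0_real.
by rewrite /eigen_spinor conj_mxD conj_mxN !conj_mxZ w_real h_real conj_opp_lam ww_real.
Qed.

Lemma eigen_spinor_neg : '[eigen_spinor (- lam), eigen_spinor lam] < 0.
Proof.
rewrite eigen_spinorE mulNr -expr2 -opprD nmulr_llt0 // oppr_gt0.
by rewrite -mulr2n pmulrn_llt0 // lam_sqr_neg.
Qed.

(* [l] is the product of a basis of the [lam]-eigenspace of [G] with the spinor
   annihilated by the [- lam]-eigenspace. *)
Lemma reconstruction : exists l : ext C, [/\ is_even l, '[l, w] = 0, '[l, h] = 0, '[l, l] = 0 &
  '[l, conjm l] < 0 /\ (G :=: spinor_ker l)%MS].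
Proof.
set ym := eigen_spinor (- lam); set yp := eigen_spinor lam.
pose A := (G :&: eigenspace T lam)%MS; pose u1 := nz_row A.
have u10 : u1 != 0 by rewrite nz_row_eq0 -mxrank_eq0 G_eigen.
have u1A : (u1 <= A)%MS by apply: nz_row_sub.
have /row_subPn[i ni] : ~~ (A <= u1)%MS.
  by apply/negP => /mxrankS; rewrite G_eigen rank_rV u10.
pose u2 := row i A; have u2A : (u2 <= A)%MS by apply: row_sub.
have span (u : 'rV[C]_(4 + 4)) : (u <= A)%MS -> exists b c, u = b *: u1 + c *: u2.
  have sub : (u1 + u2 <= A)%MS by rewrite addsmx_sub; apply/andP; split.
  have rk2 : (\rank u1 < \rank (u1 + u2)%MS)%N.
    rewrite (ltn_leqif (mxrank_leqif_sup (addsmxSl _ _))).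
    by apply: contra ni => /(submx_trans (addsmxSr u1 u2)).
  rewrite rank_rV u10 in rk2.
  have subr : (A <= u1 + u2)%MS by rewrite -(geq_leqif (mxrank_leqif_sup sub)) G_eigen.
  move=> /submx_trans/(_ subr)/sub_addsmxP[[b c] /= ->].
  by exists (b 0 0), (c 0 0); rewrite {1}[b]mx11_scalar {1}[c]mx11_scalar !mul_scalar_mx.
have iso (u v : 'rV[C]_(4 + 4)) : (u <= G)%MS -> (v <= G)%MS -> pairV u v = 0.
  by move: u v; apply/isotropicP.
have [u1G /eigenvectorP u1e] : (u1 <= G)%MS /\ (u1 <= eigenspace T lam)%MS by apply/andP; rewrite -sub_capmx.
have [u2G /eigenvectorP u2e] : (u2 <= G)%MS /\ (u2 <= eigenspace T lam)%MS by apply/andP; rewrite -sub_capmx.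
have u1p := clifford_eigen_spinor u1e; have u2p := clifford_eigen_spinor u2e.
rewrite -/yp in u1p u2p.
have evm : is_even ym by apply: eigen_spinor_even.
have swap (u v : 'rV[C]_(4 + 4)) z : (u <= G)%MS -> (v <= G)%MS -> clifford u (clifford v z) = - clifford v (clifford u z) :> ext C.
  by move=> uG vG; apply/eqP; rewrite -addr_eq0 clifford_anticomm iso // scale0r.
have sq (u : 'rV[C]_(4 + 4)) (z : ext C) : (u <= G)%MS -> clifford u (clifford u z) = 0.
  by move=> uG; apply: addrr_eq0; rewrite {1}swap // addNr.
pose l := clifford u1 (clifford u2 ym).
have u1l : clifford u1 l = 0 by apply: sq.
have u2l : clifford u2 l = 0 by rewrite /l swap // sq // clifford0r oppr0.
have l_even : is_even l by apply/clifford_odd/clifford_even.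
have lp : '[l, yp] = 0 by rewrite /l !clifford_adjoint u1p clifford0r (pairSC X) pairS0l.
have lm : '[l, ym] = 0.
  have := pairS_clifford2 X u2 u1 ym ym; rewrite iso // mul0r -mulr2n => /eqP.
  by rewrite mulrn_eq0 /= -clifford_adjoint => /eqP.
have n2 : 2%:R != 0 :> C by rewrite pnatr_eq0.
have lw : '[l, w] = 0.
  have : '[l, yp - ym] = 0 by rewrite -scaleN1r pairSDr pairSZr lp lm mulr0 addr0.
  have -> : yp - ym = (lam + lam) *: w.
    by rewrite /yp /ym /eigen_spinor opprB addrA subrK scaleNr opprK scalerDl.
  by rewrite pairSZr => /eqP; rewrite mulf_eq0 (negbTE lam_lam_neq0) => /eqP.
have lh : '[l, h] = 0.
  move: lp; rewrite /yp /eigen_spinor -scaleNr pairSDr !pairSZr lw mulr0 add0r => /eqP.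
  rewrite mulf_eq0 oppr_eq0 mulf_eq0 invr_eq0 (negbTE n2) (negbTE (ltr0_neq0 w_neg)) => /eqP.
  by [].
have ll : '[l, l] = 0.
  by rewrite {1}/l clifford_adjoint u1l (pairSC X) pairS0l.
have lb : conjm l = clifford (conjm u1) (clifford (conjm u2) yp).
  by rewrite /l !conj_clifford conj_eigen_spinor.
(* Contracting the [u]s against their conjugates, as both [u]s kill [yp], leaves the Gram
   determinant of the hermitian form on [u1], [u2]. *)
have gram : '[l, conjm l] = (pairV u1 (conjm u1) * pairV u2 (conjm u2)
    - pairV u1 (conjm u2) * pairV u2 (conjm u1)) * '[ym, yp].
  rewrite lb /l !clifford_adjoint -pairSZr; congr '[_, _].
  have red (u v z : _) : clifford u z = 0 -> clifford u (clifford v z) = pairV u v *: (z : ext C).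
    by move=> uz; rewrite -clifford_anticomm uz clifford0r addr0.
  have -> : clifford u1 (clifford (conjm u1) (clifford (conjm u2) yp)) =
      pairV u1 (conjm u1) *: clifford (conjm u2) yp - pairV u1 (conjm u2) *: clifford (conjm u1) yp.
    by rewrite -clifford_anticomm -cliffordZr -(red u1 (conjm u2) yp) // addrK.
  by rewrite -scaleNr cliffordDr !cliffordZr !red // !scalerA -scalerDl mulNr.
have pos u : (u <= A)%MS -> u != 0 -> 0 < ('i * ((-1) ^+ s * (- lam))) * pairV u (conjm u).
  rewrite sub_capmx => /andP[uG /eigenvectorP ue] u0.
  by have := G_pos uG u0; rewrite (eigen_conj ue) pairVZl conj_lam (pairVC (conjm u)) !mulrA.
have det_pos : 0 < pairV u1 (conjm u1) * pairV u2 (conjm u2) - pairV u1 (conjm u2) * pairV u2 (conjm u1).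
  have cu1 := pos u1 u1A u10; set c := 'i * _ in pos cu1.
  have a0 : pairV u1 (conjm u1) != 0 by apply: contraTneq cu1 => ->; rewrite mulr0 ltxx.
  have a_real : (pairV u1 (conjm u1))^* = pairV u1 (conjm u1) by rewrite conj_pairV conj_mxK pairVC.
  have b_conj : (- pairV u2 (conjm u1))^* = - pairV u1 (conjm u2).
    rewrite -[in RHS](conj_mxK u1) (pairVC (conjm (conjm u1))) -conj_pairV; exact: rmorphN.
  (* Gram-Schmidt: the norm of [u] is the norm of [u1] times the Gram determinant. Both norms have
     the sign of [c], so the determinant is positive whichever sign this is. *)
  pose u := pairV u1 (conjm u1) *: u2 - pairV u2 (conjm u1) *: u1.
  have uA : (u <= A)%MS by rewrite addmx_sub ?eqmx_opp ?scalemx_sub.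
  have u0 : u != 0.
    apply: contraNneq ni => /eqP; rewrite subr_eq0 => /eqP e.
    by rewrite -/u2 -[u2]scale1r -(mulVf a0) -scalerA e scalerA scalemx_sub.
  have := pos u uA u0; rewrite -(pmulr_rgt0 _ cu1).
  have -> : pairV u (conjm u) = pairV u1 (conjm u1) * (pairV u1 (conjm u1) * pairV u2 (conjm u2)
      - pairV u1 (conjm u2) * pairV u2 (conjm u1)).
    rewrite /u -!scaleNr conj_mxD !conj_mxZ a_real b_conj !(pairVDl, pairVDr) !(pairVZl, pairVZr).
    by move: (pairV _ _) (pairV _ _) (pairV _ _) (pairV _ _) => x y z t; ring.
  by rewrite mulrA mulrA pmulr_rgt0 // -mulrA mulr_gt0.
have l_neg : '[l, conjm l] < 0 by rewrite gram pmulr_rlt0 // eigen_spinor_neg.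
exists l; split=> //; split=> //.
have Gl : (G <= spinor_ker l)%MS.
  apply/row_subP => j; apply/spinor_kerP.
  have [v1 [v2 [-> /span[b [c ->]]]]] := eigen_split G_stable (row_sub j G).
  rewrite sub_capmx => /andP[v2G /eigenvectorP v2e].
  rewrite !cliffordDl !cliffordZl u1l u2l !scaler0 !add0r.
  (* The [lam]-part is spanned by [u1] and [u2], which kill [l]; the remaining vector [v2]
     anticommutes past both of them and kills [ym]. *)
  by rewrite /l swap // (swap v2 u2) // clifford_eigen_spinor // clifford0r oppr0 clifford0r oppr0.
apply/eqmxP/andP; split=> //.
by rewrite -(geq_leqif (mxrank_leqif_sup Gl)) G_rank (kernel_rank l_even ll l_neg).
Qed.

End Reconstruction.

End WeilOperator.

(** * The discriminant *)

Section QuadraticField.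
Variable d : rat.
Local Notation K := (quadratic d).
Implicit Types (k l : K) (a b c e : rat).

Definition qre k : rat := (val k)`_0.
Definition qim k : rat := (val k)`_1.

Lemma val_qX : val ('qX : K) = 'X.
Proof.
have szp : size ('X^2 + d%:P : {poly rat}) = 3%N by rewrite size_XnaddC.
apply: qpolyXE; first by rewrite szp.
by rewrite monicE lead_coefDl ?size_polyXn ?size_polyC ?lead_coefXn //; case: (d != 0).
Qed.

Lemma size_quadratic k : (size (val k) <= 2)%N.
Proof.
have szp : size ('X^2 + d%:P : {poly rat}) = 3%N by rewrite size_XnaddC.
have mon : 'X^2 + d%:P \is @monic rat.
  by rewrite monicE lead_coefDl ?size_polyXn ?size_polyC ?lead_coefXn //; case: (d != 0).
apply: leq_trans (size_npoly k) _.
by rewrite /mk_monic szp mon szp.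
Qed.

Lemma val_quadraticZD a k l : val (a *: k + l) = a *: val k + val l.
Proof. by []. Qed.

Lemma qreZD a k l : qre (a *: k + l) = a * qre k + qre l.
Proof. by rewrite /qre val_quadraticZD coefD coefZ. Qed.

Lemma qimZD a k l : qim (a *: k + l) = a * qim k + qim l.
Proof. by rewrite /qim val_quadraticZD coefD coefZ. Qed.

Lemma val_quadratic1 : val (1 : K) = 1.
Proof. by []. Qed.

Lemma qre1 : qre 1 = 1. Proof. by rewrite /qre val_quadratic1 coef1. Qed.
Lemma qim1 : qim 1 = 0. Proof. by rewrite /qim val_quadratic1 coef1. Qed.
Lemma qreX : qre 'qX = 0. Proof. by rewrite /qre val_qX coefX. Qed.
Lemma qimX : qim 'qX = 1. Proof. by rewrite /qim val_qX coefX. Qed.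
Lemma qre0 : qre 0 = 0. Proof. by apply: (addrI (qre 0)); rewrite -{1}[qre 0]mul1r -qreZD scale1r !addr0. Qed.
Lemma qim0 : qim 0 = 0. Proof. by apply: (addrI (qim 0)); rewrite -{1}[qim 0]mul1r -qimZD scale1r !addr0. Qed.

Lemma qreE a b : qre (a%:A + b *: 'qX : K) = a.
Proof. by rewrite qreZD qre1 -[b *: _]addr0 qreZD qreX qre0; ring. Qed.

Lemma qimE a b : qim (a%:A + b *: 'qX : K) = b.
Proof. by rewrite qimZD qim1 -[b *: _]addr0 qimZD qimX qim0; ring. Qed.

Lemma quadratic_ext k l : qre k = qre l -> qim k = qim l -> k = l.
Proof.
move=> e0 e1; apply: val_inj; apply/polyP => -[|[|i]] //.
by rewrite !nth_default //; apply: leq_trans (size_quadratic _) _.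
Qed.

Lemma quadraticE k : k = (qre k)%:A + qim k *: 'qX.
Proof. by apply: quadratic_ext; rewrite ?qreE ?qimE. Qed.

Lemma quadraticM a b c e : (a%:A + b *: 'qX) * (c%:A + e *: 'qX) =
  (a * c - d * (b * e))%:A + (a * e + b * c) *: 'qX :> K.
Proof.
rewrite mulrDl !mulrDr -!scalerAl -!scalerAr !mul1r !mulr1 -expr2 qX_sqr.
rewrite !scalerN !scalerA !scalerDl scaleNr (mulrC d) [X in _ + X = _]addrC addrACA.
by [].
Qed.

Lemma quadratic_algM a b : a%:A * b%:A = (a * b)%:A :> K.
Proof. by rewrite -scalerAl mul1r scalerA. Qed.

Definition qconj k : K := (qre k)%:A + (- qim k) *: 'qX.

Lemma qreD k l : qre (k + l) = qre k + qre l.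
Proof. by rewrite -[k]scale1r qreZD scale1r mul1r. Qed.

Lemma qimD k l : qim (k + l) = qim k + qim l.
Proof. by rewrite -[k]scale1r qimZD scale1r mul1r. Qed.

Lemma qreM k l : qre (k * l) = qre k * qre l - d * (qim k * qim l).
Proof. by rewrite {1}(quadraticE k) {1}(quadraticE l) quadraticM qreE. Qed.

Lemma qimM k l : qim (k * l) = qre k * qim l + qim k * qre l.
Proof. by rewrite {1}(quadraticE k) {1}(quadraticE l) quadraticM qimE. Qed.

Lemma qreN k : qre (- k) = - qre k.
Proof. by apply: (addrI (qre k)); rewrite -qreD !subrr qre0. Qed.

Lemma qimN k : qim (- k) = - qim k.
Proof. by apply: (addrI (qim k)); rewrite -qimD !subrr qim0. Qed.

Lemma qconj_zmod : zmod_morphism qconj.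
Proof.
move=> k l; apply: quadratic_ext.
  by rewrite [LHS]qreE [RHS]qreD [in RHS]qreN !qreE qreD qreN.
by rewrite [LHS]qimE [RHS]qimD [in RHS]qimN !qimE qimD qimN; ring.
Qed.

Lemma qconj_monoid : monoid_morphism qconj.
Proof.
split; first by apply: quadratic_ext; rewrite ?qreE ?qimE ?qre1 ?qim1 ?oppr0.
move=> k l; apply: quadratic_ext.
  by rewrite qreM !qreE !qimE qreM; ring.
by rewrite qimM !qreE !qimE qimM; ring.
Qed.

Definition qconj_rmorphism : {rmorphism K -> K} :=
  HB.pack qconj (GRing.isZmodMorphism.Build K K qconj qconj_zmod)
    (GRing.isMonoidMorphism.Build K K qconj qconj_monoid).

Lemma qconj_norm k : qconj k * k = (qre k ^+ 2 + d * qim k ^+ 2)%:A.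
Proof.
apply: quadratic_ext; rewrite -[_%:A]addr0 -(scale0r 'qX) ?qreM ?qimM ?qreE ?qimE; ring.
Qed.

Section Embedding.
Variables (n : nat) (T : 'M[rat]_n).
Hypothesis T_sqr : T *m T = (- d)%:M.

Definition qeta k : 'M[rat]_n := (qre k)%:M + qim k *: T.

Lemma qeta_zmod : zmod_morphism qeta.
Proof.
move=> k l; rewrite /qeta qreD qreN qimD qimN raddfB /= scalerBl opprD addrACA.
by [].
Qed.

Lemma qeta_monoid : monoid_morphism qeta.
Proof.
split; first by rewrite /qeta qre1 qim1 scale0r addr0.
move=> k l; rewrite /qeta qreM qimM -[RHS]/(((qre k)%:M + qim k *: T) *m ((qre l)%:M + qim l *: T)).
rewrite mulmxDl !mulmxDr mul_scalar_mx -!scalemxAl -!scalemxAr T_sqr !mul_mx_scalar mul_scalar_mx.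
rewrite !scalerA !scale_scalar_mx mulrN (mulrC _ d) !raddfB !raddfN /= scalerDl.
by rewrite (mulrC (qim l)) [X in _ = _ + X]addrC addrACA.
Qed.

Definition qeta_rmorphism : {rmorphism K -> 'M[rat]_n} :=
  HB.pack qeta (GRing.isZmodMorphism.Build K 'M[rat]_n qeta qeta_zmod)
    (GRing.isMonoidMorphism.Build K 'M[rat]_n qeta qeta_monoid).

Lemma qeta_X : qeta_rmorphism 'qX = T.
Proof. by rewrite /qeta_rmorphism /= /qeta qreX qimX scale1r -scalemx1 scale0r add0r. Qed.

End Embedding.

End QuadraticField.

Section Bilinear.
Variables (A : comNzRingType) (n : nat) (M : 'M[A]_n).
Implicit Types x y : 'rV[A]_n.

Lemma bilinDl x1 x2 y : bilin M (x1 + x2) y = bilin M x1 y + bilin M x2 y.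
Proof. by rewrite /bilin !mulmxDl mxE. Qed.

Lemma bilinDr x y1 y2 : bilin M x (y1 + y2) = bilin M x y1 + bilin M x y2.
Proof. by rewrite /bilin linearD mulmxDr mxE. Qed.

Lemma bilinZl a x y : bilin M (a *: x) y = a * bilin M x y.
Proof. by rewrite /bilin -!scalemxAl mxE. Qed.

Lemma bilinZr a x y : bilin M x (a *: y) = a * bilin M x y.
Proof. by rewrite /bilin linearZ -scalemxAr mxE. Qed.

Lemma bilin0l y : bilin M 0 y = 0.
Proof. by rewrite /bilin !mul0mx mxE. Qed.

Lemma bilin0r x : bilin M x 0 = 0.
Proof. by rewrite /bilin trmx0 mulmx0 mxE. Qed.

End Bilinear.

Section Discriminant.
Variables (d : rat) (T : 'M[rat]_(4 + 4)) (E : 'M[int]_(4 + 4)) (p : rat).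
Hypothesis T_sqr : T *m T = (- d)%:M.
Local Notation K := (quadratic d).
Variable eta : {rmorphism K -> 'M[rat]_(4 + 4)}.
Hypothesis etaE : forall k, eta k = qeta T k.
Local Notation B := (bilin (map_mx intr E : 'M[rat]_(4 + 4))).
Hypothesis d_gt0 : 0 < d.
Hypothesis adjoint : forall x y, B (x *m T) y = - B x (y *m T).

(** The basis of H^1 inside [V]. It is a K-basis when the upper right block of [T], the map from H^1
    to its dual induced by [T], is invertible. *)
Definition half_basis (i : 'I_4) : 'rV[rat]_(4 + 4) := row_mx (delta_mx 0 i) 0.
Local Notation u := half_basis.

Hypothesis half_isotropic : forall i j, B (u i) (u j *m T) = 0.
Hypothesis pfaffian_neq0 : p != 0.
Hypothesis det_half : \det (\matrix_(i < 4, j < 4) B (u i) (u j)) = p ^+ 2.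
Hypothesis T_block : ursubmx T \in unitmx.

Local Notation H := (weil_hermitian eta E).
Implicit Types x y z : 'rV[rat]_(4 + 4).

Lemma hermitianE x y : H x y = (B x (y *m T))%:A + B x y *: 'qX.
Proof. by rewrite /weil_hermitian etaE /qeta qreX qimX scale1r -scalemx1 scale0r add0r. Qed.

Lemma mulmx_eta x (k : K) : x *m eta k = qre k *: x + qim k *: (x *m T).
Proof. by rewrite etaE /qeta mulmxDr mul_mx_scalar -scalemxAr. Qed.

(** As [T] is skew for [B], the adjoint of [eta k] is [eta (qconj k)]; the form is antilinear in its
    first variable. *)
Lemma hermitian_sesquilinear x y k l : H (x *m eta k) (y *m eta l) = qconj k * H x y * l.
Proof.
have TT z : z *m T *m T = - d *: z by rewrite -mulmxA T_sqr mul_mx_scalar.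
rewrite !hermitianE !mulmx_eta !(mulmxDl, bilinDl, bilinDr) -!scalemxAl !(bilinZl, bilinZr) TT !bilinZr.
rewrite !adjoint TT !bilinZr; apply: quadratic_ext.
  by rewrite !qreM !qimM !qreE !qimE; ring.
by rewrite !qimM !qreM !qreE !qimE; ring.
Qed.

Lemma hermitian_suml (I : finType) (x : I -> 'rV[rat]_(4 + 4)) y : H (\sum_i x i) y = \sum_i H (x i) y.
Proof.
apply: (big_morph (H^~ y)) => [x1 x2|]; rewrite !hermitianE.
  by rewrite !bilinDl !scalerDl addrACA.
by rewrite !bilin0l !scale0r addr0.
Qed.

Lemma hermitian_sumr (I : finType) x (y : I -> 'rV[rat]_(4 + 4)) : H x (\sum_i y i) = \sum_i H x (y i).
Proof.
apply: (big_morph (H x)) => [y1 y2|]; rewrite !hermitianE.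
  by rewrite mulmxDl !bilinDr !scalerDl addrACA.
by rewrite mul0mx !bilin0r !scale0r addr0.
Qed.

Lemma half_combination (c : 'I_4 -> K) :
  \sum_j u j *m eta (c j) =
  row_mx ((\row_j qre (c j)) + (\row_j qim (c j)) *m ulsubmx T) ((\row_j qim (c j)) *m ursubmx T).
Proof.
have comb (a : 'rV[rat]_4) : \sum_j a 0 j *: u j = row_mx a 0.
  rewrite -[LHS]hsubmxK; congr row_mx; rewrite linear_sum /=.
    rewrite [RHS]row_sum_delta; apply: eq_bigr => j _.
    by rewrite linearZ /= row_mxKl.
  by rewrite big1 // => j _; rewrite linearZ /= row_mxKr scaler0.
under eq_bigr => j _ do rewrite mulmx_eta.
rewrite big_split /=.
have -> : \sum_i qre (c i) *: u i = row_mx (\row_j qre (c j)) 0.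
  by rewrite -comb; apply: eq_bigr => j _; rewrite mxE.
have -> : \sum_i qim (c i) *: (u i *m T) = row_mx (\row_j qim (c j)) 0 *m T.
  by rewrite -comb mulmx_suml; apply: eq_bigr => j _; rewrite mxE -scalemxAl.
rewrite -{1}[T]submxK mul_row_block !mul0mx !addr0 add_row_mx add0r.
by [].
Qed.

(** Solves [half_combination]: the second half of [x] determines the coefficients of ['qX], and then
    the first half the rational parts. *)
Definition half_coord (x : 'rV[rat]_(4 + 4)) (j : 'I_4) : K :=
  let b := rsubmx x *m invmx (ursubmx T) in
  ((lsubmx x - b *m ulsubmx T) 0 j)%:A + b 0 j *: 'qX.

Lemma half_coordK x : \sum_j u j *m eta (half_coord x j) = x.
Proof.
rewrite half_combination -[RHS]hsubmxK.
have -> : \row_j qim (half_coord x j) = rsubmx x *m invmx (ursubmx T).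
  by apply/rowP => j; rewrite mxE qimE.
have -> : \row_j qre (half_coord x j) = lsubmx x - rsubmx x *m invmx (ursubmx T) *m ulsubmx T.
  by apply/rowP => j; rewrite mxE qreE.
by rewrite subrK mulmxKV.
Qed.

Lemma half_coord_inj (c c' : 'I_4 -> K) :
  \sum_j u j *m eta (c j) = \sum_j u j *m eta (c' j) -> c =1 c'.
Proof.
rewrite !half_combination => /eq_row_mx[el er] j.
have eim : \row_j qim (c j) = \row_j qim (c' j) by apply: (can_inj (mulmxK T_block)).
have ere : \row_j qre (c j) = \row_j qre (c' j) by apply: (addIr _); move: el; rewrite eim; apply.
by apply: quadratic_ext; [move/rowP: ere => /(_ j) | move/rowP: eim => /(_ j)]; rewrite !mxE.
Qed.

(* In the K-basis [half_basis] the hermitian form is ['qX] times an alternating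
   rational matrix, hence its determinant is the square of [d * p]. *)
Lemma discriminant_one_half : discriminant_one eta E.
Proof.
move=> e basis_e.
pose P := \matrix_(i, j) half_coord (e i) j.
have /fin_all_exists[Q Q_eq] : forall i, exists k : {ffun 'I_4 -> K}, u i = \sum_j e j *m eta (k j).
  by move=> i; have [k []] := basis_e (u i); exists k.
pose P' := \matrix_(i, j) Q i j.
(* Writing one basis in terms of the other and back; this is what makes [\det P] nonzero. *)
have P'P : P' *m P = 1%:M.
  apply/matrixP => i k; rewrite [RHS]mxE; move: k.
  apply: (@half_coord_inj (fun k => (P' *m P) i k) (fun k => (i == k)%:R)).
  transitivity (u i); last first.
    rewrite (bigD1 i) // big1 => [|j /andP[_ /negbTE ne]].
      by rewrite eqxx rmorph1 [RHS]addr0; apply/esym/mulmx1.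
    by rewrite eq_sym ne rmorph0 mulmx0.
  rewrite [RHS]Q_eq; under eq_bigr => k _ do rewrite mxE rmorph_sum mulmx_sumr.
  rewrite exchange_big /=; apply: eq_bigr => j _.
  rewrite -[e j in RHS]half_coordK mulmx_suml; apply: eq_bigr => k _.
  by rewrite !mxE mulrC rmorphM mulmxA.
pose Hu := \matrix_(i, j) H (u i) (u j).
have HuE : Hu = 'qX *: map_mx (in_alg K) (\matrix_(i < 4, j < 4) B (u i) (u j)).
  apply/matrixP => i j; rewrite !mxE hermitianE half_isotropic scale0r add0r.
  by rewrite -scalerAr mulr1.
have detHu : \det Hu = ((d * p) ^+ 2)%:A.
  have qX4 : 'qX ^+ 4 = (d ^+ 2)%:A :> K.
    by rewrite -[4%N]/(2 * 2)%N exprM qX_sqr sqrrN expr2 quadratic_algM.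
  by rewrite HuE detZ det_map_mx det_half qX4 quadratic_algM exprMn.
have HeE : \matrix_(i, j) H (e i) (e j) = map_mx (qconj_rmorphism d) P *m Hu *m P^T.
  apply/matrixP => i j; rewrite mxE -[e i]half_coordK -[e j]half_coordK hermitian_suml mxE.
  under eq_bigr => k _ do rewrite hermitian_sumr.
  rewrite exchange_big /=; apply: eq_bigr => k _; rewrite mxE mulr_suml; apply: eq_bigr => l _.
  by rewrite hermitian_sesquilinear !mxE.
(* The determinant is multiplied by the norm of [\det P] under the change of basis, so it is the
   norm of [\det P] times the rational [d * p]. *)
exists (qre (\det P) * (d * p)), (qim (\det P) * (d * p)).
have det1 : \det P' * \det P = 1 by rewrite -det_mulmx P'P det1.
have d0 : d != 0 by rewrite gt_eqF.
split.
  apply: contraTneq (oner_neq0 K) => -[/eqP + /eqP].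
  rewrite !mulf_eq0 (negbTE d0) (negbTE pfaffian_neq0) !orbF => /eqP re0 /eqP im0.
  by rewrite -det1 [\det P]quadraticE re0 im0 !scale0r addr0 mulr0 eqxx.
rewrite HeE !det_mulmx det_tr det_map_mx detHu mulrAC [_ * \det P]qconj_norm.
by rewrite quadratic_algM; congr (_ *: _); ring.
Qed.

End Discriminant.

(** * The vector w *)

Section MukaiVector.
Variables (R : realType) (X : abelian_surface R) (n : nat).

Lemma coef_w_vec b0 b1 b2 b3 : coef (w_vec X n) (bitset b0 b1 b2 b3) =
  [&& ~~ b0, ~~ b1, ~~ b2 & ~~ b3]%:R - orientation X int *+ n.+1 * [&& b0, b1, b2 & b3]%:R.
Proof.
have s0 : finset.set0 = bitset false false false false by apply/setP; apply: ord4_ind; rewrite !inE.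
have sT : [set: 'I_4] = bitset true true true true by apply/setP; apply: ord4_ind; rewrite !inE.
rewrite /w_vec /pt_class s0 sT -scaler_nat scalerA -scaleNr ext_coefD ext_coefZ !coef_mono_bitset mulNr mulr_natl.
by rewrite !eqbF_neg !eqb_id.
Qed.

Lemma w_vec_even : is_even (w_vec X n).
Proof.
apply/is_evenP => b0 b1 b2 b3 od; rewrite coef_w_vec.
by case: b0 od; case: b1; case: b2; case: b3 => //= _; rewrite mulr0 subr0.
Qed.

Lemma w_vec_sqr : pairS X (w_vec X n) (w_vec X n) = - (2 * n.+1)%:R.
Proof.
rewrite pairSE !coef_w_vec /= ?(mulr0, mul0r, subr0, sub0r, addr0, add0r, oppr0, mulr1, mul1r, mulNr, mulrN).
by rewrite -opprD mulrN mulrDr !mulrnAr orientation_sqr -mulrnDr addnn -mul2n.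
Qed.

Lemma w_vec_neg : pairS X (w_vec X n) (w_vec X n) < 0.
Proof. by rewrite w_vec_sqr oppr_lt0 ltr0n. Qed.

End MukaiVector.

(** * Existence of periods *)

Section Nonempty.
Variables (R : realType) (X : abelian_surface R) (K : numClosedFieldType).
Local Notation "'[ s , t ]" := (pairS X s t).
Local Notation T := true.
Local Notation F := false.

(* A 2-form that is self-dual or anti-self-dual, according to the orientation. *)
Definition dual_form (x y z : K) : ext K :=
  x *: mono K (bitset T T F F) + (orientation X K * x) *: mono K (bitset F F T T)
  + y *: mono K (bitset T F T F) - (orientation X K * y) *: mono K (bitset F T F T)
  + z *: mono K (bitset T F F T) + (orientation X K * z) *: mono K (bitset F T T F).

Lemma dual_form_even x y z : is_even (dual_form x y z).
Proof.
by rewrite /dual_form -scaleNr; repeat (apply: is_evenD); apply: is_evenZ; apply: even_mono; rewrite card_bitset.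
Qed.

Lemma pairS_dual_form x y z s : '[dual_form x y z, s] =
  - (x * (coef s (bitset T T F F) + orientation X K * coef s (bitset F F T T))
   + y * (coef s (bitset T F T F) - orientation X K * coef s (bitset F T F T))
   + z * (coef s (bitset T F F T) + orientation X K * coef s (bitset F T T F))).
Proof.
have oo := orientation_sqr X K.
rewrite /dual_form -scaleNr !pairSDl !pairSZl !pairS_mono /=.
move: (orientation X K) oo => o oo.
rewrite ?expr0 ?expr1.
transitivity (- (x * (o * o * coef s (bitset T T F F) + o * coef s (bitset F F T T))
  + y * (o * o * coef s (bitset T F T F) - o * coef s (bitset F T F T))
  + z * (o * o * coef s (bitset T F F T) + o * coef s (bitset F T T F)))); first by ring.
by rewrite oo !mul1r.
Qed.

Lemma coef_dual_form x y z :
  [/\ coef (dual_form x y z) (bitset T T F F) = x,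
      coef (dual_form x y z) (bitset F F T T) = orientation X K * x,
      coef (dual_form x y z) (bitset T F T F) = y &
      [/\ coef (dual_form x y z) (bitset F T F T) = - (orientation X K * y),
      coef (dual_form x y z) (bitset T F F T) = z &
      coef (dual_form x y z) (bitset F T T F) = orientation X K * z]].
Proof.
by rewrite /dual_form -scaleNr; split; last split;
  rewrite !(ext_coefD, ext_coefZ) !coef_mono_bitset /= ?mulr1 ?mulr0 ?addr0 ?add0r.
Qed.

Lemma pairS_dual_forms x y z x' y' z' :
  '[dual_form x y z, dual_form x' y' z'] = - (x * x' + y * y' + z * z') *+ 2.
Proof.
have oo := orientation_sqr X K.
rewrite pairS_dual_form; have [-> -> -> [-> -> ->]] := coef_dual_form x' y' z'.
by rewrite mulrN opprK !mulrA oo !mul1r; ring.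
Qed.

Lemma conj_dual_form x y z : conjm (dual_form x y z) = dual_form x^* y^* z^*.
Proof.
have o_real : (orientation X K)^* = orientation X K.
  by rewrite /orientation; case: ifP => _; rewrite ?conjC1 // -{2}conjC1; exact: rmorphN.
have mono_real I : conjm (mono K I) = mono K I by apply/rowP => j; rewrite !mxE conjC_nat.
have oM c : (orientation X K * c)^* = orientation X K * c^* by rewrite -{2}o_real; exact: rmorphM.
by rewrite /dual_form !(conj_mxD, conj_mxN, conj_mxZ) !oM !mono_real.
Qed.

Lemma exists_period (h : ext int) (n : nat) : exists l : ext K,
  [/\ is_even l, '[l, map_mx intr (w_vec X n) : ext K] = 0, '[l, map_mx intr h : ext K] = 0,
      '[l, l] = 0 & '[l, conjm l] < 0].
Proof.
pose o := orientation X int.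
(* A 2-form is orthogonal to [w] by degree, and orthogonality to [h] is one linear equation on
   [(x, y, z)], with these three coefficients. *)
pose p1 : int := coef h (bitset T T F F) + o * coef h (bitset F F T T).
pose p2 : int := coef h (bitset T F T F) - o * coef h (bitset F T F T).
pose p3 : int := coef h (bitset T F F T) + o * coef h (bitset F T T F).
have [x [y [z [orth null nz]]]] : exists x y z : K,
    [/\ x * p1%:~R + y * p2%:~R + z * p3%:~R = 0, x * x + y * y + z * z = 0 & [|| x != 0, y != 0 | z != 0]].
  have [/andP[/eqP-> /eqP->]|p12] := boolP ((p1 == 0) && (p2 == 0)).
    exists 1, 'i, 0; split; rewrite ?oner_neq0 //; first by rewrite !mulr0 mul0r !addr0.
    by rewrite -['i * 'i]expr2 sqrCi mulr1 mul0r addr0 subrr.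
  have q0 : (p1%:~R ^+ 2 + p2%:~R ^+ 2 : K) != 0.
    rewrite -!rmorphXn -rmorphD intr_eq0 paddr_eq0 ?sqr_ge0 // !expf_eq0 /=.
    by [].
  move: (p1%:~R : K) (p2%:~R : K) (p3%:~R : K) q0 => a b c q0.
  pose N := sqrtC (a ^+ 2 + b ^+ 2 + c ^+ 2).
  have N2 : N ^+ 2 = a ^+ 2 + b ^+ 2 + c ^+ 2 by rewrite sqrtCK.
  have i2 : 'i ^+ 2 = -1 :> K by rewrite sqrCi.
  (* With [r = (a, b, c)] and [u = (- b, a, 0)], orthogonal to [r], this is [N u + i (r x u)]:
     orthogonal to [r], and null since the square of the cross product is [N^2] times that of
     [u]. *)
  exists (- b * N - 'i * (a * c)), (a * N - 'i * (b * c)), ('i * (a ^+ 2 + b ^+ 2)); split.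
  - by ring.
  - transitivity ((a ^+ 2 + b ^+ 2) * (N ^+ 2 + 'i ^+ 2 * (a ^+ 2 + b ^+ 2 + c ^+ 2))); first by ring.
    by rewrite i2 N2 mulN1r subrr mulr0.
  - by rewrite mulf_neq0 ?neq0Ci // !orbT.
exists (dual_form x y z); split.
- exact: dual_form_even.
- rewrite pairS_dual_form !ext_coef_map !coef_w_vec /=.
  by rewrite !(mulr0, subr0, rmorph0, addr0, oppr0).
- rewrite pairS_dual_form !ext_coef_map -[RHS]oppr0 -orth /p1 /p2 /p3.
  by rewrite !(rmorphD, rmorphN, rmorphM) /o rmorph_orientation.
- by rewrite pairS_dual_forms null oppr0 mul0rn.
- rewrite conj_dual_form pairS_dual_forms mulNrn oppr_lt0 pmulrn_lgt0 // lt0r.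
  rewrite !addr_ge0 ?mul_conjC_ge0 // andbT !paddr_eq0 ?addr_ge0 ?mul_conjC_ge0 // !mul_conjC_eq0.
  by rewrite !negb_and -orbA.
Qed.

End Nonempty.

(** * The matrices of the endomorphism and of the polarization *)

Section ThetaMatrix.
Variables (R : realType) (X : abelian_surface R) (n : nat) (h : ext int).
Variable A : comNzRingType.
Local Notation w' := (map_mx intr (w_vec X n) : ext A).
Local Notation h' := (map_mx intr h : ext A).

Let intA : {rmorphism int -> A} := intmul 1.

Lemma theta_end_map v : v *m map_mx intr (theta_end X n h) = theta X w' h' v.
Proof.
rewrite -(lin1_mxE (f := theta X w' h')) => [|a u1 u2]; last exact: thetaZD.
congr (v *m _); apply/row_matrixP => i; rewrite !rowE lin1_mxE => [|a u1 u2]; last exact: thetaZD.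
have -> : delta_mx 0 i = map_mx intr (delta_mx 0 i : 'rV[int]_(4 + 4)) :> 'rV[A]_(4 + 4).
  by rewrite (map_delta_mx intA).
rewrite -(map_mxM intA) theta_endP; apply: etrans (map_adj X intA _ _) _.
by rewrite /theta (map_clifford intA).
Qed.

Lemma theta_form_gram : theta_form X n h = theta_end X n h *m gram int.
Proof.
apply/matrixP => i j; rewrite mxE pairV_gram trmx_delta -(mulmxA (delta_mx 0 i)).
by rewrite -rowE -colE !mxE.
Qed.

Lemma theta_form_map_gram :
  map_mx intr (theta_form X n h) = map_mx intr (theta_end X n h) *m gram A :> 'M[A]_(4 + 4).
Proof.
rewrite theta_form_gram (map_mxM intA); congr (_ *m _).
by rewrite /gram (map_block_mx intA) !(map_mx0 intA) !(map_mx1 intA).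
Qed.

Lemma theta_form_map x y : bilin (map_mx intr (theta_form X n h)) x y = pairV (theta X w' h' x) y.
Proof. by rewrite theta_form_map_gram /bilin mulmxA theta_end_map pairV_gram. Qed.

Lemma theta_form_sign (s : bool) x y :
  bilin (map_mx intr ((-1) ^+ s *: theta_form X n h)) x y = (-1) ^+ s * pairV (theta X w' h' x) y.
Proof.
rewrite (map_mxZ intA) rmorphXn rmorphN1 -theta_form_map.
by rewrite /bilin -scalemxAr -scalemxAl mxE.
Qed.

End ThetaMatrix.

(** * Pfaffians and the discriminant of the family *)

Section Pfaffian.
Variable A : comNzRingType.

Lemma det4_alternating (a : nat -> nat -> A) :
  (forall i j, a j i = - a i j) -> (forall i, a i i = 0) ->
  \det (\matrix_(i < 4, j < 4) a i j) =
  (a 0%N 1%N * a 2%N 3%N - a 0%N 2%N * a 1%N 3%N + a 0%N 3%N * a 1%N 2%N) ^+ 2.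
Proof.
move=> alt diag.
rewrite (expand_det_row _ ord0) !big_ord_recl !big_ord0 /cofactor.
rewrite !(expand_det_row _ ord0) !big_ord_recl !big_ord0 /cofactor.
rewrite !(expand_det_row _ ord0) !big_ord_recl !big_ord0 /cofactor !det_mx11 !mxE /= /bump /= ?(add1n, add0n, addn0) ?(exprS, expr0).
rewrite !diag !(alt 0 1) !(alt 0 2) !(alt 0 3) !(alt 1 2) !(alt 1 3) !(alt 2 3).
ring.
Qed.

End Pfaffian.

Section HalfBasis.
Variables (R : realType) (X : abelian_surface R) (n : nat) (h : ext int).
Hypotheses (h_even : is_even h) (h_orth : pairS X h (w_vec X n) = 0) (h_neg : pairS X h h < 0).
Local Notation wQ := (map_mx intr (w_vec X n) : ext rat).
Local Notation hQ := (map_mx intr h : ext rat).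
Local Notation TQ := (map_mx intr (theta_end X n h) : 'M[rat]_(4 + 4)).
Local Notation F := false.
Local Notation T := true.

(** Half of the top coefficient of [c /\ c], for [c] the degree 2 part of [h]; by
    [half_entry_pfaffian] it is also the Pfaffian of the upper right block of [theta_end]. *)
Definition pfaffian : int :=
  coef h (bitset T T F F) * coef h (bitset F F T T) - coef h (bitset T F T F) * coef h (bitset F T F T)
  + coef h (bitset T F F T) * coef h (bitset F T T F).

(* If it vanished, [(h, w) = 0] would force [(h, h) = 2 (n+1) r^2 >= 0], with [r]
   the degree 0 coefficient of [h]. *)
Lemma pfaffian_neq0 : pfaffian != 0.
Proof.
rewrite /pfaffian.
apply: contraTneq h_neg => pf0; rewrite -leNgt.
move: h_orth pf0; rewrite !pairSE !coef_w_vec /= -[orientation X int *+ n.+1]mulr_natr; have := orientation_sqr X int.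
have kp : 0 <= n.+1%:R :> int by [].
move: (orientation X int) (n.+1%:R : int) kp => o k kp oo.
move/is_evenP: h_even => ev; rewrite !(ev T F F F) // !(ev F T F F) // !(ev F F T F) // !(ev F F F T) //.
move: (coef h (bitset F F F F)) (coef h (bitset T T T T)) (coef h (bitset T T F F)) (coef h (bitset F F T T))
  (coef h (bitset T F T F)) (coef h (bitset F T F T)) (coef h (bitset T F F T)) (coef h (bitset F T T F)) =>
  r s a a' b b' c c' orth pf0.
(* Orthogonality to [w] ties the degree 4 coefficient of [h] to the degree 0 one. *)
have sE : s = o * r * k.
  transitivity (o * o * s); first by rewrite oo mul1r.
  transitivity (o * o * (o * r * k)); last by rewrite oo mul1r.
  apply/eqP; rewrite -subr_eq0; apply/eqP; rewrite -[RHS](mulr0 o) -[in RHS]orth; ring.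
rewrite [X in 0 <= X](_ : _ = (o * o) * (2%:R * k * r ^+ 2) - 2%:R * o * (a * a' - b * b' + c * c')); last first.
  by rewrite sE; ring.
by rewrite pf0 mulr0 subr0 oo mul1r mulr_ge0 ?sqr_ge0 // mulr_ge0.
Qed.

Lemma half_basis_basisV i : half_basis i = basisV rat i true.
Proof. by []. Qed.

(** Indexed by natural numbers to fit [det4_alternating]. *)
Definition half_entry (i j : nat) : rat := coordV (theta X wQ hQ (basisV rat (inord i) true)) (inord j) false.

Lemma half_form i j : bilin (map_mx intr (theta_form X n h)) (half_basis i) (half_basis j) = half_entry i j.
Proof. by rewrite theta_form_map !half_basis_basisV pairV_basisV /half_entry !inord_val. Qed.

Lemma wQ_even : is_even wQ. Proof. exact: (map_even (intmul 1 : {rmorphism int -> rat}) (@w_vec_even _ X n)). Qed.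
Lemma hQ_even : is_even hQ. Proof. exact: (map_even (intmul 1 : {rmorphism int -> rat}) h_even). Qed.

Lemma orth_map (A : comNzRingType) :
  pairS X (map_mx intr (w_vec X n) : ext A) (map_mx intr h : ext A) = 0.
Proof.
have := map_pairS X (intmul 1 : {rmorphism int -> A}) (w_vec X n) h.
by rewrite (pairSC X (w_vec X n)) h_orth rmorph0 => <-.
Qed.

Lemma half_entryC i j : half_entry j i = - half_entry i j.
Proof.
have := theta_antisym (orth_map rat) (basisV rat (inord j) true) (basisV rat (inord i) true).
by rewrite (pairVC (basisV rat (inord j) true)) !pairV_basisV.
Qed.

Lemma half_entry_diag i : half_entry i i = 0.
Proof.
have /eqP : half_entry i i *+ 2 = 0 by rewrite mulr2n {1}half_entryC addNr.
by rewrite mulrn_eq0 /= => /eqP.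
Qed.

(** For these coordinates only the even coefficients of degree 0 and 2 of the first argument matter,
    and those of [w] are 1 and 0: what remains is the degree 3 part of [t]. *)
Lemma coordV_adj_w t j : is_odd t -> coordV (m_adj X wQ t) j false =
  orientation X rat * nth 0 [:: coef t (bitset F T T T); - coef t (bitset T F T T);
    coef t (bitset T T F T); - coef t (bitset T T T F)] j.
Proof.
move=> odt; rewrite (coordV_adjE X wQ_even odt).
have w2 b0 b1 b2 b3 : coef wQ (bitset b0 b1 b2 b3) = [&& ~~ b0, ~~ b1, ~~ b2 & ~~ b3]%:R
    - (orientation X int *+ n.+1)%:~R * [&& b0, b1, b2 & b3]%:R.
  by rewrite ext_coef_map coef_w_vec rmorphB rmorphM !rmorph_nat.
congr (_ * _); rewrite !w2 /=; move: (coef t _) (coef t _) (coef t _) (coef t _) => x y z r.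
by move: j; apply: ord4_ind; rewrite /= ?(mulr0, mul0r, subr0, sub0r, addr0, add0r, oppr0, mulr1, mul1r, mulNr, mulrN).
Qed.

(** Up to sign, the entry at distinct [i], [j] is the coefficient of [e_i /\ h] missing [e_j], that
    is, the coefficient of [h] at the complement of [{i, j}]. The Pfaffian thus pairs complementary
    coefficients, and [orientation] occurs squared. *)
Lemma half_entry_pfaffian :
  half_entry 0 1 * half_entry 2 3 - half_entry 0 2 * half_entry 1 3
  + half_entry 0 3 * half_entry 1 2 = pfaffian%:~R.
Proof.
have inord1 : inord 1 = i1 :> 'I_4 by apply: val_inj; rewrite /= inordK.
have inord2 : inord 2 = i2 :> 'I_4 by apply: val_inj; rewrite /= inordK.
have inord3 : inord 3 = i3 :> 'I_4 by apply: val_inj; rewrite /= inordK.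
have inord0 : inord 0 = i0 :> 'I_4 by apply: val_inj; rewrite /= inordK.
have odd_t i := clifford_even (basisV rat i true) hQ_even.
have entryE i j : half_entry i j = orientation X rat * nth 0
    [:: coef (clifford (basisV rat (inord i) true) hQ) (bitset F T T T); - coef (clifford (basisV rat (inord i) true) hQ) (bitset T F T T);
        coef (clifford (basisV rat (inord i) true) hQ) (bitset T T F T); - coef (clifford (basisV rat (inord i) true) hQ) (bitset T T T F)] (inord j : 'I_4).
  exact: coordV_adj_w (odd_t (inord i)).
rewrite !entryE inord0 inord1 inord2 inord3 !coef_clifford_basisV /= !ext_coef_map.
rewrite ?expr0 ?expr1 /pfaffian !(rmorphD, rmorphN, rmorphM) /=.
have := orientation_sqr X rat; move: (orientation X rat) => o o2.
move: ((coef h (bitset T T F F))%:~R) ((coef h (bitset F F T T))%:~R) ((coef h (bitset T F T F))%:~R)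
  ((coef h (bitset F T F T))%:~R) ((coef h (bitset T F F T))%:~R) ((coef h (bitset F T T F))%:~R) => a a' b b' c c'.
transitivity (o * o * (a * a' - b * b' + c * c')); first by ring.
by rewrite o2 mul1r.
Qed.

Lemma half_matrix : \matrix_(i < 4, j < 4) half_entry i j = ursubmx TQ.
Proof.
apply/matrixP => i j; rewrite !mxE /half_entry !inord_val -theta_end_map -half_basis_basisV.
have -> : half_basis i = delta_mx 0 (lshift 4 i) by rewrite delta_mx_lshift.
by rewrite -rowE /coordV !mxE.
Qed.

Lemma det_half_matrix : \det (\matrix_(i < 4, j < 4) half_entry i j) = pfaffian%:~R ^+ 2.
Proof. by rewrite det4_alternating ?half_entry_pfaffian //; [exact: half_entryC | exact: half_entry_diag]. Qed.

Lemma half_block_unit : ursubmx TQ \in unitmx.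
Proof.
rewrite -half_matrix unitmxE det_half_matrix unitfE expf_neq0 // intr_eq0; exact: pfaffian_neq0.
Qed.

Lemma weil_d_gt0 : 0 < weil_d X n h.
Proof. by rewrite /weil_d divr_gt0 // ltr0z nmulr_rgt0 // w_vec_neg. Qed.

Lemma theta_end_sqr (A : fieldType) (q : A) : 4%:R != 0 :> A ->
  4%:R * q = (pairS X (w_vec X n) (w_vec X n) * pairS X h h)%:~R ->
  map_mx intr (theta_end X n h) *m map_mx intr (theta_end X n h) = (- q)%:M.
Proof.
move=> n4 qE; pose intA : {rmorphism int -> A} := intmul 1.
have wA := map_even intA (@w_vec_even _ X n); have hA := map_even intA h_even.
apply/row_matrixP => i; rewrite !rowE mulmxA !theta_end_map mul_mx_scalar.
apply: (scalerI n4); rewrite (theta_sqr wA hA (orth_map A)) scalerA mulrN qE; congr (- _ *: _).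
by rewrite -!(map_pairS X intA) -rmorphM.
Qed.

Lemma weil_dE : 4%:R * weil_d X n h = (pairS X (w_vec X n) (w_vec X n) * pairS X h h)%:~R.
Proof. by rewrite /weil_d mulrC mulfVK. Qed.

Lemma theta_rat_sqr : TQ *m TQ = (- weil_d X n h)%:M.
Proof. by apply: theta_end_sqr; [|exact: weil_dE]. Qed.

Lemma weil_discriminant (s : bool) :
  discriminant_one (qeta_rmorphism theta_rat_sqr) ((-1) ^+ s *: theta_form X n h).
Proof.
apply: (@discriminant_one_half _ TQ _ pfaffian%:~R) => //.
- exact: theta_rat_sqr.
- exact: weil_d_gt0.
- by move=> x y; rewrite !theta_form_sign !theta_end_map (theta_antisym (orth_map rat)) mulrN.
(* Skewness moves both copies of [theta] to one side, leaving a multiple of the pairing of two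
   vectors of the isotropic subspace H^1. *)
- move=> i j; rewrite theta_form_sign theta_end_map -[pairV _ _]opprK -(theta_antisym (orth_map rat)).
  have -> : theta X wQ hQ (theta X wQ hQ (half_basis i)) = - weil_d X n h *: half_basis i.
    by rewrite -!theta_end_map -mulmxA theta_rat_sqr mul_mx_scalar.
  by rewrite !half_basis_basisV pairVZl pairV_basisV coordV_basisV /= andbF mulr0 oppr0 mulr0.
- by rewrite intr_eq0; exact: pfaffian_neq0.
- have -> : \matrix_(i < 4, j < 4) bilin (map_mx intr ((-1) ^+ s *: theta_form X n h) : 'M[rat]_(4 + 4))
      (half_basis i) (half_basis j) = (-1) ^+ s *: \matrix_(i < 4, j < 4) half_entry i j.
    by apply/matrixP => i j; rewrite !mxE theta_form_sign -theta_form_map half_form.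
  (* The determinant has size 4, so the sign comes out to an even power. *)
  by rewrite detZ det_half_matrix -exprM -signr_odd oddM andbF expr0 mul1r.
- exact: half_block_unit.
Qed.

End HalfBasis.

(** * Periods and complex structures of Weil type *)

Section WeilFiber.
Variables (R : realType) (X : abelian_surface R) (n : nat) (h : ext int) (K : numClosedFieldType).
Hypotheses (h_even : is_even h) (h_orth : pairS X h (w_vec X n) = 0) (h_neg : pairS X h h < 0).
Local Notation "'[ s , t ]" := (pairS X s t).
Local Notation wK := (map_mx intr (w_vec X n) : ext K).
Local Notation hK := (map_mx intr h : ext K).
Local Notation TK := (map_mx intr (theta_end X n h) : 'M[K]_(4 + 4)).
Local Notation E := (theta_form X n h).
Local Notation d := (weil_d X n h).

Let intK : {rmorphism int -> K} := intmul 1.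

Definition root_neg_d : K := sqrtC (- ratr d).
Local Notation lam := root_neg_d.

Lemma wK_even : is_even wK. Proof. exact: (map_even intK (@w_vec_even _ X n)). Qed.
Lemma hK_even : is_even hK. Proof. exact: (map_even intK h_even). Qed.
Lemma wK_real : conjm wK = wK. Proof. exact: conj_map_intr. Qed.
Lemma hK_real : conjm hK = hK. Proof. exact: conj_map_intr. Qed.
Lemma wK_neg : '[wK, wK] < 0. Proof. by rewrite -(map_pairS X intK) ltrz0 w_vec_neg. Qed.
Lemma hK_neg : '[hK, hK] < 0. Proof. by rewrite -(map_pairS X intK) ltrz0. Qed.
Lemma wK_hK : '[wK, hK] = 0. Proof. exact: orth_map. Qed.

Lemma root_neg_d_sqr : 4%:R * lam ^+ 2 = - ('[wK, wK] * '[hK, hK]).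
Proof.
rewrite sqrtCK mulrN -!(map_pairS X intK) -rmorphM /=; congr (- _).
rewrite -(ratr_int K) -weil_dE [RHS]rmorphM; congr (_ * _); by rewrite rmorph_nat.
Qed.

(* [l] is a cone representative of a period orthogonal to [w] and [h]. *)
Definition period_of (l : ext K) :=
  [/\ is_even l, '[l, wK] = 0, '[l, hK] = 0, '[l, l] = 0 & '[l, conjm l] < 0].

Definition polarized_by (s : bool) (G : 'M[K]_(4 + 4)) :=
  (forall u v, (u <= G)%MS -> (v <= G)%MS -> pairV (theta X wK hK u) v = 0) /\
  (forall u, (u <= G)%MS -> u != 0 -> 0 < 'i * ((-1) ^+ s * pairV (theta X wK hK (conjm u)) u)).

(** [is_polarization] over any closed field, with which it agrees by conversion over [Cplx R]. *)
Definition riemann_conditions N (F : 'M[K]_N) (M : 'M[int]_N) : Prop :=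
  [/\ M^T = - M, F *m map_mx intr M *m F^T = 0 &
      forall u : 'rV[K]_N, (u <= F)%MS -> u != 0 ->
        0 < 'i * bilin (map_mx intr M) (conjm u) u].

Lemma theta_form_tr : E^T = - E.
Proof.
apply/matrixP => i j; rewrite !mxE !theta_endP.
have wh : '[w_vec X n, h] = 0 by rewrite pairSC.
by rewrite -[RHS]/(- pairV (theta X (w_vec X n) h (delta_mx 0 i)) _) (theta_antisym wh) opprK pairVC.
Qed.

Lemma riemann_conditionsE (s : bool) (G : 'M[K]_(4 + 4)) :
  riemann_conditions G ((-1) ^+ s *: E) <-> polarized_by s G.
Proof.
have sgn0 : (-1) ^+ s != 0 :> K by rewrite signr_eq0.
have trE : ((-1) ^+ s *: E)^T = - ((-1) ^+ s *: E) by rewrite linearZ /= theta_form_tr scalerN.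
split=> [[_ iso pos]|[iso pos]].
  split=> [u v /submxP[a ->] /submxP[b ->]|u uG u0]; last by rewrite -theta_form_sign pos.
  apply: (mulfI sgn0); rewrite mulr0 -theta_form_sign /bilin trmx_mul.
  by rewrite !mulmxA -(mulmxA a) -(mulmxA a) iso mulmx0 mul0mx mxE.
split=> // [|u uG u0]; last by rewrite theta_form_sign pos.
apply/matrixP => i j; have := iso (row i G) (row j G) (row_sub _ _) (row_sub _ _).
move=> /(congr1 ( *%R ((-1) ^+ s))); rewrite mulr0 -theta_form_sign /bilin.
rewrite -row_mul tr_row => e; rewrite [RHS]mxE; apply: etrans e.
by rewrite [LHS]mxE [RHS]mxE; apply: eq_bigr => k _; congr (_ * _); rewrite !mxE.
Qed.

Lemma polarized_by_unique s s' (G : 'M[K]_(4 + 4)) : G != 0 -> polarized_by s G -> polarized_by s' G -> s = s'.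
Proof.
move=> G0 [_ p1] [_ p2]; have u0 : nz_row G != 0 by rewrite nz_row_eq0.
have := p1 _ (nz_row_sub G) u0; have := p2 _ (nz_row_sub G) u0.
move: (pairV _ _) => x; case: s {p1}; case: s' {p2} => //=; rewrite !expr0 !expr1 !mul1r !mulN1r !mulrN oppr_gt0.
  by move=> x1 x2; have := lt_trans x1 x2; rewrite ltxx.
by move=> x1 x2; have := lt_trans x1 x2; rewrite ltxx.
Qed.

Lemma polarized_by_eqmx s (G G' : 'M[K]_(4 + 4)) : (G :=: G')%MS -> polarized_by s G -> polarized_by s G'.
Proof.
by move=> e [iso pos]; split=> [u v|u]; rewrite -!e; [exact: iso | exact: pos].
Qed.

Section Period.
Variable l : ext K.
Hypothesis l_period : period_of l.
Local Notation Z := (spinor_ker l).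

Lemma period_rank : \rank Z = 4%N.
Proof. by case: l_period => ev _ _ null neg; exact: (kernel_rank ev null neg). Qed.

Lemma period_cap : (Z :&: conjm Z)%MS = 0.
Proof. by case: l_period => _ _ _ _ neg; exact: (kernel_cap neg). Qed.

Lemma period_isotropic : isotropic Z.
Proof. by case: l_period => _ _ _ _ neg; exact/spinor_kernel_isotropic/(period_neq0 neg). Qed.

Lemma period_stable : stablemx Z TK.
Proof.
case: l_period => ev lw lh _ _.
exact: (kernel_stable wK_even hK_even (@theta_end_map _ X n h K) ev lw lh).
Qed.

Lemma period_polarized : exists s, polarized_by s Z.
Proof.
case: l_period => ev lw lh null neg.
have [s pos] := kernel_polarized wK_even hK_even wK_real hK_real wK_neg hK_neg wK_hK
  (@theta_end_map _ X n h K) root_neg_d_sqr ev null neg lw lh.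
exists s; split=> [u v uZ vZ|u /spinor_kerP]; last exact: pos.
move/isotropicP: period_isotropic; apply=> //.
by rewrite -theta_end_map; exact: submx_trans (submxMr TK uZ) period_stable.
Qed.

Lemma theta_mx_antisym u v : pairV (u *m TK) v = - pairV u (v *m TK).
Proof. by rewrite !theta_end_map (theta_antisym wK_hK). Qed.

Lemma period_eigen_rank a : a = lam \/ a = - lam ->
  \rank (eigenspace TK^T a :&: kermx Z^T)%MS = 2%N.
Proof.
case: l_period => ev lw lh null neg ha.
rewrite (eigenspace_annihilator a theta_mx_antisym period_isotropic period_rank).
apply: (kernel_eigen_rank wK_even hK_even wK_real hK_real wK_neg hK_neg wK_hK
  (@theta_end_map _ X n h K) root_neg_d_sqr ev null neg lw lh).
by case: ha => ->; rewrite ?opprK; [right | left].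
Qed.

End Period.

Lemma period_of_polarized (G : 'M[K]_(4 + 4)) (s : bool) :
  \rank G = 4%N -> stablemx G TK -> polarized_by s G ->
  \rank (eigenspace TK^T (- lam) :&: kermx G^T)%MS = 2%N ->
  exists l, period_of l /\ (G :=: spinor_ker l)%MS.
Proof.
move=> rkG stG [iso pos] rk2.
have lam0 := lam_neq0 wK_neg hK_neg root_neg_d_sqr.
(* Type (1,1) makes [theta u] orthogonal to [v]; replacing [u] by [theta u], again in [G], gives
   [lam ^+ 2 (u, v) = 0]. *)
have isoG : isotropic G.
  apply/isotropicP => u v uG vG; have l2 : lam ^+ 2 != 0 by rewrite expf_neq0.
  apply: (mulfI l2); rewrite mulr0 -pairVZl -(theta_theta wK_even hK_even wK_hK root_neg_d_sqr).
  by apply: iso => //; rewrite -theta_end_map; exact: submx_trans (submxMr TK uG) stG.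
(* The eigenvalue [- lam] on 1-forms corresponds to [lam] on [G]. *)
rewrite (eigenspace_annihilator _ theta_mx_antisym isoG rkG) opprK in rk2.
have [l [ev lw lh ll [neg e]]] := reconstruction wK_even hK_even wK_real hK_real wK_neg hK_neg wK_hK
  (@theta_end_map _ X n h K) root_neg_d_sqr stG isoG rkG rk2 pos.
by exists l.
Qed.

Lemma period_of_unique l l' : period_of l -> period_of l' ->
  (spinor_ker l <= spinor_ker l')%MS -> exists c, l' = c *: l.
Proof.
move=> [ev lw lh null neg] [ev' lw' lh' null' neg'] sub.
apply: (kernel_determines ev null neg wK_even ev' (ltr0_neq0 wK_neg) lw lw') => v /spinor_kerP vl.
by apply/spinor_kerP; exact: submx_trans vl sub.
Qed.

(** Up to sign the form is [TQ *m gram]; skewness moves the last factor [TQ^T] across [gram] as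
    [- TQ], and two of the three copies of [TQ] make [- d]. *)
Lemma theta_similitude (s : bool) (TQ := map_mx intr (theta_end X n h) : 'M[rat]_(4 + 4)) :
  TQ *m map_mx intr ((-1) ^+ s *: E) *m TQ^T = d *: map_mx intr ((-1) ^+ s *: E).
Proof.
have anti : TQ *m gram rat = - (gram rat *m TQ^T).
  apply: pairV_antisym_gram => u v; rewrite !theta_end_map.
  exact: (theta_antisym (orth_map h_orth rat)).
rewrite (map_mxZ (intmul 1 : {rmorphism int -> rat})) theta_form_map_gram -/TQ.
rewrite -!scalemxAr -!scalemxAl scalerA [d * _]mulrC -scalerA; congr (_ *: _).
rewrite -mulmxA -(mulmxA TQ) -[gram rat *m TQ^T]opprK -anti !mulmxN mulmxA.
by rewrite (theta_rat_sqr h_even h_orth) mulmxA mul_scalar_mx -scalemxAl scaleNr opprK.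
Qed.

Lemma qeta_stable (G : 'M[K]_(4 + 4)) (k : quadratic d) : stablemx G TK ->
  stablemx G (map_mx ratr (qeta_rmorphism (theta_rat_sqr h_even h_orth) k)).
Proof.
move=> stG; rewrite /qeta_rmorphism /= /qeta.
have -> : map_mx ratr ((qre k)%:M + qim k *: map_mx intr (theta_end X n h)) =
    (ratr (qre k))%:M + ratr (qim k) *: TK.
  rewrite map_mxD map_scalar_mx map_mxZ -map_mx_comp; congr (_ + _ *: _).
  by apply/matrixP => i j; rewrite !mxE /= ratr_int.
rewrite mulmxDr mul_mx_scalar -scalemxAr.
by rewrite addmx_sub ?scalemx_sub.
Qed.

Lemma map_ratr_theta : map_mx ratr (map_mx intr (theta_end X n h) : 'M[rat]_(4 + 4)) = TK.
Proof. by apply/matrixP => i j; rewrite !mxE ratr_int. Qed.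

End WeilFiber.

From mathcomp Require Import all_classical all_reals all_analysis.
Import numFieldNormedType.Exports.

(** * The period domain *)

Section Differentials.
Variables (K : numFieldType) (N : nat).
Implicit Types p : 'rV[K]_N.
Local Open Scope classical_set_scope.

Lemma is_diff_sum (W : normedModType K) (I : Type) (r : seq I) (f df : I -> 'rV[K]_N -> W) p :
  (forall i, is_diff p (f i) (df i)) -> is_diff p (\sum_(i <- r) f i) (\sum_(i <- r) df i).
Proof.
move=> d; elim/big_rec2: _ => [|i g dg _ ih]; first exact: is_diff_cst.
exact: is_diffD.
Qed.

Lemma is_diff_coord p i : is_diff p (fun q : 'rV[K]_N => q 0 i : K^o) (fun q => q 0 i : K^o).
Proof.
apply: DiffDef; first exact: differentiable_coord.
have @f : {linear 'rV[K]_N -> K^o}.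
  by exists (fun q : 'rV[K]_N => q 0 i); do 2![eexists]; do ?[constructor];
     rewrite ?mxE// => ? *; rewrite ?mxE//; move=> ?; rewrite !mxE.
by rewrite (_ : (fun _ => _) = f) // diff_lin //; exact: coord_continuous.
Qed.

Lemma is_diff_functional (f : 'rV[K]_N -> K) p :
  (forall a u v, f (a *: u + v) = a * f u + f v) -> is_diff p (f : _ -> K^o) (f : _ -> K^o).
Proof.
move=> lin; have fD u v : f (u + v) = f u + f v by rewrite -[u]scale1r lin scale1r mul1r.
have f0 : f 0 = 0 by apply: (addrI (f 0)); rewrite -fD !addr0.
have fZ a u : f (a *: u) = a * f u by rewrite -[a *: u]addr0 lin f0 addr0.
have fE : f = \sum_i (f (delta_mx 0 i) *: (fun q : 'rV[K]_N => q 0 i : K^o)) :> (_ -> K^o).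
  apply/funext => q; rewrite fct_sumE [q in LHS]row_sum_delta (big_morph f fD f0).
  by apply: eq_bigr => i _; rewrite fZ mulrC.
rewrite fE; apply: is_diff_sum => i; apply: is_diffZ; exact: is_diff_coord.
Qed.

Lemma is_diff_row m (g dg : 'I_m -> 'rV[K]_N -> K^o) p :
  (forall i, is_diff p (g i) (dg i)) ->
  is_diff p (fun q => \row_i g i q : 'rV[K]_m) (fun v => \row_i dg i v : 'rV[K]_m).
Proof.
move=> d; have rowE (h : 'I_m -> 'rV[K]_N -> K^o) :
    (fun q => \row_i h i q : 'rV[K]_m) = \sum_i (fun q => h i q *: delta_mx 0 i).
  apply/funext => q; rewrite fct_sumE [LHS]row_sum_delta.
  by apply: eq_bigr => i _; rewrite mxE.
rewrite !rowE; apply: is_diff_sum => i; have [dgi vgi] := d i.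
by apply: DiffDef; [exact: differentiableZl | rewrite diffZl // vgi].
Qed.

Lemma continuous_functional (f : 'rV[K]_N -> K) :
  (forall a u v, f (a *: u + v) = a * f u + f v) -> continuous (f : _ -> K^o).
Proof.
by move=> lin p; apply: differentiable_continuous; have [] := is_diff_functional p lin.
Qed.

End Differentials.

(** * A chart of the cone of periods *)

Section PeriodChart.
Variables (R : realType) (X : abelian_surface R) (K : numFieldType).
Local Notation "'[ s , t ]" := (pairS X s t).
Implicit Types q v : ext K.

Lemma is_diff_quadratic (p : ext K) :
  is_diff p (fun q : ext K => '[q, q] : K^o) (fun v : ext K => '[p, v] *+ 2 : K^o).
Proof.
have sumE q v : '[q, v] = \sum_(I : {set 'I_4}) coef q I * '[mono K I, v].
  have qE : q = \sum_(I : {set 'I_4}) coef q I *: mono K I.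
    apply/rowP => j; rewrite -[j]enum_valK -[LHS]/(coef q (enum_val j)) -[RHS]/(coef _ (enum_val j)).
    rewrite ext_coef_sum (bigD1 (enum_val j)) //= coefZmono eqxx mulr1 big1 ?addr0 // => I ne.
    by rewrite coefZmono eq_sym (negbTE ne) mulr0.
  rewrite {1}qE; elim/big_rec2: _ => [|I x y _ <-]; first by rewrite pairS0l.
  by rewrite pairSDl pairSZl.
pose c I : 'rV[K]_#|{set 'I_4}| -> K^o := fun q => coef q I.
pose l I : 'rV[K]_#|{set 'I_4}| -> K^o := fun q => '[mono K I, q].
have dc I : is_diff p (c I) (c I) by apply: is_diff_functional => a u v; exact: coefP.
have dl I : is_diff p (l I) (l I) by apply: is_diff_functional => a u v; exact: pairS_linear_r.
have -> : (fun q : ext K => '[q, q] : K^o) = \sum_I c I * l I.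
  by apply/funext => q; rewrite fct_sumE sumE.
have -> : (fun v : ext K => '[p, v] *+ 2 : K^o) = \sum_I (c I p *: l I + l I p *: c I).
  apply/funext => v; rewrite fct_sumE mulr2n {2}(pairSC X p) !sumE -big_split.
  by apply: eq_bigr => I _; rewrite [coef v I * _]mulrC.
by apply: is_diff_sum => I; apply: is_diffM.
Qed.

Lemma card_odd_sets : #|[set I : {set 'I_4} | odd #|I|]| = 8%N.
Proof.
rewrite -sum1_card big_mkcond /= (eq_bigr (fun I : {set 'I_4} => nat_of_bool (odd #|I|))).
  by rewrite big_sets !big_bool !card_bitset.
by move=> I _; rewrite inE; case: (odd _).
Qed.

Lemma card_sets : #|{set 'I_4}| = 16%N.
Proof. by rewrite -sum1_card big_sets !big_bool. Qed.

Lemma pairS_even_odd q v : is_even q -> is_odd v -> '[q, v] = 0.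
Proof.
move=> ev od; rewrite (pairS_even_sum _ _ ev) big1 // => I eI; rewrite [I]bitsetE pairS_mono.
move/is_oddP: od => od; rewrite od ?mulr0 //.
move: eI; rewrite [I]bitsetE card_bitset !in_bitset.
by do 4 case: (_ \in I).
Qed.

Variables (w h p p' : ext K).
Hypotheses (w_even : is_even w) (h_even : is_even h) (p_even : is_even p) (p'_even : is_even p').
Hypotheses (ww : '[w, w] != 0) (hh : '[h, h] != 0) (pp' : '[p, p'] != 0).
Hypotheses (wh : '[w, h] = 0) (pw : '[p, w] = 0) (ph : '[p, h] = 0).
Hypotheses (p'w : '[p', w] = 0) (p'h : '[p', h] = 0) (pp : '[p, p] = 0).

(** The equations are the 8 odd coordinates, two linear conditions and one quadric: 11 in dimension
    16, which leaves a cone of dimension 5. *)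
Lemma period_chart : exists m (f : 'rV[K]_#|{set 'I_4}| -> 'rV[K]_m),
  [/\ (m + 5 = #|{set 'I_4}|)%N, forall q, differentiable f q,
      forall q : ext K, f q = 0 <-> [/\ is_even q, '[q, w] = 0, '[q, h] = 0 & '[q, q] = 0] &
      forall y, exists v, 'd f p v = y].
Proof.
pose O := [set I : {set 'I_4} | odd #|I|].
pose eqn (j : 'I_3) : 'rV[K]_#|{set 'I_4}| -> K^o :=
  nth (fun=> 0) [:: (fun q => '[q, w]); (fun q => '[q, h]); (fun q => '[q, q])] j.
pose deqn (p0 : ext K) (j : 'I_3) : 'rV[K]_#|{set 'I_4}| -> K^o :=
  nth (fun=> 0) [:: (fun q => '[q, w]); (fun q => '[q, h]); (fun v => '[p0, v] *+ 2)] j.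
pose g (i : 'I_(#|O| + 3)) := match fintype.split i with
  inl a => (fun q => coef q (enum_val a)) : 'rV[K]_#|{set 'I_4}| -> K^o | inr j => eqn j end.
pose dg p0 (i : 'I_(#|O| + 3)) := match fintype.split i with
  inl a => (fun q => coef q (enum_val a)) : 'rV[K]_#|{set 'I_4}| -> K^o | inr j => deqn p0 j end.
have gl (a : 'I_#|O|) : g (lshift 3 a) = (fun q => coef q (enum_val a)).
  by rewrite /g; case: split_ordP => [b /lshift_inj ->|b /eqP]; rewrite ?eq_lrshift.
have gr (j : 'I_3) : g (rshift _ j) = eqn j.
  by rewrite /g; case: split_ordP => [b /eqP|b /rshift_inj ->]; rewrite ?eq_rlshift.
have dgl p0 (a : 'I_#|O|) : dg p0 (lshift 3 a) = (fun q => coef q (enum_val a)).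
  by rewrite /dg; case: split_ordP => [b /lshift_inj ->|b /eqP]; rewrite ?eq_lrshift.
have dgr p0 (j : 'I_3) : dg p0 (rshift _ j) = deqn p0 j.
  by rewrite /dg; case: split_ordP => [b /eqP|b /rshift_inj ->]; rewrite ?eq_rlshift.
have dgP p0 i : is_diff p0 (g i) (dg p0 i).
  case: (split_ordP i) => [a ->|j ->]; rewrite ?gl ?dgl ?gr ?dgr.
    by apply: is_diff_functional => c u v; exact: coefP.
  case: j => -[|[|[|//]]] lj; rewrite /eqn /deqn /=.
  - by apply: is_diff_functional => c u v; exact: pairS_linear_l.
  - by apply: is_diff_functional => c u v; exact: pairS_linear_l.
  - exact: is_diff_quadratic.
have df p0 := is_diff_row (dgP p0).
exists (#|O| + 3)%N, (fun q => \row_i g i q); split.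
- by rewrite card_odd_sets card_sets.
- by move=> q; have [] := df q.
- move=> q; split=> [f0|[ev qw qh qq]].
    have zr j : eqn j q = 0 by move/rowP: f0 => /(_ (rshift _ j)); rewrite !mxE gr.
    split; [|exact: (zr (@Ordinal 3 0 isT))|exact: (zr (@Ordinal 3 1 isT))|exact: (zr (@Ordinal 3 2 isT))].
    move=> I oI; have IO : I \in O by rewrite inE.
    move/rowP: f0 => /(_ (lshift 3 (enum_rank_in IO I))); rewrite !mxE gl.
    by rewrite enum_rankK_in.
  apply/rowP => i; rewrite !mxE; case: (split_ordP i) => [a ->|j ->]; rewrite ?gl ?gr.
    by apply: ev; have := enum_valP a; rewrite inE.
  by case: j => -[|[|[|//]]] lj.
- move=> y; have [_ ->] := df p.
  pose yr j := y 0 (rshift #|O| j).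
  pose v1 : ext K := \sum_(a : 'I_#|O|) y 0 (lshift 3 a) *: mono K (enum_val a).
  (* The three even differentials at [p] are the pairings with [w], with [h] and with twice [p]; up
     to scale, the vectors [w], [h], [p'] are dual to them. *)
  pose v0 : ext K := (yr (@Ordinal 3 0 isT) / '[w, w]) *: w + (yr (@Ordinal 3 1 isT) / '[h, h]) *: h
     + (yr (@Ordinal 3 2 isT) / ('[p, p'] *+ 2)) *: p'.
  have v0_even : is_even v0 by do 2 (apply: is_evenD; last by apply: is_evenZ); apply: is_evenZ.
  have v1_odd : is_odd v1.
    move=> I eI; rewrite ext_coef_sum big1 // => a _; rewrite coefZmono.
    case: eqP eI => [->|_ _]; last by rewrite mulr0.
    by have := enum_valP a; rewrite inE => ->.
  have pp2 : '[p, p'] *+ 2 != 0 by rewrite mulrn_eq0.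
  exists (v0 + v1); apply/rowP => i; rewrite !mxE; case: (split_ordP i) => [a ->|j ->]; rewrite ?dgl ?dgr.
    have oa : odd #|enum_val a| by have := enum_valP a; rewrite inE.
    rewrite ext_coefD v0_even // add0r ext_coef_sum (bigD1 a) //= coefZmono eqxx mulr1 big1 ?addr0 // => b ne.
    by rewrite coefZmono (inj_eq enum_val_inj) eq_sym (negbTE ne) mulr0.
  have odd0 q : is_even q -> '[v1, q] = 0 by move=> evq; rewrite (pairSC X) pairS_even_odd.
  case: j => -[|[|[|//]]] lj; rewrite /deqn /=.
  - rewrite pairSDl odd0 // addr0 /v0 !pairSDl !pairSZl (pairSC X h) wh p'w !mulr0 !addr0 mulfVK //.
    by congr (y 0 (rshift _ _)); apply: val_inj.
  - rewrite pairSDl odd0 // addr0 /v0 !pairSDl !pairSZl wh p'h !mulr0 addr0 add0r mulfVK //.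
    by congr (y 0 (rshift _ _)); apply: val_inj.
  - rewrite pairSC pairSDl odd0 // addr0 /v0 !pairSDl !pairSZl !(pairSC X _ p) pw ph !mulr0 !add0r.
    rewrite -mulrnAr mulfVK //.
    by congr (y 0 (rshift _ _)); apply: val_inj.
Qed.

End PeriodChart.

(** * Continuity of conjugation and of the hermitian forms *)

Section Continuity.
Variables (R : realType) (X : abelian_surface R) (K : numClosedFieldType).
Local Open Scope classical_set_scope.
Local Notation "'[ s , t ]" := (pairS X s t).

Lemma conjC_continuous : continuous (fun x : K^o => x^* : K^o).
Proof.
move=> x A /= /(nbhs_ballP (x^* : K^o)) [e e0 es]; apply/nbhs_ballP; exists e => // y.
rewrite -ball_normE /= => xy; apply: es; rewrite -ball_normE /=; have -> : x^* - y^* = (x - y)^* by apply/esym; exact: rmorphB.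
by rewrite norm_conjC.
Qed.

Section Products.
Variable N : nat.
Implicit Types f g : 'rV[K]_N -> K^o.

Lemma continuous_const (c : K^o) : continuous (fun _ : 'rV[K]_N => c).
Proof. exact: cst_continuous. Qed.

Lemma continuous_mul f g : continuous f -> continuous g -> continuous (fun q => f q * g q : K^o).
Proof. by move=> cf cg q; exact: (cvgM (cf q) (cg q)). Qed.

Lemma continuous_add f g : continuous f -> continuous g -> continuous (fun q => f q + g q : K^o).
Proof. by move=> cf cg q; exact: (cvgD (cf q) (cg q)). Qed.

Lemma continuous_conj f : continuous f -> continuous (fun q => (f q)^* : K^o).
Proof. by move=> cf q; apply: continuous_comp; [exact: cf | exact: conjC_continuous]. Qed.

End Products.

Lemma continuous_hermS : continuous (fun q : ext K => '[q, conjm q : ext K] : K^o).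
Proof.
have cc I : continuous (fun q : ext K => coef q I : K^o).
  by apply: continuous_functional => a u v; exact: coefP.
have ccj I : continuous (fun q : ext K => coef (conjm q : ext K) I : K^o).
  rewrite (_ : (fun _ => _) = (fun q : ext K => (coef q I)^* : K^o)); first exact: continuous_conj (cc I).
  by apply/funext => q; rewrite /coef mxE.
pose t b0 b1 b2 b3 (q : ext K) : K^o := (-1) ^+ (b1 (+) b3) *
  (coef q (bitset b0 b1 b2 b3) * coef (conjm q : ext K) (bitset (~~ b0) (~~ b1) (~~ b2) (~~ b3))).
have ct b0 b1 b2 b3 : continuous (t b0 b1 b2 b3).
  by apply: continuous_mul; [exact: continuous_const | exact: continuous_mul (cc _) (ccj _)].
have -> : (fun q : ext K => '[q, conjm q : ext K] : K^o) = fun q => orientation X K *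
    \sum_(b0 : bool) \sum_(b1 : bool) \sum_(b2 : bool) \sum_(b3 : bool) t b0 b1 b2 b3 q.
  by apply/funext => q; rewrite pairS_bits.
apply: continuous_mul; first exact: continuous_const.
have csum (F : bool -> ext K -> K^o) : (forall b, continuous (F b)) -> continuous (fun q => \sum_b F b q : K^o).
  move=> cF; rewrite (_ : (fun _ => _) = (fun q => F true q + F false q : K^o)).
    by apply: continuous_add.
  by apply/funext => q; rewrite big_bool.
do 4 (apply: (csum) => ?); exact: ct.
Qed.

Lemma continuous_hermV (f g : ext K -> 'rV[K]_(4 + 4)) :
  (forall a u v, f (a *: u + v) = a *: f u + f v) ->
  (forall a u v, g (a *: u + v) = a *: g u + g v) ->
  continuous (fun q : ext K => pairV (conjm (f q)) (g q) : K^o).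
Proof.
move=> linf ling.
have cg i b : continuous (fun q : ext K => coordV (g q) i b : K^o).
  apply: continuous_functional => a u v; rewrite ling /coordV.
  by case: b; rewrite linearP !mxE.
have cf i b : continuous (fun q : ext K => coordV (conjm (f q)) i b : K^o).
  rewrite (_ : (fun _ => _) = (fun q : ext K => (coordV (f q) i b)^* : K^o)); last first.
    by apply/funext => q; rewrite /coordV; case: b; rewrite !mxE.
  apply: continuous_conj; apply: continuous_functional => a u v; rewrite linf /coordV.
  by case: b; rewrite linearP !mxE.
under eq_fun do rewrite pairVE.
by do 7 (apply: continuous_add; last exact: continuous_mul (cf _ _) (cg _ _)); exact: continuous_mul (cf _ _) (cg _ _).
Qed.

End Continuity.

(** * Local structure of the space of periods *)

Section PeriodTopology.
Variables (R : realType) (X : abelian_surface R) (n : nat) (h : ext int) (K : numClosedFieldType).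
Hypotheses (h_even : is_even h) (h_orth : pairS X h (w_vec X n) = 0) (h_neg : pairS X h h < 0).
Local Notation wK := (map_mx intr (w_vec X n) : ext K).
Local Notation hK := (map_mx intr h : ext K).
Local Open Scope classical_set_scope.

Lemma open_near_value (g : ext K -> K^o) (p : ext K) (e : K) :
  continuous g -> open [set q : ext K | `|g p - g q| < e].
Proof.
move=> cg; have -> : [set q : ext K | `|g p - g q| < e] = g @^-1` (ball (g p) e).
  by apply/seteqP; split => q; rewrite /preimage /= -ball_normE.
by apply: open_comp => [q _|]; [exact: cg | exact: ball_open].
Qed.

(** For the fixed spinor [t], the vector [m_adj X q t] lies in the annihilator of every nearby
    period [q] and is a nonzero multiple of [u] at [q = p]. The continuous function [g] therefore
    tests the sign at all these periods at once. *)
Lemma polarization_locally_constant (p : ext K) s :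
  period_of X n h p -> polarized_by X n h s (spinor_ker p) ->
  \forall q \near p, forall s', period_of X n h (q : ext K) ->
    polarized_by X n h s' (spinor_ker q) -> s' = s.
Proof.
move=> pp [_ pos]; have [ev pw ph null neg] := pp.
have : nz_row (spinor_ker p) != 0 by rewrite nz_row_eq0 -mxrank_eq0 (period_rank pp).
have /spinor_kerP up := nz_row_sub (spinor_ker p).
move: (nz_row _) up => u up u0.
pose t := clifford u (conjm p : ext K).
have odd_t : is_odd t by exact/clifford_even/conj_even.
have N0 := ltr0_neq0 neg.
have pt0 : m_adj X p t != 0.
  have := kernel_decomposition X p u; rewrite up adj0r addr0 => <-.
  by rewrite scaler_eq0 negb_or N0.
pose g q : K^o := pairV (conjm (theta X wK hK (m_adj X (q : ext K) t))) (m_adj X (q : ext K) t).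
have cg : continuous g.
  apply: continuous_hermV => a q1 q2; last exact: adj_linear_l.
  by rewrite adj_linear_l thetaZD.
have gE q : g q = pairV (theta X wK hK (conjm (m_adj X (q : ext K) t))) (m_adj X (q : ext K) t).
  by rewrite /g conj_theta // conj_map_intr.
have gp : 0 < 'i * ((-1) ^+ s * g p).
  by rewrite gE; apply: pos => //; apply/spinor_kerP/adj_in_kernel.
have g0 : 0 < `|g p|.
  rewrite normr_gt0; apply: contraTneq gp => ->; by rewrite !mulr0 ltxx.
have op := @open_near_value g p `|g p| cg.
have : nbhs p [set q : ext K | `|g p - g q| < `|g p| ].
  by apply: open_nbhs_nbhs; split => //=; rewrite subrr normr0.
apply: filterS => q /= close s' qp [_ posq].
have [evq qw qh nullq negq] := qp.
have [q0|qn0] := eqVneq (m_adj X (q : ext K) t) 0.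
  by move: close; rewrite {2}/g q0 pairVC pairV0l subr0 ltxx.
have gq : 0 < 'i * ((-1) ^+ s' * g q).
  by rewrite gE; apply: posq => //; apply/spinor_kerP/adj_in_kernel.
(* For different signs, [g p] and [g q] lie on opposite rays from 0, so their distance is the sum of
   their absolute values, too large for the chosen neighbourhood. *)
apply: contraTeq close => ss'; rewrite -real_leNgt ?normr_real //.
have sE : (-1) ^+ s' = - (-1) ^+ s :> K by case: s ss' {gp pos}; case: s' {gq posq} => //= _; rewrite ?expr0 ?expr1 ?opprK.
rewrite sE in gq.
have nE x : `|'i * ((-1) ^+ s * x)| = `|x| :> K.
  by rewrite !normrM normCi mul1r normrX normrN1 expr1n mul1r.
move: (g p) (g q) gp gq => x y xp yp; rewrite -(nE x) -(nE (x - y)).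
have -> : 'i * ((-1) ^+ s * (x - y)) = 'i * ((-1) ^+ s * x) + 'i * (- (-1) ^+ s * y) by ring.
by rewrite !ger0_norm ?(ltW xp) ?(ltW (addr_gt0 xp yp)) // lerDl ltW.
Qed.

Lemma period_submanifold (p : ext K) : period_of X n h p ->
  exists (m : nat) (U : set 'rV[K]_#|{set 'I_4}|) (f : 'rV[K]_#|{set 'I_4}| -> 'rV[K]_m),
    [/\ (m + 5 = #|{set 'I_4}|)%N, open U /\ U p, forall q, U q -> differentiable f q,
        [set q | period_of X n h (q : ext K)] `&` U = [set q | U q /\ f q = 0] &
        forall y, exists v, 'd f p v = y].
Proof.
move=> pp; have [ev pw ph null neg] := pp.
have wE := wK_even X n K; have hE := hK_even K h_even.
have ww := ltr0_neq0 (wK_neg X n K); have hh := ltr0_neq0 (hK_neg K h_neg).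
have evb := conj_even ev.
have pbw : pairS X (conjm p : ext K) wK = 0 by apply: (conj_orth_w _ pw); exact: conj_map_intr.
have pbh : pairS X (conjm p : ext K) hK = 0 by apply: (conj_orth_w _ ph); exact: conj_map_intr.
have [m [f [mE df f0 surj]]] := period_chart wE hE ev evb ww hh (ltr0_neq0 neg)
  (wK_hK K h_orth) pw ph pbw pbh.
pose g q : K^o := pairS X (q : ext K) (conjm q : ext K).
have cg : continuous g by exact: continuous_hermS.
(* The equations of the chart leave out the inequality [g q < 0]. In the disc of radius [|g p|]
   around the negative number [g p], every real number is negative, and [g] is real valued. *)
exists m, [set q : ext K | `|g p - g q| < `|g p| ], f; split => //.
- split; first exact: open_near_value.
  by rewrite /= subrr normr0 normr_gt0 ltr0_neq0.
- apply/seteqP; split => [q [qp Uq]|q [Uq fq]].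
    by split => //; have [evq qw qh nullq _] := qp; apply/f0.
  split => //; have [evq qw qh nullq] := (proj1 (f0 q)) fq; split => //.
  have g_real : g q \is Num.real by exact: hermS_real.
  rewrite -/(g q) real_ltNge ?real0 //; apply/negP => gq.
  move: Uq; rewrite /= distrC => Uq; have gp0 : g p < 0 by [].
  have : 0 < g q - g p by rewrite subr_gt0; exact: lt_le_trans gp0 gq.
  move=> /gtr0_norm gqp; move: Uq; rewrite gqp (ltr0_norm gp0) ltrBlDr addNr.
  by move=> lt0; have := lt_le_trans lt0 gq; rewrite ltxx.
Qed.

End PeriodTopology.

Section PeriodDomain.
Variables (R : realType) (X : abelian_surface R) (n : nat) (h : ext int).
Hypotheses (h_even : is_even h) (h_orth : pairS X h (w_vec X n) = 0) (h_neg : pairS X h h < 0).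
Local Notation C := (Cplx R).
Local Notation M := (Omega_wh X n h).
Local Notation E := (theta_form X n h).
Local Notation d := (weil_d X n h).
Local Open Scope classical_set_scope.

Lemma Omega_period l : M l <-> period_of X n h l.
Proof.
split=> [[[ev l0 lw ll neg] lh]|[ev lw lh ll neg]]; first exact: And5 ev lw lh ll neg.
exact: conj (And5 ev (period_neq0 neg) lw ll neg) lh.
Qed.

(* The sign for which the polarization is positive. *)
Definition component (l : ext C) : bool := `[< ~ polarized_by X n h false (spinor_ker l) >].

Lemma spinor_ker_neq0 l : period_of X n h (l : ext C) -> spinor_ker l != 0.
Proof. by move=> pl; rewrite -mxrank_eq0 (period_rank pl). Qed.

Lemma component_unique l s : period_of X n h (l : ext C) ->
  polarized_by X n h s (spinor_ker l) -> component l = s.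
Proof.
move=> pl ps; rewrite /component; case: s ps => ps; last by apply/asboolPn; apply.
by apply/asboolP => pf; have := polarized_by_unique (spinor_ker_neq0 pl) ps pf.
Qed.

Lemma component_polarized l : period_of X n h (l : ext C) ->
  polarized_by X n h (component l) (spinor_ker l).
Proof.
move=> pl; have [s ps] := period_polarized h_even h_orth h_neg pl.
by rewrite (component_unique pl ps).
Qed.

Lemma spinor_kerZ (c : C) (l : ext C) : c != 0 -> (spinor_ker l :=: spinor_ker (c *: l))%MS.
Proof.
move=> c0; apply/eqmxP/andP; split; apply/row_subP => i; apply/spinor_kerP.
  have /spinor_kerP e := row_sub i (spinor_ker l).
  by rewrite cliffordZr e scaler0.
have /spinor_kerP := row_sub i (spinor_ker (c *: l)).
by rewrite cliffordZr => /eqP; rewrite scaler_eq0 (negbTE c0) => /eqP.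
Qed.

Lemma period_ofZ (c : C) (l : ext C) : c != 0 -> period_of X n h l -> period_of X n h (c *: l).
Proof.
move=> c0 [ev lw lh ll neg]; split.
- exact: is_evenZ.
- by rewrite pairSZl lw mulr0.
- by rewrite pairSZl lh mulr0.
- by rewrite pairSZl pairSZr ll !mulr0.
- by rewrite conj_mxZ pairSZl pairSZr mulrA pmulr_rlt0 // mul_conjC_gt0.
Qed.

Lemma componentZ (c : C) (l : ext C) : c != 0 -> period_of X n h l -> component (c *: l) = component l.
Proof.
move=> c0 pl; apply: component_unique; first exact: period_ofZ.
by apply: polarized_by_eqmx (spinor_kerZ l c0) _; exact: component_polarized.
Qed.

Lemma component_continuous : {within M, continuous component}.
Proof.
apply/subspace_continuousP => p /Omega_period pp; apply: cvg_near_cst; rewrite near_withinE.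
have := polarization_locally_constant pp (component_polarized pp).
apply: filterS => q near_q /Omega_period qp.
exact: near_q qp (component_polarized qp).
Qed.

Lemma Omega_projective_submanifold : projective_submanifold 4 M.
Proof.
split=> [/Omega_period[_ _ _ _]|c l c0 /Omega_period pl|p /Omega_period pp].
- by rewrite pairS0l ltxx.
- exact/Omega_period/period_ofZ.
have [m [U [f [mE oU df Uf surj]]]] := period_submanifold h_even h_orth h_neg pp.
exists m, U, f; split => //; rewrite -Uf; congr (_ `&` _).
by apply/seteqP; split => q /Omega_period.
Qed.

Lemma Omega_nonempty : M !=set0.
Proof.
have [l [ev lw lh ll neg]] := exists_period X C h n.
by exists l; apply/Omega_period; split.
Qed.

Local Notation eta := (qeta_rmorphism (theta_rat_sqr h_even h_orth)).

Lemma eta_X : eta 'qX = map_mx intr (theta_end X n h).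
Proof. exact: qeta_X. Qed.

Lemma period_weil_type l : M l -> weil_type eta ((-1) ^+ component l *: E) (Zker l).
Proof.
move=> /Omega_period pl; split.
- exact: weil_d_gt0.
- split; first by rewrite -[Zker l]/(spinor_ker l) (period_rank pl).
  by rewrite -[Zker l]/(spinor_ker l) -[conj_mx _]/(conjm _) (period_cap pl) mxrank0.
- by move=> k; apply: (qeta_stable h_even h_orth k); exact: (period_stable h_even pl).
- rewrite eta_X map_ratr_theta.
  by apply: (period_eigen_rank h_even h_orth h_neg pl); left.
- rewrite eta_X map_ratr_theta.
  by apply: (period_eigen_rank h_even h_orth h_neg pl); right.
- exact: (proj2 (riemann_conditionsE h_orth (component l) (spinor_ker l))) (component_polarized pl).
- rewrite eta_X; exact: theta_similitude.
Qed.

Lemma weil_type_period (s : bool) (G : 'M[C]_(4 + 4)) : weil_type eta ((-1) ^+ s *: E) G ->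
  exists l, [/\ M l, component l = s & (Zker l == G)%MS].
Proof.
move=> [_ [rk _] stab _ eig pol _].
have rkG : \rank G = 4%N by apply: double_inj.
have stG : stablemx G (map_mx intr (theta_end X n h)).
  by have := stab 'qX; rewrite eta_X map_ratr_theta.
have pG : polarized_by X n h s G := proj1 (riemann_conditionsE h_orth s G) pol.
rewrite eta_X map_ratr_theta in eig.
have [l [pl e]] := period_of_polarized h_even h_orth h_neg rkG stG pG eig.
exists l; split.
- exact/Omega_period.
- by apply: component_unique pl _; exact: polarized_by_eqmx e pG.
- exact/eqmxP/eqmx_sym.
Qed.

End PeriodDomain.

Theorem proposition1p7 (R : realType) (X : abelian_surface R) (n : nat)
    (h : ext int) (n_ge2 : (2 <= n)%N) (h_even : is_even h)
    (h_orth : pairS X h (w_vec X n) = 0) (h_neg : pairS X h h < 0) :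
  exists (eta : {rmorphism quadratic (weil_d X n h) -> 'M[rat]_(4 + 4)})
         (sgn : ext (Cplx R) -> bool),
    complete_weil_family (map_mx intr (theta_end X n h)) (theta_form X n h)
      (Omega_wh X n h) (@Zker R) eta sgn.
Proof.
exists (qeta_rmorphism (theta_rat_sqr h_even h_orth)), (component X n h); split.
- by split; [exact: Omega_nonempty | exact: Omega_projective_submanifold].
- exact: eta_X.
- exact: component_continuous.
- by move=> c l c0 /Omega_period; exact: componentZ.
- by move=> l; exact: period_weil_type.
- by move=> l _; exact: weil_discriminant.
- move=> l l' /Omega_period pl /Omega_period pl' /andP[sub _].
  exact: period_of_unique pl pl' sub.
- by move=> s G; exact: weil_type_period.
Qed.
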